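(* Let $\Omega\subset\mathbb{R}^n$ ($n\ge 2$) be a bounded $C^\infty$-domain and let $D$ be an open set with $\overline{D}\subset\Omega$. Assume there exist a function $q_0\in H^s(\Omega)$ for some $s>n/2$ with $s>2$, $q_0\le 0$ in $\Omega$, a function $q_1\in L^\infty(\Omega)$ of the form $q_1=q_{1,b}+\chi_D q_{1,D}$ in $\Omega$ with $q_{1,b},q_{1,D}\in L^\infty(\Omega)$ and with $\inf_{x\in D}q_{1,D}(x)\ge\mu$ or $\sup_{x\in D}q_{1,D}(x)\le-\mu$ for some constant $\mu>0$, a constant $C_*>0$ and real numbers $\alpha_2>\alpha_1>0$ such that $$\big\|q(\cdot,|z_1|)z_1-q(\cdot,|z_2|)z_2-q_0(z_1-z_2)-q_1\,(|z_1|^{\alpha_1}z_1-|z_2|^{\alpha_1}z_2)\big\|_{L^\infty(\Omega)}\le C_*\big(|z_1|^{\alpha_2}+|z_2|^{\alpha_2}\big)|z_1-z_2|$$ for all $z_1,z_2\in\mathbb{C}$ with $|z_1|\le1$, $|z_2|\le 1$. Let $\omega\in\mathbb{S}^{n-1}$, choose $\omega^\perp\in\mathbb{S}^{n-1}$ with $\omega\cdot\omega^\perp=0$, put $b(\omega)=\inf_{x\in\Omega}\omega\cdot x$, $B(\omega)=\sup_{x\in\Omega}\omega\cdot x$, $t_*:=\inf_{x\in D}\omega\cdot x$, and choose $J,t\in\mathbb{R}$ with $$J>\max\left\{\frac{(B(\omega)-b(\omega))(2+2\alpha_1)}{\alpha_1},\ \frac{(B(\omega)-b(\omega))(2+\alpha_2)}{\alpha_2-\alpha_1}\right\},\qquad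 b(\omega)<t<B(\omega).$$ For small $h>0$ let $f_h=v_h|_{\partial\Omega}$ be the Dirichlet trace of the rescaled complex geometrical optics solution $v_h$ with parameters $\omega,\omega^\perp,t,J$, and let $\mathcal{I}$ be the indicator functional (both defined in the context). Then: (i) If $\{x:\omega\cdot x\le t\}\cap\overline{D}=\emptyset$, that is, $t<t_*$, then $\lim_{h\searrow0}e^{\frac{(\alpha_1+2)J}{h}}|\mathcal{I}(f_h)|=0$. (ii) If $\{x:\omega\cdot x\le t\}\cap D\ne\emptyset$, that is, $t>t_*$, then $\lim_{h\searrow0}e^{\frac{(\alpha_1+2)J}{h}}|\mathcal{I}(f_h)|=+\infty$.
   Context: Function spaces consist of complex-valued functions; $q_0$, and $q_{1,D}$ on $D$, are real-valued. $q=q(x,s)$ is a function on $\Omega\times[0,\infty)$, measurable in $x$; the displayed $L^\infty(\Omega)$ inequality is understood to hold for a.e. $x\in\Omega$ simultaneously for all admissible $z_1,z_2$. $\mathcal{A}^2(\Omega):=H^2(\Omega)\cap L^\infty(\Omega)$ with norm $\|\cdot\|_{H^2(\Omega)}+\|\cdot\|_{L^\infty(\Omega)}$; $\mathcal{A}^{3/2}(\partial\Omega):=H^{3/2}(\partial\Omega)\cap L^\infty(\partial\Omega)$ with norm $\|\cdot\|_{H^{3/2}(\partial\Omega)}+\|\cdot\|_{L^\infty(\partial\Omega)}$; $U_{\delta_0}:=\{f\in\mathcal{A}^{3/2}(\partial\Omega):\|f\|_{\mathcal{A}^{3/2}(\partial\Omega)}\le\delta_0\}$. For $f\in\mathcal{A}^{3/2}(\partial\Omega)$,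 $v_f\in\mathcal{A}^2(\Omega)$ is the unique solution of $(\Delta+q_0)v_f=0$ in $\Omega$, $v_f|_{\partial\Omega}=f$. Well-posedness: with $\alpha=\alpha_1$ and $C_{\rm Kerr}=C_*+2^{\max\{1,\alpha_1\}}\|q_1\|_{L^\infty(\Omega)}$, there is a sufficiently small $\delta_0\in(0,1)$ such that for each $f\in U_{\delta_0}$ the problem $\Delta u_f+q(x,|u_f|)u_f=0$ in $\Omega$, $u_f|_{\partial\Omega}=f$, has a unique solution $u_f\in\mathcal{A}^2(\Omega)$ satisfying $\|u_f-v_f\|_{\mathcal{A}^2(\Omega)}\le C_{\rm Kerr}C^{1+\alpha}(1+\|q_0\|_{L^\infty(\Omega)})^{2+\alpha}\|f\|_{\mathcal{A}^{3/2}(\partial\Omega)}^{1+\alpha}$ and $\|u_f\|_{\mathcal{A}^2(\Omega)}\le C(1+\|q_0\|_{L^\infty(\Omega)})\|f\|_{\mathcal{A}^{3/2}(\partial\Omega)}$ with a constant $C=C(\Omega)>1$; $u_f$ denotes this solution, and $\delta_0$ is taken small enough that $\|u_f\|_{L^\infty(\Omega)},\|v_f\|_{L^\infty(\Omega)}\le1$. Background approximate solution: $\tilde u_{b,f}$ is the unique solution of $\Delta\tilde u_{b,f}+q_0\tilde u_{b,f}=-q_{1,b}|v_f|^{\alpha_1}v_f$ in $\Omega$, $\tilde u_{b,f}|_{\partial\Omega}=f$. Indicator functional: $\mathcal{I}(f):=\int_{\partial\Omega}(\partial_\nu u_f-\partial_\nu\tilde u_{b,f})\overline{f}\,dS$ for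 $f\in U_{\delta_0}$, where $\nu$ is the outward unit normal. CGO solutions (known construction): with $\rho=\omega+\mathbf{i}\omega^\perp$, there are $h_0>0$ and $C>0$ independent of $h$ such that for every $h\in(0,h_0)$ there is $r_\rho$ (depending on $h$) with $\|r_\rho\|_{H^s(\Omega)}\le Ch\|q_0\|_{H^s(\Omega)}$ (hence also $\|r_\rho\|_{\mathcal{A}^2(\Omega)}\le Ch\|q_0\|_{H^s(\Omega)}$) such that $e^{-\rho\cdot x/h}(1+r_\rho)$ solves $(\Delta+q_0)v=0$ in $\Omega$. The rescaled solution is $$v_h=e^{-\frac{J-t}{h}}e^{-\frac{\rho\cdot x}{h}}(1+r_\rho)=e^{-\frac{J}{h}}e^{-\frac1h(\omega\cdot x-t+\mathbf{i}\omega^\perp\cdot x)}(1+r_\rho),$$ and $f_h:=v_h|_{\partial\Omega}$. For $J,t$ with $J>\max\left\{\frac{(B(\omega)-b(\omega))(2+2\alpha_1)}{\alpha_1},\frac{(B(\omega)-b(\omega))(2+\alpha_2)}{\alpha_2-\alpha_1}\right\}$ and $b(\omega)<t<B(\omega)$ one has $f_h\in U_{\delta_0}$ for all sufficiently small $h$, so $\mathcal{I}(f_h)$ is defined. *)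

(* Defs.v *)
From HB Require Import structures.
From mathcomp Require Import all_boot all_order all_algebra.
From mathcomp Require Import all_classical all_reals all_analysis.
From mathcomp Require Import complex.

Set Implicit Arguments.
Unset Strict Implicit.
Unset Printing Implicit Defensive.

Import Order.TTheory GRing.Theory Num.Theory.
Import numFieldNormedType.Exports.

Local Open Scope classical_set_scope.
Local Open Scope ring_scope.

(* The sigma-algebra on R^n generated by the coordinates, i.e. the Borel sets;
   this is the construction the library uses for n.-tuple T. *)
Definition measure_rV_display : measure_display.
Proof. exact: default_measure_display. Qed.

Section measurable_rV.
Context {R : realType} {n : nat}.

Definition coordinate (i : 'I_n) (x : 'rV[R]_n) : measurableTypeR R := x ord0 i.

Let rV_set0 : g_sigma_preimage coordinate set0.
Proof. exact: sigma_algebra0. Qed.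

Let rV_setC A : g_sigma_preimage coordinate A -> g_sigma_preimage coordinate (~` A).
Proof. exact: sigma_algebraC. Qed.

Let rV_bigcup (F : _^nat) : (forall i, g_sigma_preimage coordinate (F i)) ->
  g_sigma_preimage coordinate (\bigcup_i (F i)).
Proof. exact: sigma_algebra_bigcup. Qed.

HB.instance Definition _ := @isMeasurable.Build measure_rV_display
  'rV[R]_n (g_sigma_preimage coordinate) rV_set0 rV_setC rV_bigcup.

Lemma measurable_coordinate (i : 'I_n) : measurable_fun [set: 'rV[R]_n] (coordinate i).
Proof.
move=> _ Y mY; rewrite setTI; apply: sub_sigma_algebra => /=.
rewrite -bigcup_seq/=; exists i => /=; first by rewrite mem_index_enum.
by exists Y => //; rewrite setTI.
Qed.

Lemma measurable_rVP d (T : measurableType d) (f : T -> 'rV[R]_n) :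
  (forall i, measurable_fun [set: T] (coordinate i \o f)) ->
  measurable_fun [set: T] f.
Proof.
move=> mf.
have sub : g_sigma_preimage (fun i => coordinate i \o f) `<=` measurable.
  apply: smallest_sub; first exact: sigma_algebra_measurable.
  by rewrite -bigcup_seq; apply: bigcup_sub => i _ A [B mB <-]; exact: mf.
move=> _ A mA; apply: sub.
by rewrite g_sigma_preimage_comp; exists A.
Qed.

End measurable_rV.

(* [insert_coord i a y] is the point of R^n whose i-th coordinate is a and whose
   remaining coordinates, in order, are those of y. *)
Definition insert_coord (R : realType) (n : nat) (i : 'I_n) (a : R)
    (y : 'rV[R]_n.-1) : 'rV[R]_n :=
  \row_j oapp (y ord0) a (unlift i j).

Section lebesgue_rV.
Context {R : realType}.

Definition cons_coord (n : nat) (p : measurableTypeR R * 'rV[R]_n) : 'rV[R]_n.+1 :=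
  @insert_coord R n.+1 ord0 p.1 p.2.

Lemma measurable_cons_coord n : measurable_fun setT (@cons_coord n).
Proof.
apply: measurable_rVP => i.
have [j ->|->] := unliftP ord0 i.
  rewrite (_ : _ \o _ = coordinate j \o snd).
    by apply: measurableT_comp => //; exact: measurable_coordinate.
  by apply/funext => -[a y]; rewrite /= /coordinate /cons_coord mxE liftK.
rewrite (_ : _ \o _ = fst); first exact: measurable_fst.
by apply/funext => -[a y]; rewrite /= /coordinate /cons_coord mxE unlift_none.
Qed.

Local Open Scope ereal_scope.

Section cons_measure.
Context (n : nat) (mu : {sigma_finite_measure set 'rV[R]_n -> \bar R}).

Definition cons_measure : set 'rV[R]_n.+1 -> \bar R :=
  pushforward (@lebesgue_measure R \x mu) (@cons_coord n).

Let cons_measure0 : cons_measure set0 = 0.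
Proof. by rewrite /cons_measure /pushforward preimage_set0 measure0. Qed.

Let cons_measure_ge0 A : 0 <= cons_measure A.
Proof. by rewrite /cons_measure /pushforward; apply: measure_ge0. Qed.

Let cons_measure_sigma_additive : semi_sigma_additive cons_measure.
Proof.
move=> F mF tF mUF; rewrite /cons_measure /pushforward preimage_bigcup.
have mcons A : measurable A -> measurable (@cons_coord n @^-1` A).
  by move=> mA; rewrite -[X in measurable X]setTI; exact: measurable_cons_coord.
apply: measure_semi_sigma_additive.
- by move=> k; exact: mcons.
- apply/trivIsetP => /= i j _ _ ij; rewrite -preimage_setI.
  by move/trivIsetP : tF => /(_ _ _ _ _ ij) ->//; rewrite preimage_set0.
- by rewrite -preimage_bigcup; exact: mcons.
Qed.

HB.instance Definition _ := isMeasure.Build _ _ _ cons_measure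
  cons_measure0 cons_measure_ge0 cons_measure_sigma_additive.

Let uncons (x : 'rV[R]_n.+1) : measurableTypeR R * 'rV[R]_n :=
  (coordinate ord0 x, \row_j coordinate (lift ord0 j) x).

Let unconsK : cancel (@cons_coord n) uncons.
Proof.
move=> [a y]; rewrite /uncons /coordinate /cons_coord mxE unlift_none /=.
by congr pair; apply/rowP => j; rewrite !mxE liftK.
Qed.

Let measurable_uncons : measurable_fun setT uncons.
Proof.
apply/measurable_fun_pair; first exact: measurable_coordinate.
apply: measurable_rVP => j.
rewrite (_ : _ \o _ = coordinate (lift ord0 j)); first exact: measurable_coordinate.
by apply/funext => x; rewrite /= /coordinate mxE.
Qed.

Let cons_measure_sigma_finite : sigma_finite setT cons_measure.
Proof.
have /sigma_finiteP[F [TF ndF Foo]] := sigma_finiteT (@lebesgue_measure R).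
have /sigma_finiteP[G [TG ndG Goo]] := sigma_finiteT mu.
exists (fun k => uncons @^-1` (F k `*` G k)).
  rewrite predeqE => x; split=> // _.
  have [k _ Fx] : (\bigcup_k F k) (uncons x).1 by rewrite -TF.
  have [l _ Gx] : (\bigcup_k G k) (uncons x).2 by rewrite -TG.
  exists (maxn k l) => //; split.
    by move: Fx; exact/subsetPset/ndF/leq_maxl.
  by move: Gx; exact/subsetPset/ndG/leq_maxr.
move=> k; have [mF Fkoo] := Foo k; have [mG Gkoo] := Goo k; split.
  by rewrite -[X in measurable X]setTI;
    apply: measurable_uncons => //; exact: measurableX.
rewrite /cons_measure /pushforward -comp_preimage.
rewrite (_ : uncons \o _ = id); last by apply/funext => x /=; rewrite unconsK.
by rewrite preimage_id product_measure1E// lte_mul_pinfty// ge0_fin_numE.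
Qed.

HB.instance Definition _ := Measure_isSigmaFinite.Build _ _ _ cons_measure
  cons_measure_sigma_finite.

End cons_measure.

Fixpoint lebesgue_rV (n : nat) : {sigma_finite_measure set 'rV[R]_n -> \bar R} :=
  match n with
  | 0 => dirac (0%R : 'rV[R]_0)
  | n'.+1 => cons_measure (lebesgue_rV n')
  end.

Lemma lebesgue_rV_box n (A : 'I_n -> set (measurableTypeR R)) :
  (forall i, measurable (A i)) ->
  lebesgue_rV n [set x | forall i, A i (x ord0 i)] =
  \prod_(i < n) lebesgue_measure (A i).
Proof.
elim: n A => [|n IHn] A mA /=.
  rewrite big_ord0 diracE mem_set//; by case.
rewrite big_ord_recl -IHn//.
have consE : @cons_coord n @^-1` [set x | forall i, A i (x ord0 i)] =
    A ord0 `*` [set x : 'rV[R]_n | forall i : 'I_n, A (lift ord0 i) (x ord0 i)].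
  apply/seteqP; split=> -[a y] /=.
    move=> H; split=> [|i].
      by have := H ord0; rewrite /cons_coord mxE unlift_none.
    by have := H (lift ord0 i); rewrite /cons_coord mxE liftK.
  move=> [Aa Ay] i; have [j ->|->] := unliftP ord0 i; rewrite /cons_coord mxE.
    by rewrite liftK; exact: Ay.
  by rewrite unlift_none.
transitivity ((@lebesgue_measure R \x lebesgue_rV n)
  (@cons_coord n @^-1` [set x | forall i, A i (x ord0 i)])); first by [].
rewrite consE; apply: product_measure1E => //.
rewrite (_ : [set x : 'rV[R]_n | _] =
    \bigcap_(i in setT) (coordinate i @^-1` A (lift ord0 i))).
  apply: fin_bigcap_measurable => // i _.
  by rewrite -[X in measurable X]setTI; apply: measurable_coordinate.
by apply/seteqP; split=> [x Ax i _|x Ax i]; apply: Ax.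
Qed.

End lebesgue_rV.

Section euclidean.
Context {R : realType} {n : nat}.
Implicit Types x y : 'rV[R]_n.

Definition dot x y : R := \sum_(i < n) x ord0 i * y ord0 i.

(* The library norm on 'rV[R]_n is the sup norm. *)
Definition enorm x : R := Num.sqrt (dot x x).

Definition basis_vec (i : 'I_n) : 'rV[R]_n := delta_mx ord0 i.

Definition bd (A : set 'rV[R]_n) : set 'rV[R]_n := closure A `\` interior A.

(* pderiv [:: i1; ...; ik] f = d_i1 ... d_ik f *)
Fixpoint pderiv (a : seq 'I_n) (f : 'rV[R]_n -> R) : 'rV[R]_n -> R :=
  if a is i :: a' then fun x => 'D_(basis_vec i) (pderiv a' f) x else f.

Definition smooth (f : 'rV[R]_n -> R) : Prop :=
  forall a : seq 'I_n, continuous (pderiv a f) /\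
    forall (i : 'I_n) x, derivable (pderiv a f) x (basis_vec i).

Definition test_function (Omega : set 'rV[R]_n) (phi : 'rV[R]_n -> R) : Prop :=
  smooth phi /\ exists K : set 'rV[R]_n,
    [/\ compact K, K `<=` Omega & forall x, ~ K x -> phi x = 0].

End euclidean.

Section smooth_domain.
Context {R : realType} {n : nat}.

(* Within the ball, Omega is the strict epigraph (b = true) or hypograph
   (b = false) of g in the direction of the i-th axis; col' i x is x without
   its i-th coordinate. *)
Definition boundary_chart (Omega : set 'rV[R]_n) (p : 'rV[R]_n) (i : 'I_n)
    (b : bool) (g : 'rV[R]_n.-1 -> R) (r : R) : Prop :=
  [/\ smooth g, 0 < r & forall x, ball p r x ->
    (Omega x <-> if b then g (col' i x) < x ord0 i else x ord0 i < g (col' i x))].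

Definition bounded_smooth_domain (Omega : set 'rV[R]_n) : Prop :=
  [/\ open Omega, connected Omega, bounded_set Omega &
    forall p, bd Omega p -> exists i b g r, boundary_chart Omega p i b g r].

Definition area_factor (g : 'rV[R]_n.-1 -> R) (y : 'rV[R]_n.-1) : R :=
  Num.sqrt (1 + \sum_(k < n.-1) pderiv [:: k] g y ^+ 2).

(* sigma is the measure dS on bd Omega, extended by 0 outside bd Omega. *)
Definition surface_measure (Omega : set 'rV[R]_n)
    (sigma : {measure set 'rV[R]_n -> \bar R}) : Prop :=
  sigma (~` bd Omega) = 0%E /\
  forall p i b g r, boundary_chart Omega p i b g r ->
  forall A : set 'rV[R]_n, measurable A -> A `<=` ball p r ->
    sigma (A `&` bd Omega) =
    (\int[lebesgue_rV n.-1]_(y in [set y | A (insert_coord i (g y) y)])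
       (area_factor g y)%:E)%E.

Definition outward_unit_normal (Omega : set 'rV[R]_n)
    (nu : 'rV[R]_n -> 'rV[R]_n) : Prop :=
  forall p i b g r, boundary_chart Omega p i b g r ->
  forall x, bd Omega x -> ball p r x ->
    nu x = ((-1) ^+ b / area_factor g (col' i x)) *:
           insert_coord i 1 (- \row_k pderiv [:: k] g (col' i x)).

End smooth_domain.

Section complex_functions.
Context {R : realType}.
Local Open Scope complex_scope.

Definition cabs (z : R[i]) : R := ComplexField.Normc.normc z.

Definition cexp (z : R[i]) : R[i] :=
  (expR (complex.Re z))%:C * (cos (complex.Im z) +i* sin (complex.Im z)).

Section measure.
Context d (T : measurableType d) (mu : {measure set T -> \bar R}) (A : set T).

Definition cmeasurable (f : T -> R[i]) : Prop :=
  measurable_fun A (fun x => complex.Re (f x) : R) /\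
  measurable_fun A (fun x => complex.Im (f x) : R).

Definition cintegral (f : T -> R[i]) : R[i] :=
  (\int[mu]_(x in A) complex.Re (f x)) +i* (\int[mu]_(x in A) complex.Im (f x)).

Definition enormL (p : \bar R) (f : T -> R[i]) : \bar R :=
  ('N[mu]_p[(fun x => (cabs (f x))%:E) \_ A])%E.

Definition memL (p : \bar R) (f : T -> R[i]) : Prop :=
  cmeasurable f /\ (enormL p f < +oo)%E.

Definition normL (p : \bar R) (f : T -> R[i]) : R := fine (enormL p f).

End measure.
End complex_functions.

Section sobolev.
Context {R : realType} {n : nat}.
Implicit Types (Omega : set 'rV[R]_n) (u w f g : 'rV[R]_n -> R[i]).
Local Open Scope complex_scope.

Let leb : {measure set 'rV[R]_n -> \bar R} := lebesgue_rV n.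

(* w is the weak derivative d_a u in Omega, and is in L^2(Omega). *)
Definition is_wderiv Omega (a : seq 'I_n) u w : Prop :=
  memL leb Omega 2%:E w /\
  forall phi, test_function Omega phi ->
    cintegral leb Omega (fun x => u x * (pderiv a phi x)%:C) =
    (-1) ^+ size a * cintegral leb Omega (fun x => w x * (phi x)%:C).

Definition wderiv Omega (a : seq 'I_n) u : 'rV[R]_n -> R[i] :=
  xget (fun=> 0) [set w | is_wderiv Omega a u w].

Definition laplacian Omega u : 'rV[R]_n -> R[i] :=
  fun x => \sum_(i < n) wderiv Omega [:: i; i] u x.

(* Sobolev-Slobodeckij norm of H^s(Omega) for s >= 0, with s = k + theta,
   k integer and 0 <= theta < 1. A mixed derivative is counted once for each
   ordering of its indices. *)
Definition enormH Omega (s : R) u : \bar R :=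
  let k := Num.truncn s in
  let theta := s - k%:R in
  ((\sum_(j < k.+1) \sum_(a : j.-tuple 'I_n)
      enormL leb Omega 2%:E (wderiv Omega a u) `^ 2 +
    if (theta == 0)%R then 0 else
    \sum_(a : k.-tuple 'I_n)
      \int[leb]_(x in Omega) \int[leb]_(y in Omega)
        (cabs (wderiv Omega a u x - wderiv Omega a u y) ^+ 2 /
         enorm (x - y) `^ (n%:R + 2 * theta))%R%:E) `^ 2^-1)%E.

Definition memH Omega (s : R) u : Prop :=
  [/\ memL leb Omega 2%:E u,
      forall j (a : j.-tuple 'I_n), (j <= Num.truncn s)%N ->
        exists w, is_wderiv Omega a u w &
      (enormH Omega s u < +oo)%E].

Definition normH Omega (s : R) u : R := fine (enormH Omega s u).

Definition memA2 Omega u : Prop := memH Omega 2 u /\ memL leb Omega +oo%E u.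

Definition normA2 Omega u : R := normH Omega 2 u + normL leb Omega +oo%E u.

Section boundary.
Variables (Omega : set 'rV[R]_n) (sigma : {measure set 'rV[R]_n -> \bar R}).

(* g is the trace of u in H^1(Omega): u_k -> u in H^1(Omega) and u_k -> g in
   L^2(bd Omega) for some u_k smooth up to the boundary. *)
Definition is_trace u g : Prop :=
  memL sigma (bd Omega) 2%:E g /\
  exists uk : nat -> 'rV[R]_n -> R[i],
    [/\ forall k, smooth (fun x => complex.Re (uk k x)) /\
                  smooth (fun x => complex.Im (uk k x)),
        normH Omega 1 (fun x => uk k x - u x) @[k --> \oo] --> (0 : R) &
        normL sigma (bd Omega) 2%:E (fun x => uk k x - g x)
          @[k --> \oo] --> (0 : R)].

Definition trace_operator (tr : ('rV[R]_n -> R[i]) -> 'rV[R]_n -> R[i]) : Prop :=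
  forall u, memH Omega 1 u -> is_trace u (tr u).

Variable tr : ('rV[R]_n -> R[i]) -> 'rV[R]_n -> R[i].

Definition boundary_value u f : Prop :=
  {ae sigma, forall x, bd Omega x -> tr u x = f x}.

(* H^{3/2}(bd Omega) is the trace space of H^2(Omega), with the quotient norm. *)
Definition normH32 f : R :=
  inf [set normH Omega 2 w | w in [set w | memH Omega 2 w /\ boundary_value w f]].

Definition memA32 f : Prop :=
  (exists w, memH Omega 2 w /\ boundary_value w f) /\
  memL sigma (bd Omega) +oo%E f.

Definition normA32 f : R := normH32 f + normL sigma (bd Omega) +oo%E f.

Definition small_data (delta0 : R) f : Prop := memA32 f /\ normA32 f <= delta0.

Definition normal_derivative (nu : 'rV[R]_n -> 'rV[R]_n) u : 'rV[R]_n -> R[i] :=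
  fun x => \sum_(i < n) (nu x ord0 i)%:C * tr (wderiv Omega [:: i] u) x.

End boundary.
End sobolev.

Section problem.
Context {R : realType} {n : nat}.
Variables (Omega : set 'rV[R]_n) (sigma : {measure set 'rV[R]_n -> \bar R}).
Variable tr : ('rV[R]_n -> R[i]) -> 'rV[R]_n -> R[i].
Implicit Types (f u v w : 'rV[R]_n -> R[i]).
Local Open Scope complex_scope.

Let leb : {measure set 'rV[R]_n -> \bar R} := lebesgue_rV n.

Definition solves_schrodinger (q0 : 'rV[R]_n -> R) v : Prop :=
  memH Omega 2 v /\
  {ae leb, forall x, Omega x -> laplacian Omega v x + (q0 x)%:C * v x = 0}.

Definition linear_solution (q0 : 'rV[R]_n -> R) f v : Prop :=
  [/\ memA2 Omega v, solves_schrodinger q0 v & boundary_value Omega sigma tr v f].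

Definition kerr_solution (q : 'rV[R]_n -> R -> R[i]) f u : Prop :=
  [/\ memA2 Omega u,
      {ae leb, forall x, Omega x ->
         laplacian Omega u x + q x (cabs (u x)) * u x = 0} &
      boundary_value Omega sigma tr u f].

Definition background_solution (q0 : 'rV[R]_n -> R) (q1b : 'rV[R]_n -> R[i])
    (alpha : R) f v w : Prop :=
  [/\ memH Omega 2 w,
      {ae leb, forall x, Omega x ->
         laplacian Omega w x + (q0 x)%:C * w x =
         - q1b x * (cabs (v x) `^ alpha)%:C * v x} &
      boundary_value Omega sigma tr w f].

Definition unique_with (P : ('rV[R]_n -> R[i]) -> Prop) u : Prop :=
  P u /\ forall w, P w -> {ae leb, forall x, Omega x -> w x = u x}.

Definition kerr_estimates (q0 : 'rV[R]_n -> R) (CKerr C alpha : R) f v u : Prop :=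
  let Q := 1 + normL leb Omega +oo%E (fun x => (q0 x)%:C) in
  normA2 Omega (fun x => u x - v x) <=
    CKerr * C `^ (1 + alpha) * Q `^ (2 + alpha) *
    normA32 Omega sigma tr f `^ (1 + alpha) /\
  normA2 Omega u <= C * Q * normA32 Omega sigma tr f.

Definition indicator_functional (nu : 'rV[R]_n -> 'rV[R]_n) u w f : R[i] :=
  cintegral sigma (bd Omega) (fun x =>
    (normal_derivative Omega tr nu u x - normal_derivative Omega tr nu w x) *
    (f x)^*).

End problem.

Section cgo.
Context {R : realType} {n : nat}.
Local Open Scope complex_scope.

Definition cgo_solution (omega omegap : 'rV[R]_n) (h : R)
    (r : 'rV[R]_n -> R[i]) : 'rV[R]_n -> R[i] :=
  fun x => cexp (- ((dot omega x +i* dot omegap x) / h%:C)) * (1 + r x).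

Definition rescaled_cgo (omega omegap : 'rV[R]_n) (J t h : R)
    (r : 'rV[R]_n -> R[i]) : 'rV[R]_n -> R[i] :=
  fun x => (expR (- ((J - t) / h)))%:C * cgo_solution omega omegap h r x.

End cgo.

(* Main.v *)
(* Testing the equations of u_f and of the background approximation against the CGO solution v_h
   with Green's formula turns the indicator into a bulk integral:
     I(f_h) = - int_D q_{1,D} |v_h|^(alpha1 + 2) + error,
   where the error collects the higher order part of the nonlinearity and
   q_1 (|u|^alpha1 u - |v_h|^alpha1 v_h). The a priori estimates give
   |u|, |v_h| = O(e^(-(J - (B - b))/h)) and |u - v_h| = O(e^(-(1 + alpha1)(J - (B - b))/h)), so the
   lower bounds on J make the error o(e^(-(alpha1 + 2)J/h)). Since |v_h| is comparable to
   e^(-(J - t + omega.x)/h) and q_{1,D} has a sign, e^((alpha1 + 2)J/h) times the leading term is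
   comparable to int_D e^((alpha1 + 2)(t - omega.x)/h), which tends to 0 when t < t_* and to +oo
   when t > t_*.

   Green's formula for H^1 functions is obtained as an L^2 limit from the C^1 divergence theorem,
   which is localised by cutoffs: in a boundary chart, d_j is replaced by N_j d_i (N the normal to
   the graph, i the chart direction) and the fundamental theorem of calculus applies along x_i. The
   same formula for (a_k - M)_+^2, with a_k smooth approximations of u, bounds the trace of u by
   the supremum of u. *)
From HB Require Import structures.
Require Import Defs.
From mathcomp Require Import all_boot all_order all_algebra.
From mathcomp Require Import all_classical all_reals all_analysis.
From mathcomp Require Import complex measurable_realfun ring lra.
Set Implicit Arguments.
Unset Strict Implicit.
Unset Printing Implicit Defensive.
Import Order.TTheory GRing.Theory Num.Theory.
Import numFieldNormedType.Exports.
Local Open Scope classical_set_scope.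
Local Open Scope ring_scope.

(** * Lebesgue measure on boxes, and Fubini in one coordinate *)

(** Nothing is granted about [f_h] beyond its being a trace, so its smallness has to be proved
    before the a priori estimates apply. The H^{3/2} norm is a quotient norm, bounded by the H^2
    norm of [v_h] itself at the price of a factor h^-2; this factor is absorbed because the exponent
    J - t + b in the sup bound of |v_h| exceeds J - (B - b) by B - t > 0. The sup norm is harder: a
    trace is only an L^2 limit of smooth functions whose sup norms are uncontrolled, hence the
    truncation argument. Uniqueness for the linear problem then identifies [v_h] with the solution
    [v] of data [f_h]. In the bulk integrand the gradient terms cancel, and since q_0 is real the
    conjugate of [v_h] solves the same equation, so that the background solution drops out
    altogether. Weak derivatives are chosen representatives, so pointwise identities hold only
    almost everywhere and rest on the fundamental lemma. That lemma requires bump functions smooth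
    to all orders, whereas the cutoffs in the divergence theorem need only be C1 and are built from
    squares of positive parts. *)

Section borel_rV.
Context {R : realType} {n : nat}.
Implicit Types (x : 'rV[R]_n) (a b : 'I_n -> R).

Definition obox a b : set 'rV[R]_n := [set x | forall i, x ord0 i \in `]a i, b i[].

Definition cbox a b : set 'rV[R]_n := [set x | forall i, x ord0 i \in `[a i, b i]].

Lemma obox_cbox a b : obox a b `<=` cbox a b.
Proof. by move=> x xab i; exact/subset_itv_oo_cc/xab. Qed.

Lemma ball_rVP x e y : 0 < e ->
  ball x e y <-> forall i, `|x ord0 i - y ord0 i| < e.
Proof.
move=> e0; split=> [[_ xy] i|xy]; first exact: xy.
by split=> // i j; rewrite (ord1 i); exact: xy.
Qed.

Lemma ball_obox x e : 0 < e ->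
  ball x e = obox (fun i => x ord0 i - e) (fun i => x ord0 i + e).
Proof.
move=> e0; apply/seteqP; split=> y; rewrite ball_rVP// => H i; have := H i.
  by rewrite in_itv/= ltr_norml; lra.
by rewrite in_itv/= ltr_norml; lra.
Qed.

Lemma measurable_obox a b : measurable (obox a b).
Proof.
rewrite (_ : obox a b = \bigcap_(i in setT) (coordinate i @^-1` `]a i, b i[)).
  apply: fin_bigcap_measurable => // i _.
  by rewrite -[X in measurable X]setTI; exact: measurable_coordinate.
by apply/seteqP; split=> [x ax i _|x ax i]; apply: ax.
Qed.

Lemma open_obox_sub (U : set 'rV[R]_n) x : open U -> U x ->
  exists2 e : R, 0 < e & ball x e `<=` U.
Proof. by move=> oU Ux; have /nbhs_ballP[e e0 eU] := open_nbhs_nbhs (conj oU Ux); exists e. Qed.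

(** Rational corners make the union countable. Asking for the closed boxes to lie in [U] lets the
    bump functions of these boxes have compact support inside [U]. *)
Lemma open_bigcup_obox (U : set 'rV[R]_n) : open U ->
  U = \bigcup_(q in [set q : 'rV[rat]_n * 'rV[rat]_n |
     cbox (fun i => ratr (q.1 ord0 i)) (fun i => ratr (q.2 ord0 i)) `<=` U])
     obox (fun i => ratr (q.1 ord0 i)) (fun i => ratr (q.2 ord0 i)).
Proof.
move=> oU; apply/seteqP; split=> [x Ux|x [q qU]]; last by move=> /obox_cbox/qU.
have [e e0 eU] := open_obox_sub oU Ux.
have H i : exists q : rat * rat, [/\ x ord0 i - e < ratr q.1 < x ord0 i &
    x ord0 i < ratr q.2 < x ord0 i + e].
  have [q1 q1P] := @rat_in_itvoo R (x ord0 i - e) (x ord0 i) ltac:(lra).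
  have [q2 q2P] := @rat_in_itvoo R (x ord0 i) (x ord0 i + e) ltac:(lra).
  by exists (q1, q2); split; [move: q1P|move: q2P]; rewrite in_itv.
have [f fP] := choice H.
exists (\row_i (f i).1, \row_i (f i).2) => /=.
  move=> y; rewrite /cbox/= => Hy; apply: eU; rewrite ball_obox// => i.
  by have := Hy i; have := fP i; rewrite !mxE !in_itv/=; lra.
by move=> i; rewrite !mxE in_itv/=; have := fP i; lra.
Qed.

Lemma open_measurable_rV (U : set 'rV[R]_n) : open U -> measurable U.
Proof.
move=> /open_bigcup_obox ->; rewrite bigcup_mkcond.
apply: countable_bigcupT_measurable => // q.
by case: ifP => _ //; exact: measurable_obox.
Qed.

Lemma closed_measurable_rV (U : set 'rV[R]_n) : closed U -> measurable U.
Proof.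
by move=> cU; rewrite -[U]setCK; apply: measurableC; apply: open_measurable_rV; exact: closed_openC.
Qed.

Lemma continuous_measurable_rV (f : 'rV[R]_n -> R) (A : set 'rV[R]_n) : measurable A ->
  continuous f -> measurable_fun A (f : 'rV[R]_n -> measurableTypeR R).
Proof.
move=> mA /continuousP cf; apply: (measurability _ (measurable_realfun.RGenOpens.measurableE R)).
move=> _ [_ [a [b ->] <-]]; apply: measurableI => //.
by apply: open_measurable_rV; apply: cf; exact: interval_open.
Qed.

Lemma oboxI a b c d :
  obox a b `&` obox c d = obox (fun i => Num.max (a i) (c i)) (fun i => Num.min (b i) (d i)).
Proof.
apply/seteqP; split=> [x [H1 H2] i|x H].
  by have := H1 i; have := H2 i; rewrite !in_itv/= gt_max lt_min => /andP[-> ->] /andP[-> ->].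
by split=> i; have := H i; rewrite !in_itv/= gt_max lt_min => /andP[/andP[? ?] /andP[? ?]]; apply/andP.
Qed.

Lemma oboxy : \bigcup_k obox (fun=> - k%:R) (fun=> k%:R) = setT.
Proof.
apply/seteqP; split=> // x _.
exists (Num.truncn (\sum_i `|x ord0 i|)).+1 => // i; rewrite in_itv/= -ltr_norml.
apply: le_lt_trans (truncnS_gt _).
by rewrite (bigD1 i)//= lerDl sumr_ge0.
Qed.

Lemma measurable_rVE :
  @measurable _ 'rV[R]_n = <<s [set A | exists a b, A = obox a b] >>.
Proof.
apply/seteqP; split; last first.
  apply: smallest_sub; first exact: sigma_algebra_measurable.
  by move=> _ [a [b ->]]; exact: measurable_obox.
apply: smallest_sub; first exact: smallest_sigma_algebra.
rewrite -bigcup_seq; apply: bigcup_sub => i _ A [B mB <-]; rewrite setTI.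
move: B mB; rewrite (measurable_realfun.RGenOpens.measurableE R).
apply: smallest_sub.
  split.
  - by rewrite /= preimage_set0; exact: sigma_algebra0.
  - by move=> B /= mB; rewrite setTD preimage_setC -setTD; apply: sigma_algebraCD.
  - by move=> F mF /=; rewrite preimage_bigcup; exact: sigma_algebra_bigcup.
move=> _ [a [b ->]] /=.
(* A slab bounded in one coordinate only is the union of boxes whose other sides grow to the whole
   line. *)
rewrite (_ : _ @^-1` _ = \bigcup_k obox (fun j => if j == i then a else - k%:R)
    (fun j => if j == i then b else k%:R)).
  by apply: sigma_algebra_bigcup => k; apply: sub_gen_smallest; do 2 eexists; reflexivity.
apply/seteqP; split=> [x /= xab|x [k _ /(_ i)]]; last by rewrite eqxx.
have : [set: 'rV[R]_n] x by [].
rewrite -oboxy => -[k _ xk]; exists k => // j; case: eqP => [->//|_]; exact: xk.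
Qed.

End borel_rV.

Section lebesgue_rV_theory.
Context {R : realType}.

Lemma lebesgue_obox n (a b : 'I_n -> R) : (forall i, a i <= b i) ->
  lebesgue_rV n (obox a b) = (\prod_i (b i - a i))%:E.
Proof.
move=> ab.
apply: etrans (lebesgue_rV_box (A := fun i => `]a i, b i[%classic) _) _.
  by move=> i; exact: measurable_itv.
rewrite -prodEFin; apply: eq_bigr => i _.
by rewrite lebesgue_measure_itv/= lte_fin; case: ltgtP (ab i) => // ->; rewrite subrr.
Qed.

Lemma lebesgue_obox_lty n (a b : 'I_n -> R) : (lebesgue_rV n (obox a b) < +oo)%E.
Proof.
have [ab|] := pselect (forall i, a i <= b i); first by rewrite lebesgue_obox// ltry.
move=> /existsNP[i /negP]; rewrite -ltNge => ba.
rewrite (_ : obox a b = set0) ?measure0//; apply/seteqP; split=> // x /(_ i).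
by rewrite in_itv/=; lra.
Qed.

Lemma lebesgue_rV_bounded n (A : set 'rV[R]_n) : measurable A -> bounded_set A ->
  (lebesgue_rV n A < +oo)%E.
Proof.
move=> mA [M [_ /(_ (M + 1)) HM]].
apply: le_lt_trans (@lebesgue_obox_lty n (fun=> - (M + 2)) (fun=> M + 2)).
apply: le_measure; rewrite ?inE//; first exact: measurable_obox.
move=> x /HM; rewrite ltrDl ltr01 => /(_ isT)/= xM i.
rewrite in_itv/= -ltr_norml (le_lt_trans _ (_ : M + 1 < M + 2))//; last by rewrite ltrD2l ltr1n.
apply: le_trans xM; rewrite /Num.norm/= mx_normrE.
exact: (le_bigmax _ (fun i => `|x i.1 i.2|) (ord0, i)).
Qed.

Lemma lebesgue_rV_open_gt0 n (U : set 'rV[R]_n) : open U -> U !=set0 ->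
  (0 < lebesgue_rV n U)%E.
Proof.
move=> oU [x Ux]; have [e e0 eU] := open_obox_sub oU Ux.
apply: (@lt_le_trans _ _ (lebesgue_rV n (ball x e))).
  rewrite ball_obox// lebesgue_obox; last by move=> i; lra.
  by rewrite lte_fin; apply: prodr_gt0 => i _; lra.
apply: le_measure => //; rewrite inE; apply: open_measurable_rV => //.
exact: ball_open.
Qed.

(** Boxes are stable under intersection, generate the Borel sets and exhaust the space by cubes of
    finite measure, so the uniqueness theorem for measures applies. *)
Lemma measure_rV_unique n (m : {measure set 'rV[R]_n -> \bar R}) :
  (forall a b : 'I_n -> R, m (obox a b) = lebesgue_rV n (obox a b)) ->
  forall A, measurable A -> m A = lebesgue_rV n A.
Proof.
move=> H A mA; 
apply: (@measure_unique _ R _ _ (fun k => obox (fun=> - k%:R) (fun=> k%:R))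
  (@measurable_rVE R n) _ _ _ m (lebesgue_rV n) _ _ A mA).
- move=> _ _ [a [b ->]] [c [d ->]]; rewrite oboxI; do 2 eexists; reflexivity.
- by move=> k; do 2 eexists; reflexivity.
- exact: oboxy.
- by move=> _ [a [b ->]].
- by move=> k; rewrite H; exact: lebesgue_obox_lty.
Qed.

End lebesgue_rV_theory.

Section fubini_coord.
Context {R : realType} (m : nat) (i : 'I_m.+1).
Let inr (p : measurableTypeR R * 'rV[R]_m) : 'rV[R]_m.+1 := @insert_coord R m.+1 i p.1 p.2.

Lemma insert_coordE (a : R) (y : 'rV[R]_m) : @insert_coord R m.+1 i a y ord0 i = a.
Proof. by rewrite mxE unlift_none. Qed.

Lemma insert_coord_lift (a : R) (y : 'rV[R]_m) k :
  @insert_coord R m.+1 i a y ord0 (lift i k) = y ord0 k.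
Proof. by rewrite mxE liftK. Qed.

Lemma col'_insert_coord (a : R) (y : 'rV[R]_m) : col' i (@insert_coord R m.+1 i a y) = y.
Proof. by apply/rowP => k; rewrite mxE insert_coord_lift. Qed.

Lemma measurable_insert_coord : measurable_fun setT inr.
Proof.
apply: measurable_rVP => j; have [k ->|->] := unliftP i j.
  rewrite (_ : _ \o _ = coordinate k \o snd).
    by apply: measurableT_comp => //; exact: measurable_coordinate.
  by apply/funext => -[a y]; rewrite /= /coordinate insert_coord_lift.
rewrite (_ : _ \o _ = fst); first exact: measurable_fst.
by apply/funext => -[a y]; rewrite /= /coordinate insert_coordE.
Qed.

HB.instance Definition _ := @isMeasurableFun.Build _ _ _ _ inr measurable_insert_coord.

(** The measure is built by prepending the first coordinate, but a boundary chart may point along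
    any axis. Both measures agree on boxes, so the coordinate [i] can be split off just as well. *)
Lemma lebesgue_rV_insert (A : set 'rV[R]_m.+1) : measurable A ->
  lebesgue_rV m.+1 A = pushforward (@lebesgue_measure R \x lebesgue_rV m)%E inr A.
Proof.
move=> mA; symmetry.
apply: (@measure_rV_unique R m.+1 (pushforward (@lebesgue_measure R \x lebesgue_rV m)%E inr)); last exact: mA.
move=> a b.
transitivity ((@lebesgue_measure R \x lebesgue_rV m)%E (inr @^-1` obox a b)); first by [].
rewrite (_ : inr @^-1` _ = `]a i, b i[%classic `*` obox (a \o lift i) (b \o lift i)); last first.
  apply/seteqP; split=> [[s y]/= H|[s y]/= [H1 H2] j].
    split; first by have := H i; rewrite insert_coordE.
    by move=> k; have := H (lift i k); rewrite insert_coord_lift.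
  have [k ->|->] := unliftP i j; last by rewrite insert_coordE.
  by rewrite insert_coord_lift; exact: H2.
rewrite [LHS](@product_measure1E _ _ _ _ R lebesgue_measure (lebesgue_rV m) `]a i, b i[%classic (obox (a \o lift i) (b \o lift i))); last 2 first.
  exact: measurable_itv.
  exact: measurable_obox.
have [ab|] := pselect (forall i, a i <= b i); last first.
  move=> /existsNP[j /negP]; rewrite -ltNge => ba.
  rewrite [in RHS](_ : obox a b = set0) ?measure0; last first.
    by apply/seteqP; split=> // x /(_ j); rewrite in_itv/=; lra.
  have [k jE|jE] := unliftP i j.
    rewrite (_ : obox _ _ = set0) ?measure0 ?mule0//; apply/seteqP; split=> // x /(_ k).
    by rewrite in_itv/= -jE; lra.
  rewrite (_ : `]_, _[%classic = set0) ?measure0 ?mul0e//; apply/seteqP; split=> // x /=.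
  by rewrite in_itv/= -jE; lra.
rewrite lebesgue_obox// (lebesgue_obox (a := a \o lift i)); last by move=> k; exact: ab.
rewrite (bigD1_ord i)//= EFinM; congr (_ * _)%E.
rewrite lebesgue_measure_itv/= lte_fin.
by case: ltgtP (ab i) => // ->; rewrite subrr.
Qed.

Lemma integral_insert (f : 'rV[R]_m.+1 -> \bar R) :
  (lebesgue_rV m.+1).-integrable setT f ->
  (\int[lebesgue_rV m.+1]_x f x =
   \int[lebesgue_rV m]_y \int[lebesgue_measure]_a f (@insert_coord R m.+1 i a y))%E.
Proof.
move=> /integrableP[mf intf].
have intf' : (@lebesgue_measure R \x lebesgue_rV m)%E.-integrable setT (f \o inr).
  apply/integrableP; split; first exact: (measurableT_comp mf measurable_insert_coord).
  move: intf; rewrite (eq_measure_integral (pushforward (@lebesgue_measure R \x lebesgue_rV m)%E inr)).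
    by rewrite ge0_integral_pushforward//; exact: measurableT_comp.
  by move=> A mA _; exact: lebesgue_rV_insert.
rewrite (eq_measure_integral (pushforward (@lebesgue_measure R \x lebesgue_rV m)%E inr)); last first.
  by move=> A mA _; exact: lebesgue_rV_insert.
by rewrite integral_pushforward// preimage_setT -integral21_prod_meas1.
Qed.

End fubini_coord.

Lemma cont_comp (T U V : topologicalType) (f : T -> U) (g : U -> V) :
  continuous f -> continuous g -> continuous (fun x => g (f x)).
Proof. by move=> cf cg x; apply: (@continuous_comp _ _ _ f g); [exact: cf|exact: cg]. Qed.

(** * Functions of class C1 *)

Section continuous_ops.
Context {R : realType} {T : topologicalType}.
Implicit Types f g : T -> R.

Lemma continuous_add f g : continuous f -> continuous g -> continuous (fun x => f x + g x).
Proof. by move=> cf cg x; exact: (continuousD (cf x) (cg x)). Qed.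

Lemma continuous_sub f g : continuous f -> continuous g -> continuous (fun x => f x - g x).
Proof. by move=> cf cg x; exact: (continuousB (cf x) (cg x)). Qed.

Lemma continuous_mul f g : continuous f -> continuous g -> continuous (fun x => f x * g x).
Proof. by move=> cf cg x; exact: (continuousM (cf x) (cg x)). Qed.

Lemma continuous_maxr f g : continuous f -> continuous g ->
  continuous (fun x => Num.max (f x) (g x)).
Proof. by move=> cf cg x; exact: (continuous_max (cf x) (cg x)). Qed.

End continuous_ops.

Section slice.
Context {R : realType} {n : nat}.
Implicit Types (f g : 'rV[R]_n -> R) (x v : 'rV[R]_n).

(** A directional derivative sees only the difference quotient along one line, so [F] and [G] may
    live on different spaces. This covers the restriction to a line, slices through [insert_coord]
    and compositions with [col']. *)
Lemma derive_ext (V W : normedModType R) (F : V -> R) (G : W -> R) (x v : V) (y w : W) :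
  (forall h : R, F (h *: v + x) = G (h *: w + y)) ->
  (derivable F x v <-> derivable G y w) /\ 'D_v F x = 'D_w G y.
Proof.
move=> H; rewrite /derivable /derive.
suff -> : (fun h : R => h^-1 *: ((F \o shift x) (h *: v) - F x)) =
          (fun h : R => h^-1 *: ((G \o shift y) (h *: w) - G y)) by [].
apply/funext => h /=; rewrite H; have := H 0.
by rewrite !scale0r !add0r => ->.
Qed.

Lemma derive_slice f x v :
  (derivable f x v <-> derivable (fun h : R => f (h *: v + x)) 0 1) /\
  'D_v f x = 'D_1 (fun h : R => f (h *: v + x)) 0.
Proof. by apply: derive_ext => h; rewrite addr0 [_%:A]mulr1. Qed.

Lemma slice_derive1 f (g : R -> R) x v a :
  (forall h : R, f (h *: v + x) = g (h + a)) ->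
  (derivable f x v <-> derivable g a 1) /\ 'D_v f x = 'D_1 g a.
Proof. by move=> H; apply: derive_ext => h; rewrite H [_%:A]mulr1. Qed.

Lemma is_derive_comp (phi : R -> R) f x v : derivable f x v ->
  derivable phi (f x) 1 ->
  derivable (phi \o f) x v /\ 'D_v (phi \o f) x = 'D_1 phi (f x) * 'D_v f x.
Proof.
move=> df dp; pose s h := f (h *: v + x).
have s0 : s 0 = f x by rewrite /s scale0r add0r.
have ds : derivable s 0 1 by apply/(derive_slice f x v).1.
have dp' : derivable phi (s 0) 1 by rewrite s0.
split.
  apply/(derive_slice _ _ _).1; apply/derivable1_diffP.
  rewrite (_ : (fun h => _) = phi \o s)//.
  by apply: differentiable_comp; exact/derivable1_diffP.
rewrite (derive_slice _ _ _).2 (_ : (fun h => _) = phi \o s)//.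
have := derive1_comp ds dp'; rewrite !derive1E s0 => ->.
by rewrite (derive_slice f x v).2.
Qed.

End slice.

Section C1_functions.
Context {R : realType} {n : nat}.
Implicit Types (f g : 'rV[R]_n -> R) (x v : 'rV[R]_n) (i : 'I_n).

Definition pd i f : 'rV[R]_n -> R := fun x => 'D_(basis_vec i) f x.

Definition C1 f := continuous f /\
  forall i, (forall x, derivable f x (basis_vec i)) /\ continuous (pd i f).

Lemma C1_cst (c : R) : C1 (cst c).
Proof.
split=> [|i]; first exact: cst_continuous.
split=> [x|]; first exact: derivable_cst.
rewrite (_ : pd i _ = cst 0); first exact: cst_continuous.
by apply/funext => x; exact: derive_cst.
Qed.

Lemma C1D f g : C1 f -> C1 g -> C1 (fun x => f x + g x).
Proof.
move=> [cf Cf] [cg Cg]; split=> [|i]; first exact: continuous_add.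
have [df cdf] := Cf i; have [dg cdg] := Cg i.
split=> [x|]; first exact: derivableD.
rewrite (_ : pd i _ = fun x => pd i f x + pd i g x).
  exact: continuous_add.
by apply/funext => x; exact: deriveD.
Qed.

Lemma pdM i f g x : derivable f x (basis_vec i) -> derivable g x (basis_vec i) ->
  pd i (fun x => f x * g x) x = f x * pd i g x + g x * pd i f x.
Proof. by move=> df dg; rewrite /pd; apply: etrans (deriveM df dg) _. Qed.

Lemma C1M f g : C1 f -> C1 g -> C1 (fun x => f x * g x).
Proof.
move=> [cf Cf] [cg Cg]; split=> [|i]; first exact: continuous_mul.
have [df cdf] := Cf i; have [dg cdg] := Cg i.
split=> [x|]; first exact: derivableM.
rewrite (_ : pd i _ = fun x => f x * pd i g x + g x * pd i f x).
  by apply: continuous_add; exact: continuous_mul.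
by apply/funext => x; exact: pdM.
Qed.

Lemma is_derive_coord i j x :
  is_derive x (basis_vec j) (fun x : 'rV[R]_n => x ord0 i) (i == j)%:R.
Proof.
have H (h : R) : (h *: basis_vec j + x) ord0 i = (fun h => h * (i == j)%:R) h + x ord0 i.
  by rewrite !mxE eqxx/=.
have [H1 H2] := @slice_derive1 R n (fun x => x ord0 i) (fun h => (h - x ord0 i) * (i == j)%:R + x ord0 i) x (basis_vec j) (x ord0 i)
   ltac:(by move=> h; rewrite /= H addrK).
have D1 : is_derive (x ord0 i) 1 (fun h => (h - x ord0 i) * (i == j)%:R + x ord0 i) (i == j)%:R.
  by apply: is_derive_eq; rewrite !scaler0 add0r addr0 subr0 [_ *: 1]mulr1.
split; first by apply/H1.
by rewrite H2; apply: derive_val.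
Qed.

Lemma C1_coord i : C1 (fun x => x ord0 i).
Proof.
split=> [|j]; first exact: coord_continuous.
split=> [x|]; first by have [] := is_derive_coord i j x.
rewrite (_ : pd j _ = cst (i == j)%:R); first exact: cst_continuous.
by apply/funext => x; rewrite /pd; apply: derive_val; exact: is_derive_coord.
Qed.

Lemma C1_comp (phi : R -> R) f : C1 f -> (forall s, derivable phi s 1) ->
  continuous (fun s => 'D_1 phi s) -> C1 (fun x => phi (f x)).
Proof.
move=> [cf Cf] dp cdp; split=> [x|i].
  apply: (@continuous_comp _ _ _ f phi); first exact: cf.
  by apply: differentiable_continuous; exact/derivable1_diffP.
have [df cdf] := Cf i.
split=> [x|]; first exact: (is_derive_comp (df x) (dp (f x))).1.
rewrite (_ : pd i _ = fun x => 'D_1 phi (f x) * pd i f x).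
  apply: continuous_mul => // x.
  by apply: (@continuous_comp _ _ _ f (fun s => 'D_1 phi s)); [exact: cf|exact: cdp].
by apply/funext => x; exact: (is_derive_comp (df x) (dp (f x))).2.
Qed.

Lemma C1N f : C1 f -> C1 (fun x => - f x).
Proof.
move=> Cf; rewrite (_ : (fun x => _) = fun x => cst (-1) x * f x).
  by apply: C1M => //; exact: C1_cst.
by apply/funext => x; rewrite mulN1r.
Qed.

Lemma C1B f g : C1 f -> C1 g -> C1 (fun x => f x - g x).
Proof. by move=> Cf Cg; apply: C1D => //; exact: C1N. Qed.

Lemma C1_sum (T : Type) (s : seq T) (F : T -> 'rV[R]_n -> R) :
  (forall k, C1 (F k)) -> C1 (fun x => \sum_(i <- s) F i x).
Proof.
move=> CF; elim: s => [|a s IH].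
  by under [X in C1 X]funext do rewrite big_nil; exact: C1_cst.
by under [X in C1 X]funext do rewrite big_cons; exact: C1D.
Qed.

Lemma smooth_C1 f : smooth f -> C1 f.
Proof.
move=> sf; split; first exact: (sf [::]).1.
by move=> i; split; [move=> x; exact: (sf [::]).2|exact: (sf [:: i]).1].
Qed.

Lemma pd_eq0 (K : set 'rV[R]_n) f i x : closed K -> (forall x, ~ K x -> f x = 0) -> ~ K x ->
  pd i f x = 0.
Proof.
move=> cK f0 Kx; rewrite /pd (@near_eq_derive _ _ _ f (cst 0)) ?derive_cst//.
have : nbhs x (~` K) by apply: open_nbhs_nbhs; split => //; exact: closed_openC.
by apply: filterS => y; exact: f0.
Qed.

Lemma compact_support_integrable (K : set 'rV[R]_n) f : compact K -> continuous f ->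
  (forall x, ~ K x -> f x = 0) -> (lebesgue_rV n).-integrable setT (EFin \o f).
Proof.
move=> cK cf f0.
have clK : closed K by apply: compact_closed => //; exact: norm_hausdorff.
have mK := closed_measurable_rV clK.
have fK : EFin \o f = (EFin \o f) \_ K.
  by apply/funext => x; rewrite patchE; case: ifPn => // /negP; rewrite inE => /f0/= ->.
suff : (lebesgue_rV n).-integrable K (EFin \o f).
  by move=> /(integrable_mkcond (EFin \o f) mK).1; rewrite -fK.
refine (measurable_bounded_integrable mK _ _ _).
- apply: lebesgue_rV_bounded => //; exact: compact_bounded.
- exact: continuous_measurable_rV.
- have /compact_bounded[M [Mr MP]] : compact (f @` K).
    by apply: continuous_compact => //; exact: continuous_subspaceT.
  by exists M; split=> // z Mz x Kx; apply: MP => //; exists x.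
Qed.

End C1_functions.

(** * Integrals of partial derivatives *)

Section integral_derivative.
Context {R : realType}.
Local Notation leb := (@lebesgue_measure R).

Lemma integral_derivative_right (F f : R -> R) (M c : R) : (forall s, derivable F s 1) ->
  (forall s, 'D_1 F s = f s) ->
  continuous f -> (forall s, M < `|s| -> F s = 0) ->
  (\int[leb]_(a in `]c, +oo[) (f a)%:E = (- F c)%:E)%E.
Proof.
move=> dF Ef; have {Ef} E := funext Ef; subst f => cF F0.
have dF0 s : M < `|s| -> 'D_1 F s = 0.
  move=> Ms; rewrite (@near_eq_derive _ _ _ F (cst 0)) ?derive_cst//.
  have : \forall z \near s, M < `|z|.
    apply: (@cvgr_gt _ _ _ _ _ _ (@norm_continuous _ R s)); exact: Ms.
  by apply: filterS => z; exact: F0.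
(* Beyond both [c] and the support of [F], so the fundamental theorem of calculus on [[c, N]] leaves
   only [- F c]. *)
pose N : R := `|M| + `|c| + 1.
have cN : c < N by rewrite /N; have := ler_norm c; have := normr_ge0 M; lra.
have MN : M < N by rewrite /N; have := ler_norm M; have := normr_ge0 c; lra.
have N0 : 0 <= N by rewrite /N addr_ge0// addr_ge0.
transitivity (\int[leb]_(a in `[c, N]) ('D_1 F a)%:E)%E; last first.
  rewrite (@continuous_FTC2 _ _ F)//.
  - by rewrite (F0 N) ?ger0_norm// sub0e -EFinN.
  - exact: continuous_subspaceT.
  - split=> [x _| |]; first exact: dF.
      by apply: cvg_at_right_filter; apply: differentiable_continuous; exact/derivable1_diffP.
    by apply: cvg_at_left_filter; apply: differentiable_continuous; exact/derivable1_diffP.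
  - by move=> x _; rewrite derive1E.
rewrite -integral_itv_obnd_cbnd; last first.
  apply/measurable_EFinP; apply: measurable_funTS; exact: continuous_measurable_fun.
rewrite (_ : `]c, N]%classic = `]c, +oo[%classic `&` `]-oo, N]%classic); last first.
  by apply/seteqP; split=> x/=; rewrite !in_itv/= ?andbT; [move=> /andP|move=> [-> ->]].
rewrite integral_mkcondr; apply: eq_integral => x _; rewrite patchE.
case: ifPn => // /negP; rewrite inE/= in_itv/= => /negP; rewrite -ltNge => Nx.
rewrite dF0//; apply: lt_trans MN (lt_le_trans Nx _); exact: ler_norm.
Qed.

Lemma derivative_compact (F : R -> R) (M s : R) : (forall s, M < `|s| -> F s = 0) ->
  M < `|s| -> 'D_1 F s = 0.
Proof.
move=> F0 Ms; rewrite (@near_eq_derive _ _ _ F (cst 0)) ?derive_cst//.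
have : \forall z \near s, M < `|z|.
  apply: (@cvgr_gt _ _ _ _ _ _ (@norm_continuous _ R s)); exact: Ms.
by apply: filterS => z; exact: F0.
Qed.

Lemma integral_derivative_eq0 (F f : R -> R) (M : R) : (forall s, derivable F s 1) ->
  (forall s, 'D_1 F s = f s) ->
  continuous f -> (forall s, M < `|s| -> F s = 0) ->
  (\int[leb]_a (f a)%:E = 0)%E.
Proof.
move=> dF Ef; have {Ef} E := funext Ef; subst f => cF F0.
(* The starting point lies to the left of the support, so [F] vanishes there and the half-line
   carries the whole integral. *)
have := integral_derivative_right (- (`|M| + 1)) dF (fun=> erefl) cF F0.
rewrite F0 ?normrN ?(ger0_norm (_ : 0 <= `|M| + 1)) ?oppr0 ?addr_ge0//; last first.
  by rewrite ltr_pwDr// ler_norm.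
move=> H0; apply: etrans H0; rewrite [RHS]integral_mkcond; apply: eq_integral => x _; rewrite patchE.
case: ifPn => // /negP; rewrite inE/= in_itv/= andbT => /negP; rewrite -leNgt => Nx.
rewrite (derivative_compact F0)//.
by have := normr_ge0 M; have := ler_norm M; have := lerNnormlW (lexx `|x|); lra.
Qed.

Lemma integrable_derivative (F f : R -> R) (M : R) : (forall s, 'D_1 F s = f s) ->
  continuous f -> (forall s, M < `|s| -> F s = 0) ->
  leb.-integrable setT (fun a => (f a)%:E).
Proof.
move=> Ef; have {Ef} E := funext Ef; subst f => cF F0.
pose N : R := `|M| + 1.
have fK : (fun a => ('D_1 F a)%:E) = (fun a => ('D_1 F a)%:E) \_ `[-N, N].
  apply/funext => x; rewrite patchE; case: ifPn => // /negP; rewrite inE/= in_itv/= => /negP xN.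
  rewrite (derivative_compact F0)//; move: xN; rewrite -ler_norml -ltNge /N.
  by have := ler_norm M; lra.
suff H : leb.-integrable `[- N, N] (fun a => ('D_1 F a)%:E).
  have mI : measurable (`[- N, N]%classic : set (measurableTypeR R)) by exact: measurable_itv.
  by have := (integrable_mkcond _ mI).1 H; rewrite -fK.
apply: continuous_compact_integrable; first exact: segment_compact.
exact: continuous_subspaceT.
Qed.

Lemma integral_derivative_left (F f : R -> R) (M c : R) : (forall s, derivable F s 1) ->
  (forall s, 'D_1 F s = f s) ->
  continuous f -> (forall s, M < `|s| -> F s = 0) ->
  (\int[leb]_(a in `]-oo, c[) (f a)%:E = (F c)%:E)%E.
Proof.
move=> dF Ef cF F0.
have iF := integrable_derivative Ef cF F0.
have mF : measurable_fun setT (fun a => (f a)%:E).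
  by apply/measurable_EFinP; exact: continuous_measurable_fun.
have := integral_derivative_eq0 dF Ef cF F0.
have -> : [set: R] = `]-oo, c] `|` `]c, +oo[.
  by rewrite -itv_bndbnd_setU// set_itvE.
rewrite integral_setU_EFin//=; last 2 first.
- apply/measurable_EFinP; exact: (measurable_funS measurableT).
- by apply/disj_setPS => x/= []; rewrite !in_itv/= andbT; lra.
rewrite (integral_derivative_right c dF Ef cF F0) => H.
rewrite integral_itv_bndo_bndc; last exact: (measurable_funS measurableT).
by move: H; case: (\int[leb]_(x in _) _)%E => //= r [/eqP]; rewrite subr_eq0 => /eqP ->.
Qed.

End integral_derivative.

Section integral_pd.
Context {R : realType} (m : nat) (i : 'I_m.+1).
Local Notation leb := (@lebesgue_measure R).

Lemma continuous_rV (T : topologicalType) k (f : T -> 'rV[R]_k) :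
  (forall j, continuous (fun t => f t ord0 j)) -> continuous f.
Proof.
move=> cf t; apply/cvg_ballP => e e0.
have : \forall t' \near t, forall j, `|f t ord0 j - f t' ord0 j| < e.
  by apply: filter_forall => j; exact: (@cvgr_dist_lt _ _ _ _ _ _ _ (cf j t)).
by apply: filterS => t' H; apply/ball_rVP.
Qed.

Lemma insert_coordD (h a : R) (y : 'rV[R]_m) :
  @insert_coord R m.+1 i (h + a) y = h *: basis_vec i + @insert_coord R m.+1 i a y.
Proof.
apply/rowP => j; have [k ->|->] := unliftP i j.
  by rewrite insert_coord_lift !mxE eqxx/= eq_sym (negbTE (neq_lift _ _)) mulr0 add0r liftK.
by rewrite insert_coordE !mxE !eqxx/= mulr1 unlift_none.
Qed.

Lemma continuous_insert_coord (y : 'rV[R]_m) : continuous (fun a => @insert_coord R m.+1 i a y).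
Proof.
apply: continuous_rV => j; have [k ->|->] := unliftP i j.
  under [X in continuous X]funext do rewrite insert_coord_lift.
  exact: cst_continuous.
by under [X in continuous X]funext do rewrite insert_coordE.
Qed.

Lemma derivable_insert (f : 'rV[R]_m.+1 -> R) (a : R) (y : 'rV[R]_m) :
  derivable f (@insert_coord R m.+1 i a y) (basis_vec i) ->
  derivable (fun a => f (@insert_coord R m.+1 i a y)) a 1.
Proof. by apply: (slice_derive1 _).1.1 => h; rewrite insert_coordD. Qed.

Lemma derive_insert (f : 'rV[R]_m.+1 -> R) (y : 'rV[R]_m) a :
  'D_1 (fun a => f (@insert_coord R m.+1 i a y)) a = pd i f (@insert_coord R m.+1 i a y).
Proof.
by apply/esym; apply: (slice_derive1 _).2 => h; rewrite insert_coordD.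
Qed.

Lemma coord_le_norm k (x : 'rV[R]_k) j : `|x ord0 j| <= `|x|.
Proof.
rewrite [leRHS]/Num.norm/= mx_normrE.
exact: (le_bigmax _ (fun i => `|x i.1 i.2|) (ord0, j)).
Qed.

Lemma norm_le_coord k (x : 'rV[R]_k) (M : R) : 0 <= M ->
  (forall j, `|x ord0 j| <= M) -> `|x| <= M.
Proof.
move=> M0 H; have [x0|/mx_norm_neq0[[a j] /= xE]] := eqVneq (mx_norm x) 0.
  by rewrite [leLHS]/Num.norm/= x0.
by rewrite [leLHS]/Num.norm/= xE (ord1 a).
Qed.

Lemma compact_norm_bound k (K : set 'rV[R]_k) : compact K ->
  exists M, forall x, K x -> `|x| <= M.
Proof.
move=> /compact_bounded[M [_ MP]]; exists (M + 1) => x Kx.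
by apply: (MP (M + 1) _ _ Kx); rewrite ltrDl.
Qed.

Variables (f : 'rV[R]_m.+1 -> R) (K : set 'rV[R]_m.+1).
Hypotheses (cK : compact K) (f0 : forall x, ~ K x -> f x = 0)
  (df : forall x, derivable f x (basis_vec i)) (cdf : continuous (pd i f)).

Let clK : closed K. Proof. by apply: compact_closed => //; exact: norm_hausdorff. Qed.

Let section_support (y : 'rV[R]_m) :
  exists M : R, forall s : R, M < `|s| -> f (@insert_coord R m.+1 i s y) = 0.
Proof.
have [M HM] := compact_norm_bound cK.
exists M => s Ms; apply: f0 => /HM; apply/negP; rewrite -ltNge.
by apply: lt_le_trans Ms _; rewrite -{1}(insert_coordE i s y); exact: coord_le_norm.
Qed.

Let section_derivable (y : 'rV[R]_m) s : derivable (fun a => f (@insert_coord R m.+1 i a y)) s 1.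
Proof. by apply: derivable_insert; exact: df. Qed.

Let section_derive (y : 'rV[R]_m) s : 'D_1 (fun a => f (@insert_coord R m.+1 i a y)) s =
  pd i f (@insert_coord R m.+1 i s y).
Proof. exact: derive_insert. Qed.

Let section_continuous (y : 'rV[R]_m) :
  continuous (fun a => pd i f (@insert_coord R m.+1 i a y)).
Proof. by apply: cont_comp => //; exact: continuous_insert_coord. Qed.

Let pd_int : (lebesgue_rV m.+1).-integrable setT (EFin \o pd i f).
Proof. by apply: (compact_support_integrable cK cdf) => x; exact: pd_eq0. Qed.

Lemma integral_pd_eq0 : (\int[lebesgue_rV m.+1]_x (pd i f x)%:E = 0)%E.
Proof.
rewrite (integral_insert i)//.
under eq_integral => y _.
  have [M H3] := section_support y.
  have := integral_derivative_eq0 (@section_derivable y) (@section_derive y) (@section_continuous y) H3.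
  move=> ->.
  over.
by rewrite integral0.
Qed.

(** Fubini singles out the direction [i]; on each line in this direction the epigraph is a half-line
    starting at [g y]. *)
Lemma integral_pd_epigraph (g : 'rV[R]_m -> R) : continuous g ->
  (\int[lebesgue_rV m.+1]_(x in [set x | (g (col' i x) < x ord0 i)%R]) (pd i f x)%:E =
   \int[lebesgue_rV m]_y (- f (@insert_coord R m.+1 i (g y) y))%:E)%E.
Proof.
move=> cg; set S := [set x | _].
have mS : measurable S.
  apply: open_measurable_rV.
  rewrite (_ : S = (fun x : 'rV[R]_m.+1 => x ord0 i - g (col' i x)) @^-1` [set s | 0 < s]); last first.
    by apply/seteqP; split=> x; rewrite /S /= subr_gt0.
  apply: open_comp; last exact: open_gt.
  move=> x _; apply: continuousB; first exact: coord_continuous.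
  apply: (cont_comp _ cg).
  by apply: continuous_rV => k; under [X in continuous X]funext do rewrite mxE; exact: coord_continuous.
rewrite integral_mkcond (integral_insert i); last first.
  by apply/(integrable_mkcond _ mS).1; exact: (integrableS measurableT).
apply: eq_integral => y _.
have [M H3] := section_support y.
have := integral_derivative_right (g y) (@section_derivable y) (@section_derive y) (@section_continuous y) H3.
move=> <-; rewrite [RHS]integral_mkcond.
apply: eq_integral => a _; rewrite !patchE; congr (if _ then _ else _).
by rewrite /S; apply/idP/idP; rewrite !inE/= col'_insert_coord insert_coordE in_itv/= andbT.
Qed.

Lemma integral_pd_hypograph (g : 'rV[R]_m -> R) : continuous g ->
  (\int[lebesgue_rV m.+1]_(x in [set x : 'rV[R]_m.+1 | (x ord0 i < g (col' i x))%R]) (pd i f x)%:E =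
   \int[lebesgue_rV m]_y (f (@insert_coord R m.+1 i (g y) y))%:E)%E.
Proof.
move=> cg; set S := [set x | _].
have mS : measurable S.
  apply: open_measurable_rV.
  rewrite (_ : S = (fun x : 'rV[R]_m.+1 => g (col' i x) - x ord0 i) @^-1` [set s | 0 < s]); last first.
    by apply/seteqP; split=> x; rewrite /S /= subr_gt0.
  apply: open_comp; last exact: open_gt.
  move=> x _; apply: continuousB; last exact: coord_continuous.
  apply: (cont_comp _ cg).
  by apply: continuous_rV => k; under [X in continuous X]funext do rewrite mxE; exact: coord_continuous.
rewrite integral_mkcond (integral_insert i); last first.
  by apply/(integrable_mkcond _ mS).1; exact: (integrableS measurableT).
apply: eq_integral => y _.
have [M H3] := section_support y.
have := integral_derivative_left (g y) (@section_derivable y) (@section_derive y) (@section_continuous y) H3.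
move=> <-; rewrite [RHS]integral_mkcond.
apply: eq_integral => a _; rewrite !patchE; congr (if _ then _ else _).
by rewrite /S; apply/idP/idP; rewrite !inE/= col'_insert_coord insert_coordE in_itv/=.
Qed.

End integral_pd.

(** * Green's formula on one side of a graph *)

Section smooth_step.
Context {R : realType}.

(** Squaring makes the positive part C1, with derivative [2 * Num.max x 0]. It serves twice: to
    build cutoffs, and as the truncation that bounds a trace by the supremum of the function. *)
Definition pos_sqr (x : R) : R := Num.max x 0 ^+ 2.

Lemma pos_sqr_remainder (x h : R) :
  `|pos_sqr (h + x) - pos_sqr x - h * (2 * Num.max x 0)| <= h ^+ 2.
Proof.
rewrite /pos_sqr ler_norml.
by case: (leP x 0) => ?; case: (leP (h + x) 0) => ?; apply/andP; split; nra.
Qed.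

Lemma is_derive_pos_sqr (x : R) : is_derive x 1 pos_sqr (2 * Num.max x 0).
Proof.
have H : h^-1 *: ((pos_sqr \o shift x) (h *: 1) - pos_sqr x) @[h --> 0^'] --> 2 * Num.max x 0.
  apply/cvgrPdist_le => e e0; near=> h.
  have h0 : h != 0 by near: h; exact: nbhs_dnbhs_neq.
  have he : `|h| <= e.
    near: h; apply: dnbhs0_le; exact: e0.
  rewrite /= [_%:A]mulr1 distrC.
  have -> : h^-1 *: (pos_sqr (h + x) - pos_sqr x) - 2 * Num.max x 0 =
      h^-1 * (pos_sqr (h + x) - pos_sqr x - h * (2 * Num.max x 0)).
    by rewrite [RHS]mulrBr mulKf.
  rewrite normrM normfV -(ler_pM2l (_ : 0 < `|h|)) ?normr_gt0// mulVKf ?normr_eq0//.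
  apply: le_trans (pos_sqr_remainder _ _) _.
  by rewrite -real_normK ?num_real// expr2 ler_wpM2l.
split; first by apply/cvg_ex; eexists; exact: H.
by rewrite /derive; apply/cvg_lim.
Unshelve. all: by end_near. Qed.

(** For k > 0, a C1 step equal to 0 for s <= 0 and to 1 once k s >= 1. At a fixed s it is eventually
    constant in [k], with limit the indicator of s > 0. *)
Definition smooth_step (k s : R) : R := 1 - pos_sqr (1 - pos_sqr (k * s)).

Lemma smooth_step_bound k s : 0 <= smooth_step k s <= 1.
Proof.
rewrite /smooth_step /pos_sqr; set a := Num.max (k * s) 0 ^+ 2.
have a0 : 0 <= a by exact: sqr_ge0.
by case: (leP (1 - a) 0) => ?; apply/andP; split; nra.
Qed.

Lemma smooth_step_le0 k s : k * s <= 0 -> smooth_step k s = 0.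
Proof. by rewrite /smooth_step /pos_sqr => /max_idPr ->; rewrite expr0n subr0 (max_idPl _)// expr1n subrr. Qed.

Lemma smooth_step_ge1 k s : 1 <= k * s -> smooth_step k s = 1.
Proof.
rewrite /smooth_step /pos_sqr => ks; have ks0 : 0 <= k * s by exact: le_trans ks.
rewrite (max_idPl ks0) (max_idPr _) ?expr0n ?subr0// subr_le0 expr_ge1//.
Qed.

Definition smooth_step' (k s : R) : R :=
  2 * Num.max (1 - pos_sqr (k * s)) 0 * (2 * Num.max (k * s) 0 * k).

Lemma is_derive_smooth_step (k s : R) : is_derive s 1 (smooth_step k) (smooth_step' k s).
Proof.
have D1 : is_derive s 1 (fun s => k * s) k.
  by apply: is_derive_eq; rewrite [_ *: 1]mulr1.
have D2 := is_derive1_comp (is_derive_pos_sqr (k * s)) D1.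
have D3 : is_derive s 1 (fun s => 1 - pos_sqr (k * s)) (- (2 * Num.max (k * s) 0 * k)).
  have D2' : is_derive s 1 (fun s => pos_sqr (k * s)) (2 * Num.max (k * s) 0 * k) := D2.
  have D3 := is_deriveB (is_derive_cst (1:R) s 1) D2'; rewrite sub0r in D3; exact: D3.
have D4 := is_derive1_comp (g := fun s => 1 - pos_sqr (k * s)) (is_derive_pos_sqr (1 - pos_sqr (k * s))) D3.
have D4' : is_derive s 1 (fun s => pos_sqr (1 - pos_sqr (k * s))) _ := D4.
have := is_deriveB (is_derive_cst (1:R) s 1) D4'.
by rewrite sub0r mulrN opprK.
Qed.

Lemma pos_sqr_continuous : continuous pos_sqr.
Proof.
move=> x; apply: differentiable_continuous; apply/derivable1_diffP.
by have [] := is_derive_pos_sqr x.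
Qed.

Lemma continuous_smooth_step' k : continuous (smooth_step' k).
Proof.
have c1 : continuous (fun s : R => k * s) by move=> s; exact: mulrl_continuous.
have c2 : continuous (fun s : R => Num.max (k * s) 0).
  by apply: continuous_maxr => //; exact: cst_continuous.
have c3 : continuous (fun s : R => 1 - pos_sqr (k * s)).
  apply: continuous_sub; first exact: cst_continuous.
  exact: (cont_comp c1 pos_sqr_continuous).
have c4 : continuous (fun s : R => Num.max (1 - pos_sqr (k * s)) 0).
  by apply: continuous_maxr => //; exact: cst_continuous.
rewrite /smooth_step'; apply: continuous_mul; apply: continuous_mul; try exact: cst_continuous; first exact: c4.
by apply: continuous_mul; [exact: cst_continuous|exact: c2].
Qed.

End smooth_step.

Section graph_green.
Context {R : realType} (m : nat) (i : 'I_m.+1) (g : 'rV[R]_m -> R).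
Hypothesis sg : smooth g.

(** Gradient of x_i - g, left unnormalised so that its [i]-th entry is exactly 1; its length is the
    area factor, which cancels in the surface integral. *)
Definition graph_normal (y : 'rV[R]_m) : 'rV[R]_m.+1 :=
  @insert_coord R m.+1 i 1 (- \row_k pderiv [:: k] g y).

(** The sign is chosen later so that [level] is positive exactly on the side of the graph under
    consideration. *)
Definition level (sgn : R) (x : 'rV[R]_m.+1) : R := sgn * (x ord0 i - g (col' i x)).

Lemma continuous_col' : continuous (fun x : 'rV[R]_m.+1 => col' i x).
Proof.
by apply: continuous_rV => k; under [X in continuous X]funext do rewrite mxE; exact: coord_continuous.
Qed.

Lemma col'_basis_vec j : col' i (basis_vec j : 'rV[R]_m.+1) =
  if unlift i j is Some k then basis_vec k else 0.
Proof.
apply/rowP => l; rewrite !mxE.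
have [k ->|->] := unliftP i j; rewrite !mxE eqxx/=.
  by rewrite (inj_eq lift_inj).
by rewrite eq_sym (negbTE (neq_lift _ _)).
Qed.

Lemma pd_level sgn j x : derivable (level sgn) x (basis_vec j) /\
  pd j (level sgn) x = sgn * graph_normal (col' i x) ord0 j.
Proof.
have [_ Cg] := smooth_C1 sg.
have [H1 H2] : (derivable (fun x => g (col' i x)) x (basis_vec j) <->
   derivable g (col' i x) (col' i (basis_vec j))) /\
  'D_(basis_vec j) (fun x => g (col' i x)) x = 'D_(col' i (basis_vec j)) g (col' i x).
  by apply: derive_ext => h; congr g; apply/rowP => l; rewrite !mxE.
have [_ Ci] := @C1_coord R m.+1 i.
have D1 : is_derive x (basis_vec j) (fun x => x ord0 i) (i == j)%:R.
  exact: is_derive_coord.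
have D2 : is_derive x (basis_vec j) (fun x => g (col' i x)) ((i == j)%:R - graph_normal (col' i x) ord0 j).
  split; first apply/H1; rewrite ?H2 col'_basis_vec /graph_normal {D1 H1 H2}; case: (unliftP i j) => [k|] jE.
  - exact: (Cg k).1.
  - exact: derivable0.
  - by rewrite jE insert_coord_lift !mxE (negbTE (neq_lift _ _)) sub0r opprK.
  - by rewrite jE derive0 insert_coordE eqxx subrr.
have D3 : is_derive x (basis_vec j) (level sgn) (sgn * graph_normal (col' i x) ord0 j).
  rewrite /level; apply: is_derive_eq; rewrite subKr/=.
  by [].
by split; [case: D3|apply: derive_val].
Qed.

Lemma continuous_graph_normal j : continuous (fun y => graph_normal y ord0 j).
Proof.
rewrite /graph_normal; have [k ->|->] := unliftP i j.
  under [X in continuous X]funext do rewrite insert_coord_lift !mxE.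
  move=> y; apply: continuousN; exact: (sg [:: k]).1.
under [X in continuous X]funext do rewrite insert_coordE.
exact: cst_continuous.
Qed.

Lemma C1_level sgn : C1 (level sgn).
Proof.
split.
  rewrite /level; apply: continuous_mul; first exact: cst_continuous.
  apply: continuous_sub.
    exact: coord_continuous.
  exact: (cont_comp continuous_col' (sg [::]).1).
move=> j; split; first by move=> x; exact: (pd_level sgn j x).1.
rewrite (_ : pd j _ = fun x => sgn * graph_normal (col' i x) ord0 j).
  apply: continuous_mul; first exact: cst_continuous.
  apply: (cont_comp (g := fun y => graph_normal y ord0 j) continuous_col').
  exact: continuous_graph_normal.
by apply/funext => x; exact: (pd_level sgn j x).2.
Qed.

Section tangential.
Variables (f : 'rV[R]_m.+1 -> R) (K : set 'rV[R]_m.+1) (b : bool) (j : 'I_m.+1).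
Hypotheses (Cf : C1 f) (cK : compact K) (f0 : forall x, ~ K x -> f x = 0).

Definition graph_side (b : bool) : set 'rV[R]_m.+1 :=
  [set x | if b then g (col' i x) < x ord0 i else x ord0 i < g (col' i x)].

Let sgn : R := (-1) ^+ ~~ b.

Lemma open_graph_side : open (graph_side b).
Proof.
rewrite (_ : graph_side b = level sgn @^-1` [set s | 0 < s]); last first.
  by apply/seteqP; split=> x; rewrite /graph_side /level /sgn; case: b => /=;
    rewrite ?expr0 ?expr1 ?mul1r ?mulN1r ?opprB ?subr_gt0.
apply: open_comp; last exact: open_gt.
by move=> x _; exact: (C1_level sgn).1.
Qed.

Let N x : R := graph_normal (col' i x) ord0 j.

Let cN : continuous N.
Proof.
apply: (cont_comp (g := fun y => graph_normal y ord0 j) continuous_col').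
exact: continuous_graph_normal.
Qed.

(** [N] depends only on the coordinates other than [i], so it is constant along the direction of
    differentiation and comes out of the derivative. *)
Lemma pd_normal_mul (F : 'rV[R]_m.+1 -> R) x : derivable F x (basis_vec i) ->
  derivable (fun x => N x * F x) x (basis_vec i) /\
  pd i (fun x => N x * F x) x = N x * pd i F x.
Proof.
move=> dF.
have [H1 H2] : (derivable (fun x => N x * F x) x (basis_vec i) <->
    derivable (fun z => N x * F z) x (basis_vec i)) /\
    'D_(basis_vec i) (fun x => N x * F x) x = 'D_(basis_vec i) (fun z => N x * F z) x.
  apply: derive_ext => h; rewrite /N; congr (graph_normal _ ord0 j * _).
  by apply/rowP => l; rewrite !mxE eqxx/= eq_sym (negbTE (neq_lift _ _)) mulr0 add0r.
have dc : derivable (fun _ : 'rV[R]_m.+1 => N x) x (basis_vec i) by exact: derivable_cst.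
split; first by apply/H1; exact: (derivableM dc dF).
rewrite /pd H2; have := pdM dc dF; rewrite /pd => ->.
by rewrite (derive_cst (N x)) mulr0 addr0.
Qed.

(* [d_j - N d_i] is tangential to the graph, so it annihilates a cutoff depending on
   [x_i - g] only; such a cutoff may then increase to the indicator of the side. *)
Lemma graph_tangential :
  (\int[lebesgue_rV m.+1]_(x in graph_side b) (pd j f x)%:E =
   \int[lebesgue_rV m.+1]_(x in graph_side b) (N x * pd i f x)%:E)%E.
Proof.
have clK : closed K by apply: compact_closed => //; exact: norm_hausdorff.
have [cf Cdf] := Cf.
pose G x : R := pd j f x - N x * pd i f x.
have cG : continuous G.
  by apply: continuous_sub; [exact: (Cdf j).2|apply: continuous_mul => //; exact: (Cdf i).2].
have G0 x : ~ K x -> G x = 0.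
  by move=> Kx; rewrite /G !(pd_eq0 _ clK f0 Kx) mulr0 subrr.
have iG := compact_support_integrable cK cG G0.
have step k : (\int[lebesgue_rV m.+1]_x (smooth_step k%:R (level sgn x) * G x)%:E = 0)%E.
  pose T x : R := smooth_step k%:R (level sgn x).
  pose T' x : R := smooth_step' k%:R (level sgn x).
  have CT : C1 T.
    apply: (C1_comp (phi := smooth_step k%:R)).
    - exact: C1_level.
    - by move=> s; have [] := is_derive_smooth_step k%:R s.
    - rewrite (_ : (fun s => _) = smooth_step' k%:R); first exact: continuous_smooth_step'.
      by apply/funext => s; have [] := is_derive_smooth_step k%:R s.
  have dT l x : pd l T x = T' x * (sgn * graph_normal (col' i x) ord0 l).
    have [d1 e1] := pd_level sgn l x.
    have [d2 e2] := is_derive_smooth_step k%:R (level sgn x).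
    by rewrite /pd (is_derive_comp d1 d2).2 e2 -e1.
  have CTf := C1M CT Cf.
  have Tf0 x : ~ K x -> T x * f x = 0 by move=> /f0 ->; rewrite mulr0.
  have I1 := integral_pd_eq0 cK Tf0 (CTf.2 j).1 (CTf.2 j).2.
  have dNTf x := pd_normal_mul ((CTf.2 i).1 x).
  have NTf0 x : ~ K x -> N x * (T x * f x) = 0 by move=> /Tf0 ->; rewrite mulr0.
  have eNTf : pd i (fun x => N x * (T x * f x)) = fun x => N x * pd i (fun x => T x * f x) x.
    by apply/funext => x; exact: (dNTf x).2.
  have cNTf : continuous (pd i (fun x => N x * (T x * f x))).
    by rewrite eNTf; apply: continuous_mul => //; exact: (CTf.2 i).2.
  have I2 := integral_pd_eq0 cK NTf0 (fun x => (dNTf x).1) cNTf.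
  have i1 := compact_support_integrable cK (CTf.2 j).2 (fun x => @pd_eq0 _ _ _ _ j x clK Tf0).
  have i2 := compact_support_integrable cK cNTf (fun x => @pd_eq0 _ _ _ _ i x clK NTf0).
  transitivity (\int[lebesgue_rV m.+1]_x ((pd j (fun x => T x * f x) x)%:E -
     (pd i (fun x => N x * (T x * f x)) x)%:E))%E.
    apply: eq_integral => x _; rewrite -EFinB; congr EFin.
    rewrite eNTf (pdM ((CT.2 j).1 x) ((Cdf j).1 x)) (pdM ((CT.2 i).1 x) ((Cdf i).1 x)) !dT.
    (* The [i]-th entry of the normal is 1, so differentiating the cutoff contributes
       [T' x * sgn * N x * f x] to both derivatives, and these terms cancel. *)
    by rewrite insert_coordE mulr1 /G /N /T; ring.
  by rewrite integralB_EFin// I1 I2 sube0.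
have mS : measurable (graph_side b) by apply: open_measurable_rV; exact: open_graph_side.
have lim : (\int[lebesgue_rV m.+1]_(x in graph_side b) (G x)%:E = 0)%E.
  have [] := @dominated_convergence _ _ R (lebesgue_rV m.+1) setT measurableT
    (fun k x => (smooth_step k%:R (level sgn x) * G x)%:E)
    (((fun x => (G x)%:E) \_ (graph_side b))) (fun x => `|(G x)%:E|)%E.
  - move=> k; apply/measurable_EFinP; apply: continuous_measurable_rV => //.
    apply: continuous_mul => //.
    apply: (cont_comp (g := smooth_step k%:R) (C1_level sgn).1).
    move=> s; apply: differentiable_continuous; apply/derivable1_diffP.
    by have [] := is_derive_smooth_step k%:R s.
  - have mG : measurable_fun (graph_side b) (fun x => (G x)%:E).
      by apply/measurable_EFinP; exact: continuous_measurable_rV.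
    exact: (measurable_restrictT _ mS).1 mG.
  - apply: aeW => x _; rewrite patchE; case: ifPn.
      rewrite inE => Sx.
      have lx : 0 < level sgn x.
        by move: Sx; rewrite /graph_side /level /sgn; case: b => /=;
          rewrite ?expr0 ?expr1 ?mul1r ?mulN1r ?opprB ?subr_gt0.
      apply: cvg_near_cst; near=> k.
      rewrite smooth_step_ge1 ?mul1r//.
      rewrite -ler_pdivrMr// mul1r; near: k; exact: nbhs_infty_ger.
    move=> /negP; rewrite inE => Sx.
    have lx : level sgn x <= 0.
      by move: Sx; rewrite /graph_side /level /sgn; case: b => /= /negP;
        rewrite -leNgt ?expr0 ?expr1 ?mul1r ?mulN1r ?opprB ?subr_le0.
    apply: cvg_near_cst; apply: nearW => k.
    by rewrite smooth_step_le0 ?mul0r// mulr_ge0_le0.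
  - exact: integrable_abse.
  - apply: aeW => x k _; rewrite lee_fin normrM ler_piMl//.
    by have /andP[? ?] := smooth_step_bound k%:R (level sgn x); rewrite ger0_norm.
  move=> _ _; rewrite -integral_mkcond => /cvg_lim <-//.
  have -> : [sequence (\int[lebesgue_rV m.+1]_x (smooth_step n%:R (level sgn x) * G x)%:E)%E]_n = fun=> 0%E.
    by apply/funext => k; exact: step.
  by rewrite lim_cst.
have i1 := compact_support_integrable cK (Cdf j).2 (fun x => @pd_eq0 _ _ _ _ j x clK f0).
have iN : (lebesgue_rV m.+1).-integrable setT (fun x => (N x * pd i f x)%:E).
  apply: (compact_support_integrable cK).
    by apply: continuous_mul => //; exact: (Cdf i).2.
  by move=> x Kx; rewrite (pd_eq0 _ clK f0 Kx) mulr0.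
move: lim; under eq_integral do rewrite EFinB.
rewrite integralB_EFin//; [|exact: (integrableS measurableT)..].
have i1' := integrableS measurableT mS (@subsetT _ _) i1.
have iN' := integrableS measurableT mS (@subsetT _ _) iN.
have := integrable_fin_num mS i1'; have := integrable_fin_num mS iN'.
by case: (integral _ _ _) => // a _; case: (integral _ _ _) => // c _ [] /eqP; rewrite subr_eq0 => /eqP ->.
Unshelve. all: by end_near. Qed.

(** After the tangential reduction only [N x * pd i f x] is left. It is the [i]-th derivative of
    [N * f], so the one-dimensional fundamental theorem along the [i]-th axis finishes. *)
Lemma graph_green :
  (\int[lebesgue_rV m.+1]_(x in graph_side b) (pd j f x)%:E =
   \int[lebesgue_rV m]_y ((-1) ^+ b * graph_normal y ord0 j *
      f (@insert_coord R m.+1 i (g y) y))%:E)%E.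
Proof.
rewrite graph_tangential.
have [cf Cdf] := Cf.
have dNf x := pd_normal_mul ((Cdf i).1 x).
have eNf : pd i (fun x => N x * f x) = fun x => N x * pd i f x.
  by apply/funext => x; exact: (dNf x).2.
have cNf : continuous (pd i (fun x => N x * f x)).
  by rewrite eNf; apply: continuous_mul => //; exact: (Cdf i).2.
have Nf0 x : ~ K x -> N x * f x = 0 by move=> /f0 ->; rewrite mulr0.
transitivity (\int[lebesgue_rV m.+1]_(x in graph_side b) (pd i (fun x => N x * f x) x)%:E)%E.
  by apply: eq_integral => x _; rewrite eNf.
rewrite /graph_side; case: b.
  rewrite (integral_pd_epigraph cK Nf0 (fun x => (dNf x).1) cNf (sg [::]).1).
  by apply: eq_integral => y _; rewrite /N col'_insert_coord expr1 mulN1r mulNr.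
rewrite (integral_pd_hypograph cK Nf0 (fun x => (dNf x).1) cNf (sg [::]).1).
by apply: eq_integral => y _; rewrite /N col'_insert_coord expr0 mul1r.
Qed.

End tangential.
End graph_green.

(** * The divergence theorem on a smooth domain *)

Section transport.
Context d1 d2 (X : measurableType d1) (Y : measurableType d2) (R : realType).
Variables (nu : {measure set X -> \bar R}) (mu : {measure set Y -> \bar R}).
Variables (phi : Y -> X) (h : Y -> R) (E : set X).
Hypotheses (mphi : measurable_fun setT phi) (mh : measurable_fun setT h)
  (h0 : forall y, 0 <= h y) (mE : measurable E).
Hypothesis nuE : forall A, measurable A -> A `<=` E ->
  nu A = (\int[mu]_(y in phi @^-1` A) (h y)%:E)%E.
Import HBNNSimple.

Let mpre A : measurable A -> measurable (phi @^-1` A).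
Proof. by move=> mA; rewrite -[X in measurable X]setTI; exact: mphi. Qed.

Let nnsfun_transport (f : {nnsfun X >-> R}) :
  (\int[nu]_(x in E) (f x)%:E = \int[mu]_(y in phi @^-1` E) ((f (phi y))%:E * (h y)%:E))%E.
Proof.
under eq_integral do rewrite fimfunE -fsumEFin//.
rewrite ge0_integral_fsum//; last 2 first.
  - move=> r; apply: measurable_funTS; apply/measurable_EFinP; exact: measurable_funM.
  - by move=> r x _; rewrite EFinM nnfun_muleindic_ge0.
under [RHS]eq_integral.
  move=> y _; rewrite fimfunE -fsumEFin// ge0_mule_fsuml; last first.
    by move=> r; rewrite EFinM nnfun_muleindic_ge0.
  over.
rewrite [RHS]ge0_integral_fsum//; last 3 first.
  - exact: mpre.
  - move=> r; apply: measurable_funTS; apply: emeasurable_funM; last exact/measurable_EFinP.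
    by apply/measurable_EFinP; apply: measurable_funM => //; exact: measurableT_comp.
  - move=> r y _; apply: mule_ge0; last by rewrite lee_fin.
    by rewrite EFinM nnfun_muleindic_ge0.
apply: eq_fsbigr => r; rewrite inE => -[/= x0 _ rE].
have r0 : (0 <= r)%R by rewrite -rE.
have mA : measurable (f @^-1` [set r] `&` E) by exact: measurableI.
transitivity (r%:E * nu (f @^-1` [set r] `&` E))%E.
  under eq_integral do rewrite EFinM.
  rewrite ge0_integralZl_EFin//.
  - by rewrite integral_indic// setIC.
  by apply: measurable_funTS; exact/measurable_EFinP.
rewrite nuE//.
rewrite preimage_setI setIC integral_mkcondr -ge0_integralZl_EFin//; last 3 first.
  - exact: mpre.
  - by move=> y _; rewrite patchE; case: ifPn => // _; rewrite lee_fin.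
  - apply: measurable_funTS; apply/(measurable_restrictT _ _).1; first exact: mpre.
    by apply: measurable_funTS; exact/measurable_EFinP.
apply: eq_integral => y _; rewrite patchE /indic -!EFinM.
rewrite (_ : (y \in phi @^-1` (f @^-1` [set r])) = (phi y \in f @^-1` [set r])); last first.
  by apply/idP/idP; rewrite !inE.
by case: ifPn => _; [rewrite mulr1 EFinM|rewrite mulr0 mul0r; exact: mule0].
Qed.

(** On [E] the measure [nu] is the image under [phi] of the measure with density [h]; the identity
    holds for simple functions and passes to monotone limits. The hypothesis speaks of subsets of
    [E] only, because a chart describes the surface measure only inside its ball. *)
Lemma ge0_integral_transport (F : X -> \bar R) : measurable_fun E F ->
  (forall x, E x -> 0 <= F x)%E ->
  (\int[nu]_(x in E) F x = \int[mu]_(y in phi @^-1` E) (F (phi y) * (h y)%:E))%E.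
Proof.
move=> mF F0; pose f := nnsfun_approx mE mF.
have cf x : E x -> EFin \o f ^~ x @ \oo --> F x.
  by move=> Ex; apply: cvg_nnsfun_approx.
transitivity (limn (fun k => \int[nu]_(x in E) (f k x)%:E)%E).
  rewrite -monotone_convergence//; last 3 first.
  - by move=> k; apply: measurable_funTS; exact/measurable_EFinP.
  - by move=> k x _; rewrite lee_fin.
  - by move=> x _ a b ab; rewrite lee_fin; exact/lefP/nd_nnsfun_approx.
  by apply: eq_integral => x; rewrite inE => Ex; apply/esym/cvg_lim => //; exact: cf.
rewrite (_ : (fun k => _) = fun k => \int[mu]_(y in phi @^-1` E) ((f k (phi y))%:E * (h y)%:E))%E; last first.
  by apply/funext => k; exact: nnsfun_transport.
rewrite -monotone_convergence//; last 4 first.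
- exact: mpre.
- move=> k; apply: measurable_funTS; apply: emeasurable_funM; apply/measurable_EFinP => //.
  exact: measurableT_comp.
- by move=> k y _; rewrite mule_ge0// lee_fin.
- move=> y _ a b ab; rewrite lee_wpmul2r ?lee_fin//; exact/lefP/nd_nnsfun_approx.
apply: eq_integral => y; rewrite inE => Ey; apply/cvg_lim => //.
apply: cvgeZr => //; exact: cf.
Qed.

Lemma integral_transport (F : X -> R) : nu.-integrable E (EFin \o F) ->
  mu.-integrable (phi @^-1` E) (fun y => (F (phi y) * h y)%:E) /\
  (\int[nu]_(x in E) (F x)%:E = \int[mu]_(y in phi @^-1` E) (F (phi y) * h y)%:E)%E.
Proof.
move=> /[dup] iF /integrableP[mF lF].
have mFh : measurable_fun (phi @^-1` E) (fun y => (F (phi y) * h y)%:E).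
  apply/measurable_EFinP; apply: measurable_funM; last exact: measurable_funTS.
  apply: (measurable_comp mE) => //.
  - by move=> _ [y ? <-].
  - exact/measurable_EFinP.
  - exact: measurable_funTS.
split.
  apply/integrableP; split=> //; apply: le_lt_trans lF.
  rewrite ge0_integral_transport//; last exact: measurableT_comp.
  rewrite le_eqVlt; apply/orP; left; apply/eqP; apply: eq_integral => y _.
  by rewrite /= normrM EFinM (ger0_norm (h0 y)).
rewrite [LHS]integralE [RHS]integralE; congr (_ - _)%E.
  rewrite ge0_integral_transport//; last exact: measurable_funepos.
  apply: eq_integral => y _; rewrite !funeposE/= -!EFin_max -EFinM; congr EFin.
  by rewrite maxr_pMl// mul0r.
rewrite ge0_integral_transport//; last exact: measurable_funeneg.
apply: eq_integral => y _; rewrite !funenegE/= -!EFin_max -EFinM; congr EFin.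
by rewrite maxr_pMl// mul0r mulNr.
Qed.

End transport.

Section compact_cover_balls.
Context {R : realType} {n : nat}.

(** [P] carries whatever local fact is attached to a ball, so one extraction of a finite list serves
    charts, cutoffs and local trace bounds alike. *)
Lemma compact_ball_cover (K : set 'rV[R]_n) (P : 'rV[R]_n -> R -> Prop) : compact K ->
  (forall x, K x -> exists2 e, 0 < e & P x e) ->
  exists L : seq ('rV[R]_n * R),
    (forall p, p \in L -> [/\ K p.1, 0 < p.2 & P p.1 p.2]) /\
    forall x, K x -> exists2 p, p \in L & ball p.1 p.2 x.
Proof.
rewrite compact_cover => cK KP.
have H x : exists e : R, K x -> 0 < e /\ P x e.
  have [Kx|] := pselect (K x); last by exists 0.
  by have [e ? ?] := KP x Kx; exists e.
have [e eP] := choice H.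
have [||D DK KD] := cK _ K (fun x => ball x (e x)).
- by move=> x Kx; apply: ball_open; exact: (eP x Kx).1.
- by move=> x Kx; exists x => //; apply: ballxx; exact: (eP x Kx).1.
exists [seq (x, e x) | x <- finmap.enum_fset D]; split.
  move=> p /mapP[x xD ->] /=.
  have Kx : K x by have := DK x xD; rewrite inE.
  by have [] := eP x Kx.
move=> x /KD[z /= zD zx]; exists (z, e z) => //.
by apply/mapP; exists z.
Qed.

End compact_cover_balls.

Section charts.
Context {R : realType} {m : nat}.
Variables (Omega : set 'rV[R]_m.+1).
Hypothesis oO : open Omega.

Definition graph_point (i : 'I_m.+1) (g : 'rV[R]_m -> R) (y : 'rV[R]_m) : 'rV[R]_m.+1 :=
  @insert_coord R m.+1 i (g y) y.

Lemma continuous_graph_point i g : continuous g -> continuous (graph_point i g).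
Proof.
move=> cg; apply: continuous_rV => j; rewrite /graph_point; have [k ->|->] := unliftP i j.
  by under [X in continuous X]funext do rewrite insert_coord_lift; exact: coord_continuous.
by under [X in continuous X]funext do rewrite insert_coordE.
Qed.

Variables (p : 'rV[R]_m.+1) (i : 'I_m.+1) (b : bool) (g : 'rV[R]_m -> R) (r : R).
Hypothesis chart : @boundary_chart R m.+1 Omega p i b g r.

Let cg : continuous g. Proof. by case: chart => + _ _; move=> /(_ [::])[]. Qed.
Let r0 : 0 < r. Proof. by case: chart. Qed.

Lemma chart_side x : ball p r x -> (Omega x <-> graph_side i g b x).
Proof. by case: chart => _ _ H /H. Qed.

Definition chart_area : 'rV[R]_m -> R := @area_factor R m.+1 g.

Lemma chart_area_ge1 y : 1 <= chart_area y.
Proof.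
rewrite -[leLHS]sqrtr1 ler_wsqrtr// lerDl.
by apply: sumr_ge0 => k _; exact: sqr_ge0.
Qed.

Lemma continuous_chart_area : continuous chart_area.
Proof.
have sg : smooth g by case: chart.
apply: (cont_comp (g := Num.sqrt)); last exact: sqrt_continuous.
apply: continuous_add; first exact: cst_continuous.
have : forall s : seq 'I_m, continuous (fun y => \sum_(k <- s) pderiv [:: k] g y ^+ 2).
  elim=> [|k s IH].
    by under [X in continuous X]funext do rewrite big_nil; exact: cst_continuous.
  under [X in continuous X]funext do rewrite big_cons.
  by apply: continuous_add => //; apply: continuous_mul; exact: (sg [:: k]).1.
exact.
Qed.

Lemma bounded_graph_preimage :
  exists M : R, forall y, ball p r (graph_point i g y) -> `|y| <= M.
Proof.
exists (`|p| + r) => y py; apply: norm_le_coord; rewrite ?addr_ge0// ?ltW//.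
move=> k; have := (ball_rVP _ _ r0).1 py (lift i k).
rewrite /graph_point insert_coord_lift => H.
have := coord_le_norm p (lift i k).
by move=> H2; have := ler_distD (p ord0 (lift i k)) (y ord0 k) 0; rewrite !subr0 distrC => H3; lra.
Qed.

End charts.

Section surface.
Context {R : realType} {m : nat}.
Variables (Omega : set 'rV[R]_m.+1) (sigma : {measure set 'rV[R]_m.+1 -> \bar R})
  (nu : 'rV[R]_m.+1 -> 'rV[R]_m.+1).
Hypotheses (hO : @bounded_smooth_domain R m.+1 Omega)
  (hs : @surface_measure R m.+1 Omega sigma)
  (hnu : @outward_unit_normal R m.+1 Omega nu).
Local Notation leb := (lebesgue_rV m.+1 : {measure set 'rV[R]_m.+1 -> \bar R}).

Let oO : open Omega. Proof. by case: hO. Qed.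

Lemma measurable_Omega : measurable Omega.
Proof. exact: open_measurable_rV. Qed.

Lemma compact_closure_Omega : compact (closure Omega).
Proof.
apply: bounded_closed_compact; last exact: closed_closure.
have [M [Mr MP]] : bounded_set Omega by case: hO.
pose S := [set x : 'rV[R]_m.+1 | `|x| <= M + 1].
have cS : closed S.
  rewrite (_ : S = Num.norm @^-1` [set s : R | s <= M + 1])//.
  by apply: closed_comp; [move=> x _; exact: norm_continuous|exact: closed_le].
have OS : closure Omega `<=` S.
  rewrite [X in _ `<=` X](closure_id S).1//; apply: closure_subset => x Ox.
  by apply: (MP (M + 1)) => //; rewrite ltrDl.
exists (M + 1); split; first exact: num_real.
by move=> z Mz x /OS xM; apply: le_trans xM (ltW Mz).
Qed.

Lemma closed_bd : closed (bd Omega).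
Proof.
rewrite /bd setDE; apply: closedI; first exact: closed_closure.
by apply: open_closedC; exact: open_interior.
Qed.

Lemma bd_Omega x : bd Omega x -> ~ Omega x.
Proof. by move=> [_]; rewrite ((interior_id _).1 oO). Qed.

Lemma measurable_bd : measurable (bd Omega).
Proof. apply: closed_measurable_rV; exact: closed_bd. Qed.

Lemma compact_bd : compact (bd Omega).
Proof.
by apply: (subclosed_compact closed_bd compact_closure_Omega) => x [].
Qed.

Lemma leb_Omega_lty : (leb Omega < +oo)%E.
Proof. by apply: lebesgue_rV_bounded; [exact: measurable_Omega|case: hO]. Qed.

Lemma sigma_setI_bd A : measurable A -> sigma A = sigma (A `&` bd Omega).
Proof.
move=> mA; have [s0 _] := hs.
rewrite (measureDI sigma mA measurable_bd) [X in (X + _)%E](_ : _ = 0%E) ?add0e//.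
apply: subset_measure0 s0; [|exact: measurableC measurable_bd|by move=> x []].
by apply: measurableD => //; exact: measurable_bd.
Qed.

Section chart.
Variables (p : 'rV[R]_m.+1) (i : 'I_m.+1) (b : bool) (g : 'rV[R]_m -> R) (r : R).
Hypothesis chart : @boundary_chart R m.+1 Omega p i b g r.

Let cg : continuous g. Proof. by case: chart => + _ _; move=> /(_ [::])[]. Qed.
Let sg : smooth g. Proof. by case: chart. Qed.
Let r0 : 0 < r. Proof. by case: chart. Qed.
Local Notation gamma := (graph_point i g).

Lemma measurable_ball_rV (q : 'rV[R]_m.+1) (e : R) : measurable (ball q e : set 'rV[R]_m.+1).
Proof.
have [e0|e0] := ltP 0 e; first by apply: open_measurable_rV; exact: ball_open.
rewrite (_ : ball q e = set0)//; apply/seteqP; split=> // x [+ _].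
by rewrite ltNge e0.
Qed.

Lemma measurable_gamma : measurable_fun setT (gamma : 'rV[R]_m -> 'rV[R]_m.+1).
Proof.
apply: measurable_rVP => j; apply: continuous_measurable_rV => //.
apply: (cont_comp (continuous_graph_point (i := i) cg)).
exact: coord_continuous.
Qed.

Lemma measurable_gamma_pre A : measurable A -> measurable (gamma @^-1` A).
Proof. by move=> mA; rewrite -[X in measurable X]setTI; exact: measurable_gamma. Qed.

Lemma measurable_chart_area : measurable_fun setT (chart_area g).
Proof. by apply: continuous_measurable_rV => //; exact: (continuous_chart_area chart). Qed.

Lemma chart_area_ge0 y : 0 <= chart_area g y.
Proof. exact: sqrtr_ge0. Qed.

Lemma sigma_chart A : measurable A -> A `<=` ball p r ->
  sigma A = (\int[lebesgue_rV m]_(y in gamma @^-1` A) (chart_area g y)%:E)%E.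
Proof.
move=> mA Ap; rewrite sigma_setI_bd//.
by have [_ hs2] := hs; rewrite (hs2 _ _ _ _ _ chart A mA Ap).
Qed.

(** The parameters [y] whose graph point lies in the ball stay in a bounded set, on which the
    continuous area factor is bounded. *)
Lemma sigma_ball_lty : (sigma (ball p r) < +oo)%E.
Proof.
have mB := measurable_ball_rV p r.
rewrite sigma_chart//.
have [M MP] := bounded_graph_preimage chart.
pose K := [set y : 'rV[R]_m | `|y| <= M].
have cK : compact K.
  apply: bounded_closed_compact.
    exists M; split; first exact: num_real.
    by move=> z Mz x /= xM; apply: le_trans xM (ltW Mz).
  rewrite (_ : K = Num.norm @^-1` [set s : R | s <= M])//.
  by apply: closed_comp; [move=> x _; exact: norm_continuous|exact: closed_le].
have [N [_ NP]] : bounded_set (chart_area g @` K).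
  apply: compact_bounded; apply: continuous_compact => //.
  by apply: continuous_subspaceT; exact: (continuous_chart_area chart).
have mG := measurable_gamma_pre mB.
apply: (@le_lt_trans _ _ (\int[lebesgue_rV m]_(y in gamma @^-1` (ball p r)) (cst (`|N| + 1)%:E y))%E).
  apply: ge0_le_integral => //.
  - by move=> y _; rewrite lee_fin chart_area_ge0.
  - by apply: measurable_funTS; apply/measurable_EFinP; exact: measurable_chart_area.
  - move=> y /MP yK; rewrite lee_fin; apply: le_trans (ler_norm _) _.
    by apply: (NP (`|N| + 1)); [rewrite ltr_pwDr// ler_norm|exists y].
rewrite integral_cst// lte_mul_pinfty//.
apply: lebesgue_rV_bounded => //.
exists M; split; first exact: num_real.
by move=> z Mz y /MP yM; apply: le_trans yM (ltW Mz).
Qed.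

Definition chart_nu j (x : 'rV[R]_m.+1) : R :=
  (-1) ^+ b * graph_normal i g (col' i x) ord0 j / chart_area g (col' i x).

Lemma nu_chart j x : bd Omega x -> ball p r x -> nu x ord0 j = chart_nu j x.
Proof.
move=> bx px; rewrite (hnu chart bx px) mxE /chart_nu /graph_normal.
by rewrite mulrAC.
Qed.

Lemma chart_area_gt0 y : 0 < chart_area g y.
Proof. by apply: lt_le_trans (chart_area_ge1 _ _). Qed.

Lemma continuous_chart_nu j : continuous (chart_nu j).
Proof.
apply: continuous_mul.
  apply: continuous_mul; first exact: cst_continuous.
  apply: (cont_comp (g := fun y => graph_normal i g y ord0 j) (continuous_col' (i := i))).
  exact: continuous_graph_normal.
move=> x; apply: (@continuousV _ _ (fun x => chart_area g (col' i x))).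
  by rewrite gt_eqF// chart_area_gt0.
exact: (cont_comp (continuous_col' (i := i)) (continuous_chart_area chart)).
Qed.

Lemma chart_nu_bound j x : `|chart_nu j x| <= 1.
Proof.
rewrite /chart_nu normrM normfV (gtr0_norm (chart_area_gt0 _)) ler_pdivrMr ?chart_area_gt0// mul1r.
rewrite normrMsign -ler_sqr ?nnegrE// ?chart_area_ge0// real_normK ?num_real//.
rewrite sqr_sqrtr; last by rewrite addr_ge0// sumr_ge0// => k _; exact: sqr_ge0.
rewrite /graph_normal; have [k ->|->] := unliftP i j.
  rewrite insert_coord_lift !mxE sqrrN (bigD1 k)//= addrCA lerDl addr_ge0//.
  by rewrite sumr_ge0// => l _; exact: sqr_ge0.
by rewrite insert_coordE expr1n lerDl sumr_ge0// => l _; exact: sqr_ge0.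
Qed.

Definition green_holds (j : 'I_m.+1) (psi : 'rV[R]_m.+1 -> R) :=
  (\int[leb]_(x in Omega) (pd j psi x)%:E = \int[sigma]_(x in bd Omega) (psi x * nu x ord0 j)%:E)%E.

(** The support lies in the chart ball, so [Omega] may be replaced by the whole side of the graph
    and the surface measure by its graph parametrisation. *)
Lemma green_chart j psi K : C1 psi -> compact K -> K `<=` ball p r ->
  (forall x, ~ K x -> psi x = 0) -> green_holds j psi.
Proof.
move=> Cpsi cK Kp psi0; rewrite /green_holds.
have clK : closed K by apply: compact_closed => //; exact: norm_hausdorff.
have mB := measurable_ball_rV p r.
transitivity (\int[leb]_(x in graph_side i g b) (pd j psi x)%:E)%E.
  rewrite integral_mkcond [RHS]integral_mkcond; apply: eq_integral => x _; rewrite !patchE.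
  have [Kx|nKx] := pselect (K x); last first.
    by rewrite (pd_eq0 j clK psi0 nKx); case: ifPn; case: ifPn.
  congr (if _ then _ else _); apply/idP/idP; rewrite !inE => H.
    by apply/(chart_side chart (Kp _ Kx)).
  by apply/(chart_side chart (Kp _ Kx)).
rewrite (graph_green i sg b j Cpsi cK psi0).
pose F x := psi x * chart_nu j x.
have cF : continuous F by apply: continuous_mul; [case: Cpsi|exact: continuous_chart_nu].
have F0 x : ~ K x -> F x = 0 by move=> /psi0 Fx; rewrite /F Fx mul0r.
have mF : measurable_fun setT F by exact: continuous_measurable_rV.
have iF : sigma.-integrable (ball p r) (EFin \o F).
  apply: measurable_bounded_integrable => //.
  - exact: sigma_ball_lty.
  - exact: measurable_funTS.
  have /compact_bounded[M [Mr MP]] : compact (F @` K).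
    by apply: continuous_compact => //; exact: continuous_subspaceT.
  exists `|M|; split=> // z Mz x px.
  rewrite /=; have [Kx|/F0 ->] := pselect (K x).
    by apply: MP; [apply: le_lt_trans Mz; exact: ler_norm|exists x].
  by rewrite normr0; apply: le_trans (ltW Mz).
transitivity (\int[sigma]_(x in ball p r) (F x)%:E)%E; last first.
  have e1 : (\int[sigma]_(x in ball p r) (F x)%:E = \int[sigma]_(x in ball p r `&` bd Omega) (F x)%:E)%E.
    rewrite (negligible_integral (N := ~` bd Omega)) ?setDE ?setCK//.
    - exact: measurableC measurable_bd.
    - by case: hs.
  rewrite e1 integral_mkcond [RHS]integral_mkcond; apply: eq_integral => x _; rewrite !patchE.
  have [Kx|nKx] := pselect (K x); last first.
    by rewrite F0// psi0// mul0r; case: ifPn; case: ifPn.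
  have px := Kp _ Kx.
  rewrite in_setI (mem_set px)/=; case: ifPn => // /set_mem bx.
  by rewrite /F (nu_chart j bx px).
have [_ ->] := integral_transport measurable_gamma measurable_chart_area chart_area_ge0 mB sigma_chart iF.
rewrite [RHS]integral_mkcond; apply: eq_integral => y _; rewrite patchE.
have [Ky|nKy] := pselect (K (gamma y)); last first.
  by rewrite F0// psi0// mul0r mulr0; case: ifPn.
rewrite mem_set; last exact: Kp.
(* The area factor of the surface measure cancels the normalisation of [nu]. *)
have a0 : chart_area g y != 0 by rewrite gt_eqF// chart_area_gt0.
by rewrite /F /chart_nu col'_insert_coord -[in RHS]mulrA divfK// mulrC.
Qed.

End chart.

Definition is_chart_ball (x : 'rV[R]_m.+1) (e : R) :=
  exists i b g, @boundary_chart R m.+1 Omega x i b g e.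

Lemma chart_cover : exists L : seq ('rV[R]_m.+1 * R),
  (forall p, p \in L -> is_chart_ball p.1 p.2) /\
  forall x, bd Omega x -> exists2 p, p \in L & ball p.1 p.2 x.
Proof.
have [||L [L1 L2]] := @compact_ball_cover R m.+1 (bd Omega) is_chart_ball.
- exact: compact_bd.
- move=> x bx; have [_ _ _ /(_ x bx)[i [b [g [e ch]]]]] := hO.
  by exists e; [case: ch|exists i, b, g].
by exists L; split=> // p /L1[].
Qed.

Lemma sigma_lty : (sigma setT < +oo)%E.
Proof.
rewrite sigma_setI_bd// setTI.
have [L [L1 L2]] := chart_cover.
have mB (L' : seq ('rV[R]_m.+1 * R)) : measurable (\big[setU/set0]_(p <- L') ball p.1 p.2 : set 'rV[R]_m.+1).
  by apply: bigsetU_measurable => p _; exact: measurable_ball_rV.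
have H (L' : seq ('rV[R]_m.+1 * R)) : (forall p, p \in L' -> is_chart_ball p.1 p.2) ->
    (sigma (\big[setU/set0]_(p <- L') ball p.1 p.2) < +oo)%E.
  elim: L' => [_|p L' IH H']; first by rewrite big_nil measure0.
  rewrite big_cons; apply: (le_lt_trans (measureU2 _ _ _)) => //.
    exact: measurable_ball_rV.
  apply: lte_add_pinfty; last by apply: IH => q qL; apply: H'; rewrite in_cons qL orbT.
  have [i [b [g ch]]] := H' p (mem_head _ _).
  exact: (sigma_ball_lty ch).
apply: le_lt_trans (H L L1).
apply: le_measure; rewrite ?inE//; first exact: measurable_bd.
by move=> x /L2[p pL px]; rewrite -bigcup_seq; exists p.
Qed.

Lemma nu_bound j x : bd Omega x -> `|nu x ord0 j| <= 1.
Proof.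
move=> bx; have [_ _ _ /(_ x bx)[i [b [g [e ch]]]]] := hO.
rewrite (nu_chart ch j bx); first exact: chart_nu_bound.
by apply: ballxx; case: ch.
Qed.

(** [nu] is prescribed only through chart formulas, each continuous on its ball; finitely many balls
    cover the boundary. *)
Lemma measurable_nu j : measurable_fun (bd Omega) (fun x => nu x ord0 j).
Proof.
have [L [L1 L2]] := chart_cover.
have mB (L' : seq ('rV[R]_m.+1 * R)) : measurable (\big[setU/set0]_(p <- L') ball p.1 p.2 : set 'rV[R]_m.+1).
  by apply: bigsetU_measurable => p _; exact: measurable_ball_rV.
have H (L' : seq ('rV[R]_m.+1 * R)) : (forall p, p \in L' -> is_chart_ball p.1 p.2) ->
    measurable_fun (bd Omega `&` \big[setU/set0]_(p <- L') ball p.1 p.2) (fun x => nu x ord0 j).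
  elim: L' => [_|p L' IH H'].
    by rewrite big_nil setI0; exact: measurable_fun_set0.
  rewrite big_cons setIUr; apply/measurable_funU.
  - by apply: measurableI; [exact: measurable_bd|exact: measurable_ball_rV].
  - by apply: measurableI => //; exact: measurable_bd.
  split; last by apply: IH => q qL; apply: H'; rewrite in_cons qL orbT.
  have [i [b [g ch]]] := H' p (mem_head _ _).
  apply: (eq_measurable_fun (chart_nu i b g j)).
    by move=> x; rewrite inE => -[bx px]; rewrite (nu_chart ch j bx px).
  apply: measurable_funTS; apply: continuous_measurable_rV => //.
  exact: (continuous_chart_nu ch).
have := H L L1; rewrite setIidl// => x /L2[p pL px].
by rewrite -bigcup_seq; exists p.
Qed.

Lemma continuous_bounded_closure (f : 'rV[R]_m.+1 -> R) : continuous f ->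
  exists2 M : R, 0 <= M & forall x, closure Omega x -> `|f x| <= M.
Proof.
move=> cf; have [M [_ MP]] : bounded_set (f @` closure Omega).
  apply: compact_bounded; apply: continuous_compact; last exact: compact_closure_Omega.
  exact: continuous_subspaceT.
exists (`|M| + 1); first by rewrite addr_ge0.
by move=> x cx; apply: MP; [rewrite ltr_pwDr// ler_norm|exists x].
Qed.

Lemma integrable_pd_Omega (f : 'rV[R]_m.+1 -> R) : continuous f ->
  leb.-integrable Omega (EFin \o f).
Proof.
move=> cf; have [M M0 MP] := continuous_bounded_closure cf.
refine (measurable_bounded_integrable _ _ _ _).
- exact: measurable_Omega.
- exact: leb_Omega_lty.
- by apply: continuous_measurable_rV => //; exact: measurable_Omega.
- exists M; split; first exact: num_real.
  by move=> z Mz x Ox; apply: le_trans (ltW Mz); apply: MP; exact: subset_closure.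
Qed.

Lemma integrable_nu_bd j (f : 'rV[R]_m.+1 -> R) : continuous f ->
  sigma.-integrable (bd Omega) (fun x => (f x * nu x ord0 j)%:E).
Proof.
move=> cf; have [M M0 MP] := continuous_bounded_closure cf.
apply: (measurable_bounded_integrable (f := fun x => f x * nu x ord0 j)).
- exact: measurable_bd.
- rewrite (le_lt_trans _ sigma_lty)//; apply: le_measure; rewrite ?inE//; exact: measurable_bd.
- apply: measurable_funM; last exact: measurable_nu.
  by apply: continuous_measurable_rV => //; exact: measurable_bd.
- exists M; split; first exact: num_real.
  move=> z Mz x bx; apply: le_trans (ltW Mz); rewrite /= normrM.
  rewrite -[leRHS]mulr1 ler_pM ?normr_ge0 ?nu_bound//; apply: MP; by case: bx.
Qed.

Lemma green_holdsD j f1 f2 : C1 f1 -> C1 f2 -> green_holds j f1 -> green_holds j f2 ->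
  green_holds j (fun x => f1 x + f2 x).
Proof.
move=> C1f C2f H1 H2; rewrite /green_holds.
transitivity (\int[leb]_(x in Omega) ((pd j f1 x)%:E + (pd j f2 x)%:E))%E.
  apply: eq_integral => x _; rewrite -EFinD; congr EFin.
  by apply: deriveD; [exact: (C1f.2 j).1|exact: (C2f.2 j).1].
rewrite integralD_EFin//; [|exact: measurable_Omega|exact: integrable_pd_Omega (C1f.2 j).2|exact: integrable_pd_Omega (C2f.2 j).2].
rewrite [X in (X + _)%E]H1 [X in (_ + X)%E]H2.
under [RHS]eq_integral do rewrite mulrDl EFinD.
rewrite integralD_EFin//; [exact: measurable_bd|exact: integrable_nu_bd C1f.1|exact: integrable_nu_bd C2f.1].
Qed.

(** Both sides vanish: [psi] is zero on the boundary, and the bulk integral is either empty or that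
    of a derivative of a compactly supported function over the whole space. *)
Lemma green_interior j psi K (U : set 'rV[R]_m.+1) : C1 psi -> compact K -> K `<=` U -> open U ->
  U `&` bd Omega = set0 -> U `<=` Omega \/ U `&` Omega = set0 ->
  (forall x, ~ K x -> psi x = 0) -> green_holds j psi.
Proof.
move=> Cpsi cK KU oU Ubd UO psi0; rewrite /green_holds.
have clK : closed K by apply: compact_closed => //; exact: norm_hausdorff.
rewrite [RHS]integral0_eq; last first.
  move=> x bx; rewrite psi0 ?mul0r// => Kx.
  by have : (U `&` bd Omega) x; [split=> //; exact: KU|rewrite Ubd].
case: UO => [UO|UO]; last first.
  apply: integral0_eq => x Ox; rewrite (pd_eq0 j clK psi0)// => Kx.
  by have : (U `&` Omega) x; [split=> //; exact: KU|rewrite UO].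
rewrite -(integral_pd_eq0 cK psi0 (Cpsi.2 j).1 (Cpsi.2 j).2) integral_mkcond.
apply: eq_integral => x _; rewrite patchE; case: ifPn => //; rewrite notin_setE => nOx.
by rewrite (pd_eq0 j clK psi0)// => /KU/UO.
Qed.

Definition green_local (x : 'rV[R]_m.+1) (e : R) := forall j psi K, C1 psi -> compact K ->
  K `<=` ball x e -> (forall x, ~ K x -> psi x = 0) -> green_holds j psi.

Lemma green_local_closure x : closure Omega x -> exists2 e, 0 < e & green_local x e.
Proof.
move=> cx; have [Ox|nOx] := pselect (Omega x).
  have [e e0 eO] := open_obox_sub oO Ox; exists e => // j psi K Cpsi cK Ke psi0.
  apply: (@green_interior j psi K (ball x e)) => //; [exact: ball_open| |by left].
  by apply/seteqP; split=> // z [/eO Oz /bd_Omega].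
have bx : bd Omega x by split=> //; rewrite ((interior_id _).1 oO).
have [_ _ _ /(_ x bx)[i [b [g [e ch]]]]] := hO.
exists e; first by case: ch.
by move=> j psi K Cpsi cK Ke psi0; exact: (green_chart ch j Cpsi cK Ke).
Qed.

(** Green's formula is asked of [psi * chi] for every C1 [psi], so that in [green_C1] the function
    [psi] may already carry cutoffs of other balls. *)
Definition has_cutoff (x : 'rV[R]_m.+1) (e : R) := exists chi, [/\ C1 chi,
  forall z, ball x e z -> chi z = 1 &
  forall j psi, C1 psi -> green_holds j (fun z => psi z * chi z)].

(** Balls are cubes of the sup norm, while the cutoff is a function of the squared Euclidean
    distance [d], which is a polynomial: it is 1 where d <= A and 0 where d >= 4 A. *)
Lemma cutoff_ball (x : 'rV[R]_m.+1) (e : R) : 0 < e -> exists2 e', 0 < e' &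
  exists chi K, [/\ C1 chi, compact K, K `<=` ball x e, forall z, ~ K z -> chi z = 0 &
    forall z, ball x e' z -> chi z = 1].
Proof.
move=> e0; pose N : R := m.+1%:R; have N1 : 1 <= N by rewrite ler1n.
have N0 : 0 < N by rewrite ltr0n.
(* On the cube of radius [e'] one has d <= N e'^2 = A, and this radius gives 4 A = e^2 / (4 N) <
   e^2, so that the set d <= 4 A fits into the cube of radius [e]. *)
exists (e / (4 * N)); first by rewrite divr_gt0// mulr_gt0.
set e' := e / (4 * N); have e'0 : 0 < e' by rewrite divr_gt0// mulr_gt0.
pose A := N * e' ^+ 2; have A0 : 0 < A by rewrite mulr_gt0// exprn_gt0.
have Ae : 4 * A < e ^+ 2.
  have eE : e = 4 * N * e' by rewrite /e' mulrC divfK// gt_eqF// mulr_gt0.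
  by rewrite eE /A; nra.
pose d (z : 'rV[R]_m.+1) : R := \sum_(k < m.+1) (z ord0 k - x ord0 k) ^+ 2.
have Cd : C1 d.
  apply: C1_sum => k; rewrite /C1 -/(C1 _).
  have Ck : C1 (fun z : 'rV[R]_m.+1 => z ord0 k - x ord0 k).
    by apply: C1B; [exact: C1_coord|exact: C1_cst].
  exact: (C1M Ck Ck).
(* The slope that brings the step from 0 at d = A to 1 at d = 4 A. *)
pose kk := (3 * A)^-1.
exists (fun z => 1 - smooth_step kk (d z - A)), [set z | d z <= 4 * A]; split.
- apply: C1B; first exact: C1_cst.
  apply: (C1_comp (phi := smooth_step kk)).
  + by apply: C1B => //; exact: C1_cst.
  + by move=> s; have [] := is_derive_smooth_step kk s.
  + rewrite (_ : (fun s => _) = smooth_step' kk); first exact: continuous_smooth_step'.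
    by apply/funext => s; have [] := is_derive_smooth_step kk s.
- apply: bounded_closed_compact.
    exists (`|x| + e); split; first exact: num_real.
    move=> y ye z /= dz; apply: le_trans (ltW ye); apply: norm_le_coord.
      by rewrite addr_ge0// ltW.
    move=> k; have : (z ord0 k - x ord0 k) ^+ 2 <= e ^+ 2.
      apply: le_trans (ltW Ae); apply: le_trans dz; rewrite /d (bigD1 k)//= lerDl.
      by apply: sumr_ge0 => l _; exact: sqr_ge0.
    rewrite -(real_normK (num_real _)) ler_sqr ?nnegrE// ?(ltW e0)// => H.
    by have := ler_distD (x ord0 k) (z ord0 k) 0; rewrite !subr0; have := coord_le_norm x k; lra.
  rewrite (_ : [set z | _] = d @^-1` [set s : R | s <= 4 * A])//.
  by apply: closed_comp; [move=> z _; exact: Cd.1|exact: closed_le].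
- move=> z /= dz; apply/ball_rVP => // k; rewrite distrC.
  have : (z ord0 k - x ord0 k) ^+ 2 < e ^+ 2.
    apply: le_lt_trans Ae; apply: le_trans dz; rewrite /d (bigD1 k)//= lerDl.
    by apply: sumr_ge0 => l _; exact: sqr_ge0.
  by rewrite -(real_normK (num_real _)) ltr_sqr ?nnegrE// ltW.
- move=> z /= /negP; rewrite -ltNge => dz; rewrite smooth_step_ge1 ?subrr//.
  have h3 : 0 < 3 * A by exact: mulr_gt0.
  rewrite /kk [X in _ <= X]mulrC (ler_pdivlMr _ _ h3) mul1r.
  have -> : 3 * A = 4 * A - A by ring.
  by rewrite lerB// ltW.
- move=> z ze; rewrite smooth_step_le0 ?subr0//.
  have k0 : 0 <= kk by rewrite /kk invr_ge0 mulr_ge0// ltW.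
  apply: mulr_ge0_le0 => //; rewrite subr_le0.
  have -> : A = \sum_(k < m.+1) e' ^+ 2 by rewrite sumr_const card_ord -mulr_natl.
  apply: ler_sum => k _; have := (ball_rVP _ _ e'0).1 ze k; rewrite distrC => H.
  by rewrite -(real_normK (num_real _)) ler_sqr ?nnegrE// ltW.
Qed.

Lemma closure_has_cutoff x : closure Omega x -> exists2 e, 0 < e & has_cutoff x e.
Proof.
move=> /green_local_closure[e e0 gl].
have [e' e'0 [chi [K [Cchi cK Ke chi0 chi1]]]] := cutoff_ball x e0.
exists e' => //; exists chi; split=> // j psi Cpsi.
by apply: (gl j _ K) => //; [exact: C1M|move=> z /chi0 ->; rewrite mulr0].
Qed.

(** In place of a partition of unity, psi = psi chi + psi (1 - chi) peels off one ball at a time.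
    What remains is [psi * Phi], with [Phi] the product of all the factors 1 - chi; it vanishes on
    the closure of [Omega], so Green's formula for it reads 0 = 0. *)
Theorem green_C1 j psi : C1 psi -> green_holds j psi.
Proof.
move=> Cpsi.
have [L [L1 L2]] := compact_ball_cover compact_closure_Omega closure_has_cutoff.
have H (L' : seq ('rV[R]_m.+1 * R)) : (forall p, p \in L' -> has_cutoff p.1 p.2) ->
  exists Phi, [/\ C1 Phi, forall z p, p \in L' -> ball p.1 p.2 z -> Phi z = 0 &
    forall psi, C1 psi -> green_holds j (fun z => psi z * Phi z) -> green_holds j psi].
  elim: L' => [_|p L' IH H'].
    exists (cst 1); split=> //; first exact: C1_cst.
    by move=> f _; rewrite (_ : (fun z => _) = f)//; apply/funext => z; rewrite mulr1.
  have [|Phi [CPhi Phi0 PhiG]] := IH.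
    by move=> q qL; apply: H'; rewrite in_cons qL orbT.
  have [chi [Cchi chi1 chiG]] := H' p (mem_head _ _).
  have C1c : C1 (fun z => 1 - chi z) by apply: C1B => //; exact: C1_cst.
  exists (fun z => (1 - chi z) * Phi z); split.
  - exact: C1M.
  - move=> z q; rewrite in_cons => /orP[/eqP -> /chi1 ->|qL qz].
      by rewrite subrr mul0r.
    by rewrite (Phi0 z q)// mulr0.
  - move=> f Cf Hf.
    have Cfc := C1M Cf C1c.
    have G1 : green_holds j (fun z => f z * (1 - chi z)).
      apply: PhiG => //; move: Hf; congr (green_holds j _).
      by apply/funext => z; rewrite mulrA.
    have := green_holdsD Cfc (C1M Cf Cchi) G1 (chiG j f Cf).
    congr (green_holds j _); apply/funext => z.
    by rewrite -mulrDr subrK mulr1.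
have [|Phi [CPhi Phi0 PhiG]] := H L; first by move=> p /L1[].
apply: PhiG => //; rewrite /green_holds !integral0_eq//.
  move=> x bx; have [|p pL px] := L2 x; first by case: bx.
  by rewrite (Phi0 x p)// mulr0 mul0r.
move=> x Ox; have [|p pL px] := L2 x; first exact: subset_closure.
rewrite (pd_eq0 (K := ~` ball p.1 p.2))//.
- apply: open_closedC; apply: ball_open; by have [] := L1 p pL.
- by move=> z; rewrite /setC/= => /contrapT/(Phi0 z p pL) ->; rewrite mulr0.
Qed.

End surface.

(** * Bump functions and the fundamental lemma *)

Section smooth_functions.
Context {R : realType} {n : nat}.
Implicit Types (f g : 'rV[R]_n -> R) (i : 'I_n).

(** Peels off the innermost derivative, whereas [pderiv] peels off the outermost. In this order the
    product and chain rules close up by induction on [k]; [pderiv_rcons] translates between the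
    two. *)
Fixpoint Ck (k : nat) f : Prop :=
  if k is k'.+1 then
    continuous f /\ forall i, (forall x, derivable f x (basis_vec i)) /\ Ck k' (pd i f)
  else continuous f.

Lemma pderiv_rcons (a : seq 'I_n) i f : pderiv (rcons a i) f = pderiv a (pd i f).
Proof. by elim: a => //= j a ->. Qed.

Lemma CkS k f : Ck k.+1 f -> Ck k f.
Proof.
elim: k f => [|k IH] f; first by case.
move=> [cf Hf]; split=> // i; have [df Cf] := Hf i.
by split=> //; exact: IH.
Qed.

Lemma smoothP f : smooth f <-> forall k, Ck k f.
Proof.
split=> [sf k|Cf a].
  elim: k f sf => [|k IH] f sf; first exact: (sf [::]).1.
  split=> [|i]; first exact: (sf [::]).1.
  split=> [x|]; first exact: (sf [::]).2.
  by apply: IH => a; rewrite -pderiv_rcons; exact: sf.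
elim/last_ind: a f Cf => [|a i IH] f Cf.
  by split; [exact: (Cf 0)|move=> i x; exact: ((Cf 1).2 i).1].
by rewrite pderiv_rcons; apply: IH => k; exact: ((Cf k.+1).2 i).2.
Qed.

Lemma smooth_pd i f : smooth f -> smooth (pd i f).
Proof. by move=> sf a; rewrite -pderiv_rcons; exact: sf. Qed.

Lemma Ck_cst k (c : R) : Ck k (cst c).
Proof.
elim: k c => [|k IH] c; first exact: cst_continuous.
split=> [|i]; first exact: cst_continuous.
split=> [x|]; first exact: derivable_cst.
by rewrite (_ : pd i _ = cst 0)//; apply/funext => x; exact: derive_cst.
Qed.

Lemma CkD k f g : Ck k f -> Ck k g -> Ck k (fun x => f x + g x).
Proof.
elim: k f g => [|k IH] f g; first exact: continuous_add.
move=> [cf Hf] [cg Hg]; split=> [|i]; first exact: continuous_add.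
have [df Cf] := Hf i; have [dg Cg] := Hg i.
split=> [x|]; first exact: derivableD.
rewrite (_ : pd i _ = fun x => pd i f x + pd i g x); first exact: IH.
by apply/funext => x; exact: deriveD.
Qed.

Lemma CkM k f g : Ck k f -> Ck k g -> Ck k (fun x => f x * g x).
Proof.
elim: k f g => [|k IH] f g; first exact: continuous_mul.
move=> Cf1 Cg1; have Cf0 := CkS Cf1; have Cg0 := CkS Cg1.
move: Cf1 Cg1 => [cf Hf] [cg Hg]; split=> [|i]; first exact: continuous_mul.
have [df Cf] := Hf i; have [dg Cg] := Hg i.
split=> [x|]; first exact: derivableM.
rewrite (_ : pd i _ = fun x => f x * pd i g x + g x * pd i f x).
  by apply: CkD; exact: IH.
by apply/funext => x; exact: pdM.
Qed.

Lemma Ck_coord k j : Ck k (fun x => x ord0 j).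
Proof.
case: k => [|k]; first exact: coord_continuous.
split=> [|i]; first exact: coord_continuous.
split; first by move=> x; have [] := is_derive_coord j i x.
rewrite (_ : pd i _ = cst (j == i)%:R); first exact: Ck_cst.
by apply/funext => x; rewrite /pd; apply: derive_val; exact: is_derive_coord.
Qed.

(** The induction on [k] replaces [phi] by its derivative, hence a family [S] closed under
    differentiation: the exponential alone, the combinations of sine and cosine, or the functions
    [bump a b c P k]. *)
Lemma Ck_comp (S : set (R -> R)) :
  (forall phi, S phi -> (forall s, derivable phi s 1) /\ S (fun s => 'D_1 phi s)) ->
  forall k phi f, S phi -> Ck k f -> Ck k (fun x => phi (f x)).
Proof.
move=> HS; have cS phi : S phi -> continuous phi.
  by move=> /HS[dp _] s; apply: differentiable_continuous; exact/derivable1_diffP.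
elim=> [|k IH] phi f Sp Cf; first by apply: cont_comp => //; exact: cS.
have Cf0 := CkS Cf; case: Cf => [cf Hf]; have [dp Sp'] := HS _ Sp.
split=> [|i]; first by apply: cont_comp => //; exact: cS.
have [df Cf] := Hf i; split=> [x|]; first exact: (is_derive_comp (df x) (dp _)).1.
rewrite (_ : pd i _ = fun x => 'D_1 phi (f x) * pd i f x).
  by apply: CkM => //; exact: (IH (fun s => 'D_1 phi s)).
by apply/funext => x; exact: (is_derive_comp (df x) (dp _)).2.
Qed.

Lemma smoothD f g : smooth f -> smooth g -> smooth (fun x => f x + g x).
Proof. by move=> /smoothP sf /smoothP sg; apply/smoothP => k; exact: CkD. Qed.

Lemma smoothM f g : smooth f -> smooth g -> smooth (fun x => f x * g x).
Proof. by move=> /smoothP sf /smoothP sg; apply/smoothP => k; exact: CkM. Qed.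

Lemma smooth_cst (c : R) : smooth (cst c : 'rV[R]_n -> R).
Proof. by apply/smoothP => k; exact: Ck_cst. Qed.

Lemma smooth_coord j : smooth (fun x : 'rV[R]_n => x ord0 j).
Proof. by apply/smoothP => k; exact: Ck_coord. Qed.

Lemma smooth_prod (T : Type) (s : seq T) (F : T -> 'rV[R]_n -> R) :
  (forall k, smooth (F k)) -> smooth (fun x => \prod_(k <- s) F k x).
Proof.
move=> sF; elim: s => [|a s IH].
  by under [X in smooth X]funext do rewrite big_nil; exact: smooth_cst.
by under [X in smooth X]funext do rewrite big_cons; exact: smoothM.
Qed.

Lemma smooth_sum (T : Type) (s : seq T) (F : T -> 'rV[R]_n -> R) :
  (forall k, smooth (F k)) -> smooth (fun x => \sum_(k <- s) F k x).
Proof.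
move=> sF; elim: s => [|a s IH].
  by under [X in smooth X]funext do rewrite big_nil; exact: smooth_cst.
by under [X in smooth X]funext do rewrite big_cons; exact: smoothD.
Qed.

Lemma smooth_comp (S : set (R -> R)) phi f :
  (forall phi, S phi -> (forall s, derivable phi s 1) /\ S (fun s => 'D_1 phi s)) ->
  S phi -> smooth f -> smooth (fun x => phi (f x)).
Proof. by move=> HS Sp /smoothP sf; apply/smoothP => k; exact: (Ck_comp HS). Qed.

Lemma smooth_expR f : smooth f -> smooth (fun x => expR (f x)).
Proof.
apply: (smooth_comp (S := [set expR])) => // phi ->; split=> [s|]; first exact: derivable_expR.
by apply/funext => s; have [] := is_derive_expR s.
Qed.

Lemma smooth_trig (a b : R) f : smooth f -> smooth (fun x => a * sin (f x) + b * cos (f x)).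
Proof.
apply: (smooth_comp (S := [set phi | exists a b : R, phi = fun s => a * sin s + b * cos s])
  (phi := fun s => a * sin s + b * cos s)); last by exists a, b.
move=> _ [c [d ->]].
have D (s : R) : is_derive s (1 : R) (fun s => c * sin s + d * cos s) (c * cos s + d * - sin s).
  have D1 := is_deriveD (is_deriveZ c (is_derive_sin s)) (is_deriveZ d (is_derive_cos s)).
  exact: D1.
split=> [s|]; first by have [] := D s.
exists (- d), c; apply/funext => s; have [_ ->] := D s.
by rewrite mulrN mulNr addrC.
Qed.

End smooth_functions.

Section bump.
Context {R : realType}.
Variables (a b c : R).
Hypotheses (ab : a < b) (c0 : 0 < c).

Let rho (s : R) : R := (s - a) * (b - s).
Let rhop : {poly R} := ('X - a%:P) * (b%:P - 'X).
Let rho'p : {poly R} := (a + b)%:P - 2%:P * 'X.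

(** P(s) rho^-k exp(-c / rho) with rho = (s - a)(b - s), extended by 0. The polynomial and the power
    make the family closed under differentiation, which yields smoothness at once. The bump proper
    has P = 1 and k = 0; it tends to 1 inside the interval as c tends to 0. *)
Definition bump (P : {poly R}) (k : nat) (s : R) : R :=
  if 0 < (s - a) * (b - s) then
    P.[s] * (((s - a) * (b - s))^-1 ^+ k * expR (- (c * ((s - a) * (b - s))^-1)))
  else 0.

Lemma bump_support_itv (s : R) : (0 < (s - a) * (b - s)) = (s \in `]a, b[).
Proof.
rewrite in_itv/=; apply/idP/idP; last by move=> /andP[? ?]; rewrite mulr_gt0// subr_gt0.
have [sa|sa] := ltP a s => /=.
  by rewrite pmulr_rgt0 ?subr_gt0.
have sa0 : s - a <= 0 by rewrite subr_le0.
have bs0 : 0 <= b - s by rewrite subr_ge0 (le_trans sa (ltW ab)).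
by rewrite ltNge mulr_le0_ge0.
Qed.

(** A single term of the exponential series: exp(c y) >= (c y)^(k+1) / (k+1)!. *)
Let exp_bound k (y : R) : 0 < y ->
  y ^+ k.+1 * expR (- (c * y)) <= k.+1`!%:R / c ^+ k.+1.
Proof.
move=> y0; have cy0 : 0 <= c * y by rewrite mulr_ge0 ?ltW.
have := expR_ge1Dxn k cy0.
have F0 : 0 < (k.+1)`!%:R :> R by rewrite ltr0n fact_gt0.
have ck0 : 0 < c ^+ k.+1 by rewrite exprn_gt0.
rewrite exprMn expRN => H.
rewrite ler_pdivlMr// mulrAC ler_pdivrMr ?expR_gt0// mulrC [leRHS]mulrC.
rewrite -ler_pdivrMr//; apply: le_trans H; by rewrite lerDr.
Qed.

(** The numerator in (P rho^-k exp(-c / rho))' = (P' rho^2 - k P rho' rho + c P rho') rho^-(k+2)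
    exp(-c / rho). *)
Let bump' (P : {poly R}) (k : nat) : {poly R} :=
  P^`() * rhop ^+ 2 - k%:R%:P * P * rho'p * rhop + c%:P * P * rho'p.

Let bump'E P k s : (bump' P k).[s] =
  P^`().[s] * rho s ^+ 2 - k%:R * P.[s] * rho'p.[s] * rho s + c * P.[s] * rho'p.[s].
Proof. by rewrite /bump' /rhop /rho'p !hornerE /rho. Qed.

Let is_derive_rho s : is_derive s (1 : R) rho (rho'p.[s]).
Proof.
have D1 := is_deriveB (is_derive_id s (1 : R)) (is_derive_cst a s (1 : R)).
have D2 := is_deriveB (is_derive_cst b s (1 : R)) (is_derive_id s (1 : R)).
have D3 := is_deriveM D1 D2.
have -> : rho'p.[s] = (s - a) *: (0 - 1) + (b - s) *: (1 - 0) :> R^o.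
  by rewrite /rho'p !hornerE/= /GRing.scale/=; ring.
exact: D3.
Qed.

Let is_derive_bump_in P k s : 0 < rho s -> is_derive s (1 : R) (bump P k) (bump (bump' P k) k.+2 s).
Proof.
move=> rs.
pose f (s : R) : R := P.[s] * ((rho s)^-1 ^+ k * expR (- (c * (rho s)^-1))).
have nf : \forall z \near s, f z = bump P k z.
  have crho : continuous rho.
    by move=> z; apply: differentiable_continuous; apply/derivable1_diffP; have [] := is_derive_rho z.
  have : \forall z \near s, 0 < rho z by exact: (@cvgr_gt _ _ _ _ _ _ (crho s)).
  by apply: filterS => z; rewrite /bump /rho => ->.
apply: (near_eq_is_derive nf).
have r0 : rho s != 0 by rewrite gt_eqF.
have DP : is_derive s (1 : R) (horner P) (P^`()).[s].
  split; first exact: derivable_horner.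
  by rewrite derivE derive1E.
have DV : is_derive s (1 : R) (fun s => (rho s)^-1) (- (rho s) ^- 2 * rho'p.[s]).
  exact: (is_deriveV (f := rho) r0 (is_derive_rho s)).
have DX : is_derive s (1 : R) (fun s => (rho s)^-1 ^+ k)
    (k%:R * (rho s)^-1 ^+ k.-1 * (- (rho s) ^- 2 * rho'p.[s])).
  case: k f nf => [|k] f nf; first by rewrite !mul0r; exact: is_derive_cst.
  rewrite (_ : (fun s => (rho s)^-1 ^+ k.+1) = (fun s => (rho s)^-1) ^+ k.+1); last first.
    by apply/funext => z; rewrite exprfctE.
  exact: (is_deriveX k.+1 DV).
have DE : is_derive s (1 : R) (fun s => expR (- (c * (rho s)^-1)))
    (expR (- (c * (rho s)^-1)) * - (c * (- (rho s) ^- 2 * rho'p.[s]))).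
  have DN : is_derive s (1 : R) (fun s => - (c * (rho s)^-1)) (- (c * (- (rho s) ^- 2 * rho'p.[s]))).
    exact: (is_deriveN (is_deriveZ c DV)).
  exact: (is_derive1_comp (g := fun s => - (c * (rho s)^-1)) (is_derive_expR _) DN).
have := is_deriveM DP (is_deriveM DX DE).
set E := expR (- (c * (rho s)^-1)) => H.
have -> : bump (bump' P k) k.+2 s = P.[s] * ((rho s)^-1 ^+ k *
     (E * - (c * (- (rho s) ^- 2 * rho'p.[s]))) +
     E * (k%:R * (rho s)^-1 ^+ k.-1 * (- (rho s) ^- 2 * rho'p.[s]))) +
    ((rho s)^-1 ^+ k * E) * P^`().[s]; last exact: H.
rewrite /bump -/(rho s) rs bump'E -/E.
case: k {f nf DX H} => [|k] /=.
  by rewrite !expr0 !mul0r; field.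
rewrite !exprS; set X := _^-1 ^+ k; set r' := rho'p.[s]; set P' := (P^`()).[s]; set p := P.[s].
have -> : (1 + k)%:R = 1 + k%:R :> R by rewrite natrD.
by field.
Qed.

(** At an endpoint rho(h + s) = O(h), while exp(-c / rho) beats every power of 1 / rho. Two spare
    powers of rho give a quadratic bound in h, so the derivative at the endpoint is 0. *)
Let bump_bound P k s : rho s = 0 -> exists2 M : R, 0 <= M &
  forall h, `|h| <= 1 -> `|bump P k (h + s)| <= M * h ^+ 2.
Proof.
move=> rs0.
have [M1 [_ M1P]] : bounded_set (horner P @` `[s - 1, s + 1]).
  apply: compact_bounded; apply: continuous_compact; last exact: segment_compact.
  by apply: continuous_subspaceT; exact: continuous_horner.
pose F := k.+2`!%:R / c ^+ k.+2.
have F0 : 0 <= F by rewrite divr_ge0// exprn_ge0// ltW.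
(* For |h| <= 1 the factor of rho that does not vanish at the endpoint is at most [B], whence |rho(h
   + s)| <= B |h|. *)
pose B := b - a + 1; have B0 : 0 <= B by rewrite /B addr_ge0// subr_ge0 ltW.
exists ((`|M1| + 1) * (F * B ^+ 2)).
  by rewrite mulr_ge0 ?addr_ge0// mulr_ge0// sqr_ge0.
move=> h h1; rewrite /bump -/(rho (h + s)); case: ifPn => [rh|_]; last first.
  by rewrite normr0 mulr_ge0 ?sqr_ge0// mulr_ge0 ?addr_ge0// mulr_ge0// sqr_ge0.
rewrite normrM -(mulrA _ _ (h ^+ 2)); apply: ler_pM => //.
  apply: M1P; first by rewrite ltr_pwDr// ler_norm.
  by exists (h + s) => //; rewrite /= in_itv/=; move: h1; rewrite ler_norml; lra.
set r := rho (h + s); have y0 : 0 < r^-1 by rewrite invr_gt0.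
rewrite ger0_norm; last by rewrite mulr_ge0 ?expR_ge0// exprn_ge0// ltW.
have H := exp_bound k.+1 y0.
have r2 : r ^+ 2 <= (B * h) ^+ 2.
  have rB : `|r| <= `|B * h|.
    rewrite [leRHS]normrM (ger0_norm B0) /r /rho.
    have : s = a \/ s = b.
      by move/eqP: rs0; rewrite mulf_eq0 !subr_eq0 => /orP[/eqP ->|/eqP ->]; [left|right].
    case=> ->.
      have -> : h + a - a = h by ring.
      rewrite normrM mulrC ler_wpM2r//.
      have -> : b - (h + a) = (b - a) + (- h) by ring.
      apply: le_trans (ler_normD _ _) _; rewrite normrN ger0_norm ?subr_ge0 ?(ltW ab)//.
      by rewrite /B lerD2l.
    have -> : b - (h + b) = - h by ring.
    rewrite normrM normrN ler_wpM2r//.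
    have -> : h + b - a = (b - a) + h by ring.
    apply: le_trans (ler_normD _ _) _; rewrite ger0_norm ?subr_ge0 ?(ltW ab)//.
    by rewrite /B lerD2l.
  by rewrite -(real_normK (num_real r)) -(real_normK (num_real (B * h))) ler_sqr ?nnegrE.
apply: (@le_trans _ _ (F * r ^+ 2)).
  have -> : r^-1 ^+ k * expR (- (c * r^-1)) = r^-1 ^+ k.+2 * expR (- (c * r^-1)) * r ^+ 2.
    rewrite mulrAC; congr (_ * _); rewrite -addn2 exprD -mulrA -exprMn mulVf ?expr1n ?mulr1//.
    by rewrite gt_eqF.
  by rewrite ler_wpM2r ?sqr_ge0.
by rewrite -(mulrA F) -exprMn ler_wpM2l.
Qed.

(** Inside the interval by the product rule, outside by local constancy, at the endpoints by the
    quadratic bound. *)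
Lemma is_derive_bump P k s : is_derive s (1 : R) (bump P k) (bump (bump' P k) k.+2 s).
Proof.
have [rs|] := ltP 0 (rho s); first exact: is_derive_bump_in.
rewrite le_eqVlt => /predU1P[rs0|rs]; last first.
  have nf : \forall z \near s, cst 0 z = bump P k z.
    have crho : continuous rho.
      by move=> z; apply: differentiable_continuous; apply/derivable1_diffP; have [] := is_derive_rho z.
    have : \forall z \near s, rho z < 0 by exact: (@cvgr_lt _ _ _ _ _ _ (crho s)).
    by apply: filterS => z rz; rewrite /bump -/(rho z) ltNge (ltW rz).
  apply: (near_eq_is_derive nf).
  rewrite /bump -/(rho s) ltNge (ltW rs)/=; exact: is_derive_cst.
have [M M0 HM] := bump_bound P k rs0.
have b0 Q l : bump Q l s = 0 by rewrite /bump -/(rho s) rs0 ltxx.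
have H : h^-1 *: ((bump P k \o shift s) (h *: (1 : R)) - bump P k s) @[h --> 0^'] --> (0 : R).
  apply/cvgrPdist_le => e e0; near=> h.
  have h0 : h != 0 by near: h; exact: nbhs_dnbhs_neq.
  have h1 : `|h| <= 1 by near: h; apply: dnbhs0_le.
  have he : `|h| <= e / (M + 1) by near: h; apply: dnbhs0_le; rewrite divr_gt0// ltr_wpDl.
  rewrite /= [_%:A]mulr1 b0 subr0 sub0r normrN [_ *: _]/(_ * _) normrM normfV.
  rewrite -(ler_pM2l (_ : 0 < `|h|)) ?normr_gt0// mulVKf ?normr_eq0//.
  apply: le_trans (HM h h1) _.
  rewrite -(real_normK (num_real h)) expr2 mulrCA ler_wpM2l//.
  move: he; rewrite ler_pdivlMr ?ltr_wpDl// => he; apply: le_trans he.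
  by rewrite mulrC ler_wpM2l// lerDl.
rewrite b0; split; first by apply/cvg_ex; eexists; exact: H.
by rewrite /derive; apply/cvg_lim.
Unshelve. all: by end_near. Qed.

End bump.

Section bump_test.
Context {R : realType} {n : nat}.

Lemma bump01 (a b c s : R) : 0 < c -> 0 <= bump a b c 1 0 s <= 1.
Proof.
move=> c0; rewrite /bump; case: ifPn => [rs|_]; last by rewrite lexx ler01.
rewrite -[1 : {poly R}]/(1%:P) hornerC expr0 !mul1r expR_ge0/= -expR0 ler_expR oppr_le0.
by rewrite mulr_ge0 ?invr_ge0 ?ltW.
Qed.

Lemma smooth_bump (a b c : R) j : a < b -> 0 < c ->
  smooth (fun x : 'rV[R]_n => bump a b c 1 0 (x ord0 j)).
Proof.
move=> ab c0.
apply: (smooth_comp (S := [set phi | exists P k, phi = bump a b c P k])); last exact: smooth_coord.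
  move=> _ [P [k ->]]; split=> [s|]; first by have [] := is_derive_bump ab c0 P k s.
  do 2 eexists; apply/funext => s; have [_ ->] := is_derive_bump ab c0 P k s; reflexivity.
by exists 1, 0.
Qed.

Definition box_bump (a b : 'I_n -> R) (c : R) (x : 'rV[R]_n) : R :=
  \prod_j bump (a j) (b j) c 1 0 (x ord0 j).

Variables (a b : 'I_n -> R).
Hypothesis ab : forall j, a j < b j.

Lemma box_bump_out c x : ~ obox a b x -> box_bump a b c x = 0.
Proof.
move=> /existsNP[j /negP nx]; rewrite /box_bump (bigD1 j)//= {1}/bump.
by rewrite (bump_support_itv (ab j)) (negbTE nx) mul0r.
Qed.

Lemma compact_cbox : compact (cbox a b).
Proof. by apply: (rV_compact (A := fun j => ([set` `[a j, b j]] : set R))) => j; exact: segment_compact. Qed.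

Lemma box_bump_test (Omega : set 'rV[R]_n) c : 0 < c -> cbox a b `<=` Omega ->
  test_function Omega (box_bump a b c).
Proof.
move=> c0 abO; split.
  exact: (@smooth_prod _ _ _ _ (fun j x => bump (a j) (b j) c 1 0 (x ord0 j)) (fun j => smooth_bump j (ab j) c0)).
exists (cbox a b); split=> // [|x nx]; first exact: compact_cbox.
by apply: box_bump_out => /obox_cbox.
Qed.

Lemma box_bump_norm c x : 0 < c -> `|box_bump a b c x| <= 1.
Proof.
move=> c0; rewrite /box_bump normr_prod; apply: prodr_ile1 => j _.
by have /andP[? ?] := bump01 (a j) (b j) (x ord0 j) c0; rewrite normr_ge0 ger0_norm.
Qed.

Lemma box_bump_cvg x : obox a b x -> box_bump a b k.+1%:R^-1 x @[k --> \oo] --> (1 : R).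
Proof.
move=> xab.
have H : forall s : seq 'I_n,
    \prod_(j <- s) bump (a j) (b j) k.+1%:R^-1 1 0 (x ord0 j) @[k --> \oo] --> (1 : R).
  elim=> [|j s IH].
    rewrite (_ : (fun k => _) = cst (1 : R)); first exact: cvg_cst.
    by apply/funext => k; rewrite big_nil.
  rewrite (_ : (fun k => _) = fun k => bump (a j) (b j) k.+1%:R^-1 1 0 (x ord0 j) *
    \prod_(j <- s) bump (a j) (b j) k.+1%:R^-1 1 0 (x ord0 j)); last first.
    by apply/funext => k; rewrite big_cons.
  suff H1 : bump (a j) (b j) k.+1%:R^-1 1 0 (x ord0 j) @[k --> \oo] --> (1 : R).
    by have := cvgM H1 IH; rewrite mulr1; apply.
  have xj := xab j.
  rewrite (_ : (fun k => _) = fun k =>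
    expR (- (k.+1%:R^-1 * ((x ord0 j - a j) * (b j - x ord0 j))^-1))); last first.
    apply/funext => k; rewrite /bump (bump_support_itv (ab j)) xj.
    by rewrite -[1 : {poly R}]/(1%:P) hornerC expr0 !mul1r.
  have H0 : - (k.+1%:R^-1 * ((x ord0 j - a j) * (b j - x ord0 j))^-1) @[k --> \oo] --> (0 : R).
    rewrite -oppr0; apply: cvgN; rewrite -(mul0r ((x ord0 j - a j) * (b j - x ord0 j))^-1).
    by apply: cvgMl; exact: cvg_harmonic.
  by have := continuous_cvg _ (@continuous_expR R 0) H0; rewrite expR0; apply.
exact: H.
Qed.

End bump_test.

Section fundamental_lemma.
Context {R : realType} {n : nat}.
Variables (Omega : set 'rV[R]_n) (w : 'rV[R]_n -> R).
Local Notation leb := (lebesgue_rV n : {measure set 'rV[R]_n -> \bar R}).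
Hypotheses (hO : open Omega) (iw : leb.-integrable Omega (EFin \o w)).
Hypothesis w0 : forall phi, test_function Omega phi ->
  (\int[leb]_(x in Omega) (w x * phi x)%:E)%E = 0%E.
Local Open Scope ereal_scope.

Let mO : measurable Omega. Proof. exact: open_measurable_rV. Qed.

(** As c = 1 / (k+1) tends to 0, the bumps of the box tend to the indicator of the open box, with
    |w| as a dominating function. *)
Let integral_box a b : cbox a b `<=` Omega -> \int[leb]_(x in obox a b) (w x)%:E = 0.
Proof.
move=> abO; have [ab|] := pselect (forall j, (a j < b j)%R); last first.
  move=> /existsNP[j /negP]; rewrite -leNgt => ba.
  rewrite (_ : obox a b = set0) ?integral_set0//; apply/seteqP; split=> // x /(_ j).
  by rewrite in_itv/= => /andP[/lt_trans H /H]; rewrite ltNge ba.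
have bO : obox a b `<=` Omega by apply: subset_trans abO; exact: obox_cbox.
have mw : measurable_fun Omega w by apply/measurable_EFinP; exact: measurable_int iw.
pose f_ (k : nat) x : \bar R := (w x * box_bump a b k.+1%:R^-1 x)%:E.
pose f x : \bar R := (w x * \1_(obox a b) x)%:E.
have k0 k : (0 < k.+1%:R^-1 :> R)%R by rewrite invr_gt0.
have mf_ k : measurable_fun Omega (f_ k).
  apply/measurable_EFinP; apply: measurable_funM => //.
  apply: continuous_measurable_rV => //.
  have [sb _] := box_bump_test ab (k0 k) abO; exact: (sb [::]).1.
have mf : measurable_fun Omega f.
  apply/measurable_EFinP; apply: measurable_funM => //.
  by apply: measurable_indic; exact: measurable_obox.
have [||_ _] := dominated_convergence mO mf_ mf _ (integrable_abse iw).
- apply: aeW => x _; apply: cvg_EFin; first by near=> k.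
  rewrite /f /f_ /comp/=; apply: cvgMr => /=.
  have [xab|xab] := pselect (obox a b x).
    by rewrite indicE mem_set//; exact: box_bump_cvg.
  rewrite indicE memNset//.
  under eq_fun do rewrite box_bump_out//; exact: cvg_cst.
- apply: aeW => x k _; rewrite /= lee_fin normrM ler_piMr//.
  by apply: box_bump_norm => //.
rewrite (_ : (fun k => _) = cst 0); last first.
  by apply/funext => k; apply: w0; exact: box_bump_test.
move=> H; have := cvg_unique _ H (cvg_cst 0).
rewrite /f => <-//.
rewrite (integral_mkcond (obox a b)) (integral_mkcond Omega); congr (integral _ _ _); apply/funext => x.
rewrite /patch; case: ifPn => xab.
  by rewrite indicE xab mulr1 ifT// inE; apply: bO; rewrite inE in xab.
by rewrite indicE (negbTE xab) mulr0 if_same.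
Unshelve. all: by end_near. Qed.

(** The sets over whose intersection with the box [w] integrates to 0 form a Dynkin system
    containing all boxes, hence all Borel sets; an integrable function with this property vanishes
    almost everywhere. *)
Let ae_box a b : cbox a b `<=` Omega -> {ae leb, forall x, obox a b x -> w x = 0%R}.
Proof.
move=> abO; have bO : obox a b `<=` Omega by apply: subset_trans abO; exact: obox_cbox.
have mb : measurable (obox a b) by exact: measurable_obox.
have ib : leb.-integrable (obox a b) (EFin \o w) by exact: integrableS iw.
suff H A : measurable A -> \int[leb]_(x in A `&` obox a b) (w x)%:E = 0.
  have := @integral_ae_eq _ _ _ leb _ mb (cst 0) (EFin \o w) ib.
  move=> /(_ (measurable_cst _)) K.
  have {}K : ae_eq leb (obox a b) (EFin \o w) (cst 0).
    by apply: K => E Eb mE; rewrite integral0 -[in LHS](setIidl Eb) H.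
  by apply: filterS K => x /= Hx xb; have := Hx xb; case.
rewrite measurable_rVE; apply: (@dynkin_induction _ 'rV[R]_n _ (fun A => \int[leb]_(x in A `&` obox a b) (w x)%:E = 0)) => //.
- exact: measurable_rVE.
- by move=> _ _ [a1 [b1 ->]] [a2 [b2 ->]]; rewrite oboxI; do 2 eexists; reflexivity.
- by rewrite setTI; exact: integral_box.
- move=> _ [a1 [b1 ->]]; rewrite oboxI; apply: integral_box.
  apply: subset_trans abO => x Hx j; have := Hx j; rewrite !in_itv/= ge_max le_min.
  by move=> /andP[/andP[_ ->] /andP[_ ->]].
- move=> S mS H.
  have mSb : measurable (S `&` obox a b) by exact: measurableI.
  have mSC : measurable (~` S `&` obox a b) by apply: measurableI => //; exact: measurableC.
  have E : obox a b = (S `&` obox a b) `|` (~` S `&` obox a b) by rewrite -setIUl setUv setTI.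
  have := integral_box abO; rewrite [in LHS]E integral_setU_EFin//.
  + by rewrite H add0e.
  + by rewrite -E; apply/measurable_EFinP; exact: measurable_int ib.
  + by apply/disj_setPS => x [[Sx _] [nSx _]].
- move=> F mF tF H; rewrite setI_bigcupl integral_bigcup//.
  + by apply: eseries0 => k _ _; exact: H.
  + exact: trivIset_setIr.
  + by move=> k; exact: measurableI.
  + apply: integrableS ib => //; first by apply: bigcupT_measurable => k; exact: measurableI.
    by move=> x [k _ []].
Qed.

Lemma fundamental_lemma : {ae leb, forall x, Omega x -> w x = 0%R}.
Proof.
rewrite (open_bigcup_obox hO).
(* The rational boxes are enumerated by [unpickle], so that countably many exceptional null sets are
   collected. *)
pose F (k : nat) := if @unpickle ('rV[rat]_n * 'rV[rat]_n)%type k is Some q then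
  (fun x => cbox (fun i => ratr (q.1 ord0 i)) (fun i => ratr (q.2 ord0 i)) `<=` Omega ->
   obox (fun i => ratr (q.1 ord0 i)) (fun i => ratr (q.2 ord0 i)) x -> w x = 0%R)
  else (fun=> True).
have : {ae leb, forall x k, F k x}.
  apply: ae_foralln => k; rewrite /F; case: unpickle => [q|]; last exact: aeW.
  have [qO|qO] := pselect (cbox (fun i => ratr (q.1 ord0 i)) (fun i => ratr (q.2 ord0 i)) `<=` Omega); last exact: aeW.
  by apply: filterS (ae_box qO) => x Hx _.
apply: filterS => x Hx [q /= qO xq].
by have := Hx (pickle q); rewrite /F pickleK; apply.
Qed.

End fundamental_lemma.

(** * Square-integrable functions *)

Section square_integrable.
Context {d} {T : measurableType d} {R : realType}.
Variables (mu : {measure set T -> \bar R}) (A : set T).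
Hypothesis mA : measurable A.
Implicit Types (f g c : T -> R) (K : R) (F G : nat -> T -> R).

Definition L1 f : Prop := mu.-integrable A (EFin \o f).

Definition L2 f : Prop := measurable_fun A f /\ L1 (fun x => f x ^+ 2).

Definition ip f g : R := \int[mu]_(x in A) (f x * g x).

Definition L2cvg F f : Prop :=
  [/\ forall k, L2 (F k), L2 f &
      ip (fun x => F k x - f x) (fun x => F k x - f x) @[k --> \oo] --> (0 : R)].

Lemma L1_measurable f : L1 f -> measurable_fun A f.
Proof. by move=> /measurable_int/measurable_EFinP. Qed.

Lemma le_L1 f g : measurable_fun A f -> (forall x, A x -> `|f x| <= g x) -> L1 g -> L1 f.
Proof.
move=> mf fg; apply: le_integrable => //; first exact/measurable_EFinP.
by move=> x Ax; rewrite /= lee_fin (le_trans (fg _ Ax))// ler_norm.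
Qed.

Lemma L1D f g : L1 f -> L1 g -> L1 (fun x => f x + g x).
Proof. by move=> i1 i2; have := integrableD mA i1 i2; apply: eq_integrable. Qed.

Lemma L1Z (c : R) f : L1 f -> L1 (fun x => c * f x).
Proof. by move=> i1; have := integrableZl mA c i1; apply: eq_integrable. Qed.

Lemma L1N f : L1 f -> L1 (fun x => - f x).
Proof. by move=> /(L1Z (-1)); apply: eq_integrable => // x _; rewrite /= mulN1r. Qed.

Lemma L1B f g : L1 f -> L1 g -> L1 (fun x => f x - g x).
Proof. by move=> i1 /L1N; exact: L1D. Qed.

Lemma L1_sum I (s : seq I) (P : pred I) (F : I -> T -> R) : (forall i, L1 (F i)) ->
  L1 (fun x => \sum_(i <- s | P i) F i x).
Proof.
move=> iF; elim: s => [|a s IH].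
  have := integrable0 mu A; apply: eq_integrable => // x _ /=; by rewrite big_nil.
have [Pa|Pa] := boolP (P a).
  have := L1D (iF a) IH; apply: eq_integrable => // x _ /=; by rewrite big_cons Pa.
by move: IH; apply: eq_integrable => // x _ /=; rewrite big_cons (negbTE Pa).
Qed.

Lemma Rint_sum I (s : seq I) (P : pred I) (F : I -> T -> R) : (forall i, L1 (F i)) ->
  \int[mu]_(x in A) (\sum_(i <- s | P i) F i x) = \sum_(i <- s | P i) \int[mu]_(x in A) F i x.
Proof.
move=> iF; elim: s => [|a s IH].
  rewrite big_nil (_ : Rintegral _ _ _ = \int[mu]_(x in A) (0 : R)).
    by rewrite Rintegral_cst// mul0r.
  by apply: eq_Rintegral => x _; rewrite big_nil.
rewrite big_cons -IH; case: ifP => Pa.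
  rewrite -RintegralD//; [|exact: iF|exact: L1_sum].
  by apply: eq_Rintegral => x _; rewrite big_cons Pa.
by apply: eq_Rintegral => x _; rewrite big_cons Pa.
Qed.

Lemma L2M f g : L2 f -> L2 g -> L1 (fun x => f x * g x).
Proof.
move=> [mf f2] [mg g2]; apply: le_L1 (L1D f2 g2); first exact: measurable_funM.
move=> x _; rewrite ler_norml; apply/andP; split; nra.
Qed.

Lemma L2D f g : L2 f -> L2 g -> L2 (fun x => f x + g x).
Proof.
move=> [mf f2] [mg g2]; split; first exact: measurable_funD.
apply: le_L1 (L1D (L1Z 2 f2) (L1Z 2 g2)).
  by apply: measurable_funX; exact: measurable_funD.
move=> x _; rewrite ger0_norm ?sqr_ge0//; have := sqr_ge0 (f x - g x); nra.
Qed.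

Lemma L2Mb c K f : measurable_fun A c -> (forall x, A x -> `|c x| <= K) -> L2 f ->
  L2 (fun x => c x * f x).
Proof.
move=> mc cK [mf f2]; split; first exact: measurable_funM.
apply: le_L1 (L1Z (K ^+ 2) f2); first by apply: measurable_funX; exact: measurable_funM.
move=> x Ax; rewrite ger0_norm ?sqr_ge0// exprMn ler_wpM2r ?sqr_ge0//.
by rewrite -(real_normK (num_real (c x))) lerXn2r ?nnegrE ?cK// (le_trans _ (cK x Ax)).
Qed.

Lemma L2Z (c : R) f : L2 f -> L2 (fun x => c * f x).
Proof. by apply: (@L2Mb (cst c) `|c|) => //; exact: measurable_cst. Qed.

Lemma L2N f : L2 f -> L2 (fun x => - f x).
Proof.
by move=> /(L2Z (-1)); rewrite (_ : (fun x => _) = fun x => - f x)//; apply/funext => x; rewrite mulN1r.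
Qed.

Lemma L2B f g : L2 f -> L2 g -> L2 (fun x => f x - g x).
Proof. by move=> i1 /L2N; exact: L2D. Qed.

Lemma L1_bounded f K : (mu A < +oo)%E -> measurable_fun A f -> (forall x, A x -> `|f x| <= K) -> L1 f.
Proof.
move=> muA mf fK; apply: (@le_L1 _ (cst K)) => //.
rewrite /L1; apply/integrableP; split; first by apply/measurable_EFinP; exact: measurable_cst.
have := integral_cst mu mA (`|K|%:E); rewrite /cst/= => ->; exact: lte_mul_pinfty.
Qed.

Lemma L2_bounded f K : (mu A < +oo)%E -> measurable_fun A f -> (forall x, A x -> `|f x| <= K) -> L2 f.
Proof.
move=> muA mf fK; split=> //; apply: (@L1_bounded _ (K ^+ 2)) => //; first exact: measurable_funX.
by move=> x Ax; rewrite normrX lerXn2r ?nnegrE ?fK// (le_trans _ (fK x Ax)).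
Qed.

Lemma L2_L1 f : (mu A < +oo)%E -> L2 f -> L1 f.
Proof.
move=> muA Lf; have /(L2M Lf) : L2 (cst 1) by apply: (@L2_bounded _ 1) => // x _; rewrite normr1.
by apply: eq_integrable => // x _; rewrite /= mulr1.
Qed.

Lemma ipC f g : ip f g = ip g f.
Proof. by apply: eq_Rintegral => x _; rewrite mulrC. Qed.

Lemma ip_ge0 f : 0 <= ip f f.
Proof. by apply: Rintegral_ge0 => x _; rewrite -expr2 sqr_ge0. Qed.

Lemma ipDl f g h : L2 f -> L2 g -> L2 h -> ip (fun x => f x + g x) h = ip f h + ip g h.
Proof.
move=> Lf Lg Lh; rewrite /ip -RintegralD//; [|exact: L2M..].
by apply: eq_Rintegral => x _; rewrite mulrDl.
Qed.

Lemma ipZl (c : R) f g : L2 f -> L2 g -> ip (fun x => c * f x) g = c * ip f g.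
Proof.
move=> Lf Lg; rewrite /ip -RintegralZl//; last exact: L2M.
by apply: eq_Rintegral => x _; rewrite mulrA.
Qed.

Lemma cauchy_schwarz f g : L2 f -> L2 g -> ip f g ^+ 2 <= ip f f * ip g g.
Proof.
move=> Lf Lg.
have H (t : R) : 0 <= ip f f + 2 * t * ip f g + t ^+ 2 * ip g g.
  have Ltg := L2Z t Lg; have Lftg := L2D Lf Ltg.
  have := ip_ge0 (fun x => f x + t * g x).
  rewrite ipDl// ipZl// !(ipC _ (fun x => f x + t * g x)) !ipDl// !ipZl// (ipC g f).
  by have -> : ip f f + t * ip f g + t * (ip f g + t * ip g g) = ip f f + 2 * t * ip f g + t ^+ 2 * ip g g by ring.
have := ip_ge0 f; have := ip_ge0 g.
move: H; set a := ip f f; set b := ip f g; set c := ip g g => H c0 a0.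
move: c0; rewrite le_eqVlt => /predU1P[c0|c0].
  rewrite -c0 mulr0; have [->|b0] := eqVneq b 0; first by rewrite expr0n.
  (* In the degenerate case where [ip g g] is 0, this value of [t] makes the quadratic equal to
     -1. *)
  have := H (- (a + 1) / (2 * b)); rewrite -c0 mulr0 addr0.
  have -> : 2 * (- (a + 1) / (2 * b)) * b = - (a + 1) by field.
  lra.
have := H (- b / c).
have -> : a + 2 * (- b / c) * b + (- b / c) ^+ 2 * c = (a * c - b ^+ 2) / c by field; rewrite gt_eqF.
by rewrite pmulr_lge0 ?invr_gt0// subr_ge0.
Qed.

Lemma cauchy_schwarz_norm f g : L2 f -> L2 g -> `|ip f g| <= Num.sqrt (ip f f) * Num.sqrt (ip g g).
Proof.
move=> Lf Lg; rewrite -sqrtrM ?ip_ge0// -sqrtr_sqr ler_sqrt ?mulr_ge0 ?ip_ge0//.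
exact: cauchy_schwarz.
Qed.

(** Expansion around the two limits leaves three terms with a factor tending to 0, each controlled
    by the Cauchy-Schwarz inequality. *)
Lemma ip_cvg F f G g : L2cvg F f -> L2cvg G g -> ip (F k) (G k) @[k --> \oo] --> ip f g.
Proof.
move=> [LF Lf cF] [LG Lg cG].
pose F' k x := F k x - f x; pose G' k x := G k x - g x.
have LF' k : L2 (F' k) by exact: L2B.
have LG' k : L2 (G' k) by exact: L2B.
have sF : Num.sqrt (ip (F' k) (F' k)) @[k --> \oo] --> (0 : R).
  by rewrite -sqrtr0; apply: (continuous_cvg _ (@sqrt_continuous R 0)).
have sG : Num.sqrt (ip (G' k) (G' k)) @[k --> \oo] --> (0 : R).
  by rewrite -sqrtr0; apply: (continuous_cvg _ (@sqrt_continuous R 0)).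
have E k : ip (F k) (G k) = ip (F' k) (G' k) + ip (F' k) g + (ip (G' k) f + ip f g).
  have E1 h : L2 h -> ip (G' k) h + ip g h = ip (G k) h.
    move=> Lh; rewrite -ipDl// (_ : (fun x => G' k x + g x) = G k)//.
    by apply/funext => x; rewrite /G' subrK.
  rewrite 2!(ipC (F' k)) E1// (ipC f) E1// (ipC _ (F' k)) (ipC _ f) -ipDl//.
  by congr ip; apply/funext => x; rewrite /F' subrK.
rewrite (_ : (fun k => ip (F k) (G k)) = fun k => ip (F' k) (G' k) + ip (F' k) g + (ip (G' k) f + ip f g)); last by apply/funext.
have S (f' g' : nat -> T -> R) : (forall k, L2 (f' k)) -> (forall k, L2 (g' k)) ->
    (Num.sqrt (ip (f' k) (f' k)) * Num.sqrt (ip (g' k) (g' k))) @[k --> \oo] --> (0 : R) ->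
    ip (f' k) (g' k) @[k --> \oo] --> (0 : R).
  move=> L1' L2' H; apply/norm_cvg0P; apply: (squeeze_cvgr _ (cvg_cst 0) H).
  by near=> k; rewrite normr_ge0 cauchy_schwarz_norm.
rewrite -[X in _ --> X]add0r -[X in X + _]addr0; apply: cvgD; first apply: cvgD.
- by apply: S => //; rewrite -(mulr0 0); apply: cvgM.
- apply: (S F' (fun=> g)) => //; rewrite -(mul0r (Num.sqrt (ip g g))).
  by apply: cvgMl.
- rewrite -[X in _ --> X]add0r; apply: cvgD; last exact: cvg_cst.
  apply: (S G' (fun=> f)) => //; rewrite -(mul0r (Num.sqrt (ip f f))).
  by apply: cvgMl.
Unshelve. all: by end_near. Qed.

Lemma L2cvgMb c K F f : measurable_fun A c -> (forall x, A x -> `|c x| <= K) -> L2cvg F f ->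
  L2cvg (fun k x => c x * F k x) (fun x => c x * f x).
Proof.
move=> mc cK [LF Lf cF]; split=> [k||]; [exact: L2Mb mc cK (LF k)|exact: L2Mb mc cK Lf|].
have K2 : ip (fun x => F k x - f x) (fun x => F k x - f x) * K ^+ 2 @[k --> \oo] --> (0 : R).
  by rewrite -(mul0r (K ^+ 2)); apply: cvgMl.
apply: (squeeze_cvgr _ (cvg_cst 0) K2); near=> k.
have LB := L2B (LF k) Lf; have LcB := L2Mb mc cK LB.
rewrite ip_ge0/= mulrC /ip -RintegralZl//; last exact: L2M.
apply: le_Rintegral => //.
- have := L2M LcB LcB; apply: eq_integrable => // x _; by rewrite /= -mulrBr.
- by apply: L1Z; exact: L2M.
move=> x Ax; rewrite -mulrBr -!expr2 exprMn ler_wpM2r ?sqr_ge0//.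
by rewrite -(real_normK (num_real (c x))) lerXn2r ?nnegrE ?cK// (le_trans _ (cK x Ax)).
Unshelve. all: by end_near. Qed.

(** Meant for truncations [G] of [F], where the pointwise comparison is a Lipschitz bound or follows
    from an upper bound on the limit. *)
Lemma L2cvg_le F f G g : (forall k, L2 (G k)) -> L2 g ->
  (forall k, {ae mu, forall x, A x -> `|G k x - g x| <= `|F k x - f x|}) ->
  L2cvg F f -> L2cvg G g.
Proof.
move=> LG Lg GF [LF Lf cF]; split=> //.
apply: (squeeze_cvgr _ (cvg_cst 0) cF); near=> k; rewrite ip_ge0/=.
have LB := L2B (LF k) Lf; have LB' := L2B (LG k) Lg.
rewrite /ip /Rintegral fine_le//.
- by apply: integrable_fin_num => //; exact: L2M.
- by apply: integrable_fin_num => //; exact: L2M.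
apply: ae_ge0_le_integral => //.
- by move=> x _; rewrite lee_fin -expr2 sqr_ge0.
- by apply: measurable_int; exact: (L2M LB' LB').
- by move=> x _; rewrite lee_fin -expr2 sqr_ge0.
- by apply: measurable_int; exact: (L2M LB LB).
apply: filterS (GF k) => x H Ax; rewrite lee_fin -!expr2.
rewrite -(real_normK (num_real (F k x - _))) -(real_normK (num_real (G k x - _))).
by rewrite lerXn2r ?nnegrE ?H.
Unshelve. all: by end_near. Qed.

End square_integrable.

Section complex_abs.
Context {R : realType}.
Implicit Types z w : R[i].
Local Open Scope complex_scope.
Local Notation Re := complex.Re.
Local Notation Im := complex.Im.

Lemma ReD z w : Re (z + w) = Re z + Re w. Proof. by case: z w => ? ? []. Qed.
Lemma ImD z w : Im (z + w) = Im z + Im w. Proof. by case: z w => ? ? []. Qed.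
Lemma ReN z : Re (- z) = - Re z. Proof. by case: z. Qed.
Lemma ImN z : Im (- z) = - Im z. Proof. by case: z. Qed.
Lemma ReM z w : Re (z * w) = Re z * Re w - Im z * Im w. Proof. by case: z w => ? ? []. Qed.
Lemma ImM z w : Im (z * w) = Re z * Im w + Im z * Re w. Proof. by case: z w => ? ? []. Qed.
Lemma Re_conj z : Re z^* = Re z. Proof. by case: z. Qed.
Lemma Im_conj z : Im z^* = - Im z. Proof. by case: z. Qed.

Definition ReImE := (ReD, ImD, ReN, ImN, ReM, ImM, Re_conj, Im_conj).

Lemma complexP z w : Re z = Re w -> Im z = Im w -> z = w.
Proof. by case: z w => ? ? [? ?] /= -> ->. Qed.

Lemma Re_sum I (s : seq I) (P : pred I) (F : I -> R[i]) :
  Re (\sum_(i <- s | P i) F i) = \sum_(i <- s | P i) Re (F i).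
Proof. by elim: s => [|a s IH]; rewrite ?big_nil// !big_cons; case: ifP => _; rewrite ?ReD IH. Qed.

Lemma Im_sum I (s : seq I) (P : pred I) (F : I -> R[i]) :
  Im (\sum_(i <- s | P i) F i) = \sum_(i <- s | P i) Im (F i).
Proof. by elim: s => [|a s IH]; rewrite ?big_nil// !big_cons; case: ifP => _; rewrite ?ImD IH. Qed.

Lemma cabs_ge0 z : 0 <= cabs z.
Proof. by case: z => a b; exact: sqrtr_ge0. Qed.

Lemma cabs_sqr z : cabs z ^+ 2 = Re z ^+ 2 + Im z ^+ 2.
Proof. by case: z => a b; rewrite /cabs /= sqr_sqrtr// addr_ge0 ?sqr_ge0. Qed.

Lemma cabsM z w : cabs (z * w) = cabs z * cabs w.
Proof. exact: ComplexField.Normc.normcM. Qed.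

Lemma cabsD z w : cabs (z + w) <= cabs z + cabs w.
Proof. exact: le_normcD. Qed.

Lemma cabsN z : cabs (- z) = cabs z.
Proof. exact: normcN. Qed.

Lemma cabsB z w : cabs (z - w) <= cabs z + cabs w.
Proof. by rewrite -(cabsN w) cabsD. Qed.

Lemma cabs_real (a : R) : cabs a%:C = `|a|.
Proof. by rewrite /cabs /= expr0n/= addr0 sqrtr_sqr. Qed.

Lemma cabs0 : cabs (0 : R[i]) = 0.
Proof. by rewrite (cabs_real 0) normr0. Qed.

Lemma cabs_conj z : cabs z^* = cabs z.
Proof. by case: z => a b; rewrite /cabs /= sqrrN. Qed.

Lemma le_Re_cabs z : `|Re z| <= cabs z.
Proof.
rewrite -(ler_pXn2r (_ : 0 < 2)%N) ?nnegrE ?cabs_ge0//.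
by rewrite cabs_sqr real_normK ?num_real// lerDl sqr_ge0.
Qed.

Lemma le_Im_cabs z : `|Im z| <= cabs z.
Proof.
rewrite -(ler_pXn2r (_ : 0 < 2)%N) ?nnegrE ?cabs_ge0//.
by rewrite cabs_sqr real_normK ?num_real// lerDr sqr_ge0.
Qed.

Lemma cabs_le z : cabs z <= `|Re z| + `|Im z|.
Proof.
rewrite -(ler_pXn2r (_ : 0 < 2)%N) ?nnegrE ?cabs_ge0 ?addr_ge0//.
rewrite cabs_sqr -(real_normK (num_real (Re z))) -(real_normK (num_real (Im z))) sqrrD.
by rewrite lerD2r lerDl mulrn_wge0// mulr_ge0.
Qed.

Lemma cabs_cexp z : cabs (cexp z) = expR (Re z).
Proof.
rewrite /cexp cabsM cabs_real ger0_norm ?expR_ge0//.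
by rewrite {1}/cabs/= addrC sin2cos2 subrK sqrtr1 mulr1.
Qed.

End complex_abs.

Section complex_Lp.
Context {d} {T : measurableType d} {R : realType}.
Variables (mu : {measure set T -> \bar R}) (A : set T).
Hypothesis mA : measurable A.
Implicit Types (f g : T -> R[i]).
Local Notation Re := complex.Re.
Local Notation Im := complex.Im.
Local Notation ReF f := (fun x => Re (f x)).
Local Notation ImF f := (fun x => Im (f x)).

Lemma cmeasurable_cabs f : cmeasurable A f -> measurable_fun A (fun x => cabs (f x)).
Proof.
move=> [mR mI].
rewrite (_ : (fun x => _) = Num.sqrt \o (fun x => Re (f x) ^+ 2 + Im (f x) ^+ 2)).
  apply: measurableT_comp; first exact: (continuous_measurable_fun (@sqrt_continuous R)).
  by apply: measurable_funD; exact: measurable_funX.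
by apply/funext => x; rewrite /= -cabs_sqr sqrtr_sqr ger0_norm ?cabs_ge0.
Qed.

Lemma enormL2_sqr f :
  (enormL mu A 2%:E f `^ 2 = \int[mu]_(x in A) (cabs (f x) ^+ 2)%:E)%E.
Proof.
rewrite /enormL powR_Lnorm// [RHS]integral_mkcond; apply: eq_integral => x _.
rewrite /patch; case: ifP => _; last by rewrite abse0 poweR_EFin powR0.
by rewrite abse_EFin poweR_EFin powR_mulrn// (ger0_norm (cabs_ge0 _)).
Qed.

Lemma L1_cabs2 f : L2 mu A (ReF f) -> L2 mu A (ImF f) -> L1 mu A (fun x => cabs (f x) ^+ 2).
Proof.
move=> [_ H1] [_ H2]; have := L1D mA H1 H2; apply: eq_integrable => // x _.
by rewrite /= cabs_sqr.
Qed.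

(** Reduces complex square integrability to real and imaginary parts, for which the real inner
    product [ip] is available. *)
Lemma memL2P f : memL mu A 2%:E f <-> L2 mu A (ReF f) /\ L2 mu A (ImF f).
Proof.
split=> [[cf fy]|[L1' L2']].
  have iN : L1 mu A (fun x => cabs (f x) ^+ 2).
    apply/integrableP; split.
      by apply/measurable_EFinP; apply: measurable_funX; exact: cmeasurable_cabs.
    rewrite (_ : (\int[_]_(_ in _) _)%E = (enormL mu A 2%:E f `^ 2)%E) ?poweR_lty//.
    rewrite enormL2_sqr; apply: eq_integral => x _.
    by rewrite /= ger0_norm ?sqr_ge0.
  split; (split; [by case: cf|]).
    apply: le_L1 iN => //; first by case: cf => ? _; exact: measurable_funX.
    by move=> x _; rewrite ger0_norm ?sqr_ge0// cabs_sqr lerDl sqr_ge0.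
  apply: le_L1 iN => //; first by case: cf => _ ?; exact: measurable_funX.
  by move=> x _; rewrite ger0_norm ?sqr_ge0// cabs_sqr lerDr sqr_ge0.
split; first by split; [case: L1'|case: L2'].
apply: (@lty_poweRy _ _ 2) => //; rewrite enormL2_sqr.
have := L1_cabs2 L1' L2'; move/integrableP => [_].
rewrite (eq_integral (fun x => (cabs (f x) ^+ 2)%:E))// => x _.
by rewrite /= ger0_norm ?sqr_ge0.
Qed.

Lemma normL2_sqr f : memL mu A 2%:E f ->
  normL mu A 2%:E f ^+ 2 = ip mu A (ReF f) (ReF f) + ip mu A (ImF f) (ImF f).
Proof.
move=> /memL2P[L1' L2'].
have N0 : 0 <= normL mu A 2%:E f by rewrite fine_ge0// Lnorm_ge0.
rewrite -powR_mulrn// /normL -fine_poweR enormL2_sqr /ip -RintegralD//; [|exact: L2M..].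
by apply: eq_Rintegral => x _; rewrite cabs_sqr !expr2.
Qed.

Lemma normL_ge0 p f : 0 <= normL mu A p f.
Proof. by rewrite fine_ge0// Lnorm_ge0. Qed.

Lemma normL2_sqr_cabs f : memL mu A 2%:E f ->
  normL mu A 2%:E f ^+ 2 = \int[mu]_(x in A) (cabs (f x) ^+ 2).
Proof.
move=> /[dup] /normL2_sqr -> /memL2P[L1' L2']; rewrite /ip -RintegralD//; [|exact: L2M..].
by apply: eq_Rintegral => x _; rewrite cabs_sqr !expr2.
Qed.

Lemma normL2_le f g : memL mu A 2%:E f -> memL mu A 2%:E g ->
  {ae mu, forall x, A x -> cabs (f x) <= cabs (g x)} -> normL mu A 2%:E f <= normL mu A 2%:E g.
Proof.
move=> Lf Lg H.
rewrite -(ler_pXn2r (_ : 0 < 2)%N) ?nnegrE ?normL_ge0// !normL2_sqr_cabs//.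
have [f1 f2] := (memL2P f).1 Lf; have [g1 g2] := (memL2P g).1 Lg.
have if2 := L1_cabs2 f1 f2; have ig2 := L1_cabs2 g1 g2.
rewrite /Rintegral fine_le//; try exact: integrable_fin_num.
apply: ae_ge0_le_integral => //.
- by move=> x _; rewrite lee_fin sqr_ge0.
- exact: measurable_int if2.
- by move=> x _; rewrite lee_fin sqr_ge0.
- exact: measurable_int ig2.
by apply: filterS H => x H Ax; rewrite lee_fin lerXn2r ?nnegrE ?cabs_ge0 ?H.
Qed.

Lemma memL2_cbM (E : T -> R[i]) (K : R) f : cmeasurable A E -> (forall x, A x -> cabs (E x) <= K) ->
  memL mu A 2%:E f -> memL mu A 2%:E (fun x => E x * f x).
Proof.
move=> [mR mI] EK /memL2P[f1 f2].
have RK x : A x -> `|Re (E x)| <= K by move=> Ax; apply: le_trans (le_Re_cabs _) (EK x Ax).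
have IK x : A x -> `|Im (E x)| <= K by move=> Ax; apply: le_trans (le_Im_cabs _) (EK x Ax).
apply/memL2P; split.
  under [X in L2 _ _ X]funext do rewrite ReM.
  by apply: L2B => //; [exact: L2Mb mR RK f1|exact: L2Mb mI IK f2].
under [X in L2 _ _ X]funext do rewrite ImM.
by apply: L2D => //; [exact: L2Mb mR RK f2|exact: L2Mb mI IK f1].
Qed.

Lemma memL2_cM (c : R[i]) f : memL mu A 2%:E f -> memL mu A 2%:E (fun x => c * f x).
Proof. by apply: (@memL2_cbM (cst c) (cabs c)) => //; split; exact: measurable_cst. Qed.

Lemma memL2D f g : memL mu A 2%:E f -> memL mu A 2%:E g -> memL mu A 2%:E (fun x => f x + g x).
Proof.
move=> /memL2P[f1 f2] /memL2P[g1 g2]; apply/memL2P; split.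
  by under [X in L2 _ _ X]funext do rewrite ReD; exact: L2D.
by under [X in L2 _ _ X]funext do rewrite ImD; exact: L2D.
Qed.

Lemma normL2_cbM (E : T -> R[i]) (K : R) f : 0 <= K -> cmeasurable A E ->
  (forall x, A x -> cabs (E x) <= K) -> memL mu A 2%:E f ->
  normL mu A 2%:E (fun x => E x * f x) <= K * normL mu A 2%:E f.
Proof.
move=> K0 mE EK Lf; have LE := memL2_cbM mE EK Lf.
rewrite -(ler_pXn2r (_ : 0 < 2)%N) ?nnegrE ?mulr_ge0 ?normL_ge0//.
rewrite exprMn !normL2_sqr_cabs//.
have [f1 f2] := (memL2P f).1 Lf; have [g1 g2] := (memL2P _).1 LE.
have if2 := L1_cabs2 f1 f2; have ig2 := L1_cabs2 g1 g2.
rewrite -RintegralZl//; apply: le_Rintegral => //; first exact: (L1Z mA).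
move=> x Ax; rewrite cabsM exprMn ler_wpM2r ?sqr_ge0//.
by rewrite lerXn2r ?nnegrE ?cabs_ge0 ?EK.
Qed.

Lemma normL2_cM (c : R[i]) f : memL mu A 2%:E f ->
  normL mu A 2%:E (fun x => c * f x) <= cabs c * normL mu A 2%:E f.
Proof.
by apply: (@normL2_cbM (cst c)) => //; exact: cabs_ge0.
Qed.

(** From |a + b|^2 <= 2 |a|^2 + 2 |b|^2. The factor 2 only enlarges constants, which never affect an
    exponential rate. *)
Lemma normL2D f g : memL mu A 2%:E f -> memL mu A 2%:E g ->
  normL mu A 2%:E (fun x => f x + g x) <= 2 * (normL mu A 2%:E f + normL mu A 2%:E g).
Proof.
move=> Lf Lg; have LD := memL2D Lf Lg.
have a0 := normL_ge0 2%:E f; have b0 := normL_ge0 2%:E g.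
rewrite -(ler_pXn2r (_ : 0 < 2)%N) ?nnegrE ?normL_ge0 ?mulr_ge0 ?addr_ge0//.
apply: (@le_trans _ _ (2 * (normL mu A 2%:E f ^+ 2 + normL mu A 2%:E g ^+ 2))); last by nra.
rewrite !normL2_sqr_cabs//.
have [f1 f2] := (memL2P f).1 Lf; have [g1 g2] := (memL2P g).1 Lg; have [h1 h2] := (memL2P _).1 LD.
have if2 := L1_cabs2 f1 f2; have ig2 := L1_cabs2 g1 g2; have ih2 := L1_cabs2 h1 h2.
rewrite -RintegralD// -RintegralZl//; last exact: (L1D mA).
apply: le_Rintegral => //; first by apply: (L1Z mA); exact: (L1D mA).
move=> x Ax; have H := cabsD (f x) (g x).
apply: (@le_trans _ _ ((cabs (f x) + cabs (g x)) ^+ 2)).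
  by rewrite lerXn2r ?nnegrE ?addr_ge0 ?cabs_ge0.
by have := sqr_ge0 (cabs (f x) - cabs (g x)); nra.
Qed.

Lemma normL2_cvg f (F : nat -> T -> R[i]) : (forall k, memL mu A 2%:E (F k)) -> memL mu A 2%:E f ->
  normL mu A 2%:E (fun x => F k x - f x) @[k --> \oo] --> (0 : R) ->
  L2cvg mu A (fun k => ReF (F k)) (ReF f) /\ L2cvg mu A (fun k => ImF (F k)) (ImF f).
Proof.
move=> LF Lf H.
have LB k : memL mu A 2%:E (fun x => F k x - f x).
  apply/memL2P; have [LFR LFI] := (memL2P _).1 (LF k); have [LfR LfI] := (memL2P _).1 Lf.
  split; [have := L2B mA LFR LfR|have := L2B mA LFI LfI].
    by congr L2; apply/funext => x; rewrite ReD ReN.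
  by congr L2; apply/funext => x; rewrite ImD ImN.
have H2 : normL mu A 2%:E (fun x => F k x - f x) ^+ 2 @[k --> \oo] --> (0 : R).
  by have := continuous_cvg _ (@exprn_continuous R 2 0) H; rewrite expr0n; apply.
have E1 k : ip mu A (fun x => Re (F k x) - Re (f x)) (fun x => Re (F k x) - Re (f x)) =
    ip mu A (ReF (fun x => F k x - f x)) (ReF (fun x => F k x - f x)).
  by apply: eq_Rintegral => x _; rewrite ReD ReN.
have E2 k : ip mu A (fun x => Im (F k x) - Im (f x)) (fun x => Im (F k x) - Im (f x)) =
    ip mu A (ImF (fun x => F k x - f x)) (ImF (fun x => F k x - f x)).
  by apply: eq_Rintegral => x _; rewrite ImD ImN.
have [LfR LfI] := (memL2P _).1 Lf.
split; split=> //; try by move=> k; have [] := (memL2P _).1 (LF k).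
  apply: (squeeze_cvgr _ (cvg_cst 0) H2); near=> k; rewrite ip_ge0 E1/=.
  by rewrite (normL2_sqr (LB k)) lerDl ip_ge0.
apply: (squeeze_cvgr _ (cvg_cst 0) H2); near=> k; rewrite ip_ge0 E2/=.
by rewrite (normL2_sqr (LB k)) lerDr ip_ge0.
Unshelve. all: by end_near. Qed.

Lemma enormLy_le f (M : R) : 0 <= M -> {ae mu, forall x, A x -> cabs (f x) <= M} ->
  (enormL mu A +oo%E f <= M%:E)%E.
Proof.
move=> M0 H; rewrite /enormL unlock; case: ifP => _; last by rewrite lee_fin.
apply/ess_sup_inf.ess_supP; apply: filterS H => x Hx; rewrite /= /patch; case: ifPn => xA.
  by rewrite abse_EFin lee_fin ger0_norm ?cabs_ge0 ?Hx//; rewrite inE in xA.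
by rewrite abse0 lee_fin.
Qed.

Lemma normLy_le f (M : R) : 0 <= M -> {ae mu, forall x, A x -> cabs (f x) <= M} ->
  normL mu A +oo%E f <= M.
Proof.
move=> M0 H; have := enormLy_le M0 H; have : (0 <= enormL mu A +oo%E f)%E by exact: Lnorm_ge0.
by rewrite /normL; case: (enormL _ _ _ _).
Qed.

Lemma normLy_ae f : (enormL mu A +oo%E f < +oo)%E ->
  {ae mu, forall x, A x -> cabs (f x) <= normL mu A +oo%E f}.
Proof.
move=> fy; have f0 : (0 <= enormL mu A +oo%E f)%E by exact: Lnorm_ge0.
have fE : enormL mu A +oo%E f = (normL mu A +oo%E f)%:E by rewrite fineK// ge0_fin_numE.
(* The sup norm is 0 by definition when the whole space is null, and then everything holds almost
   everywhere. *)
move: fE; rewrite {1}/enormL unlock; case: ifPn => [m0 fE|m0 _]; last first.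
  exists setT; split=> //; apply/eqP; rewrite eq_le measure_ge0 andbT leNgt; exact: m0.
have : (ess_sup_inf.ess_sup mu (abse \o ((fun x => (cabs (f x))%:E) \_ A)) <= (normL mu A +oo%E f)%:E)%E by rewrite fE.
move=> /ess_sup_inf.ess_supP; apply: filterS => x /= + Ax.
by rewrite /patch mem_set// abse_EFin lee_fin ger0_norm ?cabs_ge0.
Qed.

End complex_Lp.

(** * Weak derivatives and traces *)

Section weak_derivatives.
Context {R : realType} {m : nat}.
Variable Omega : set 'rV[R]_m.+1.
Hypothesis hO : @bounded_smooth_domain R m.+1 Omega.
Local Notation leb := (lebesgue_rV m.+1 : {measure set 'rV[R]_m.+1 -> \bar R}).
Local Notation L1 := (L1 leb Omega).
Local Notation L2 := (L2 leb Omega).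
Implicit Types (u w e : 'rV[R]_m.+1 -> R) (a : seq 'I_m.+1) (i j : 'I_m.+1).

Let mO : measurable Omega := measurable_Omega hO.
Let oO : open Omega. Proof. by case: hO. Qed.

Lemma continuous_L2 u : continuous u -> L2 u.
Proof.
move=> cu; have [M M0 uM] := continuous_bounded_closure hO cu.
apply: (L2_bounded mO (K := M)); [exact: leb_Omega_lty|exact: continuous_measurable_rV|].
by move=> x Ox; apply: uM; exact: subset_closure.
Qed.

Lemma L1M_continuous u e : continuous e -> L1 u -> L1 (fun x => e x * u x).
Proof.
move=> ce iu; have [M M0 eM] := continuous_bounded_closure hO ce.
apply: (le_L1 mO (g := fun x => M * `|u x|)).
- by apply: measurable_funM; [exact: continuous_measurable_rV|exact: L1_measurable iu].
- move=> x Ox; rewrite normrM ler_wpM2r// eM//; exact: subset_closure.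
- by apply: L1Z => //; exact: integrable_abse iu.
Qed.

Definition real_wderiv a u w : Prop := forall phi, test_function Omega phi ->
  \int[leb]_(x in Omega) (u x * pderiv a phi x) =
  (-1) ^+ size a * \int[leb]_(x in Omega) (w x * phi x).

Lemma test_pd i phi : test_function Omega phi -> test_function Omega (pd i phi).
Proof.
move=> [sp [K [cK KO p0]]]; split; first exact: smooth_pd.
exists K; split=> // x Kx; apply: (pd_eq0 (K := K)) => //.
by apply: compact_closed => //; exact: norm_hausdorff.
Qed.

Lemma testM e phi : smooth e -> test_function Omega phi -> test_function Omega (fun x => e x * phi x).
Proof.
move=> se [sp [K [cK KO p0]]]; split; first exact: smoothM.
by exists K; split=> // x Kx; rewrite p0// mulr0.
Qed.

Lemma test_continuous phi : test_function Omega phi -> continuous phi.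
Proof. by move=> [/(_ [::])[]]. Qed.

Lemma L1M_test u phi : test_function Omega phi -> L1 u -> L1 (fun x => u x * phi x).
Proof.
move=> /test_continuous cp /(L1M_continuous cp); apply: eq_integrable => // x _.
by rewrite /= mulrC.
Qed.

Lemma real_wderiv_unique a u w w' : L1 w -> L1 w' -> real_wderiv a u w -> real_wderiv a u w' ->
  {ae leb, forall x, Omega x -> w x = w' x}.
Proof.
move=> iw iw' H H'.
have iB : L1 (fun x => w x - w' x) by exact: L1B.
have : {ae leb, forall x, Omega x -> w x - w' x = 0}.
  apply: fundamental_lemma => // phi tphi.
  have iwp := L1M_test tphi iw; have iwp' := L1M_test tphi iw'.
  have E : \int[leb]_(x in Omega) (w x * phi x) = \int[leb]_(x in Omega) (w' x * phi x).
    apply: (mulfI (_ : (-1) ^+ size a != 0 :> R)); first by rewrite signr_eq0.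
    by rewrite -H// -H'.
  have iBp := L1M_test tphi iB.
  rewrite -[LHS]fineK; last by apply: integrable_fin_num iBp.
  congr EFin; rewrite -/(Rintegral _ _ _).
  rewrite (_ : Rintegral _ _ _ = \int[leb]_(x in Omega) (w x * phi x - w' x * phi x)).
    by rewrite RintegralB// E subrr.
  by apply: eq_Rintegral => x _; rewrite mulrBl.
by apply: filterS => x H0 Ox; apply/eqP; rewrite -subr_eq0 H0.
Qed.

Lemma real_wderivD a u u' w w' : L1 u -> L1 u' -> L1 w -> L1 w' -> real_wderiv a u w -> real_wderiv a u' w' ->
  real_wderiv a (fun x => u x + u' x) (fun x => w x + w' x).
Proof.
move=> iu iu' iw iw' H H' phi tphi.
have tp : test_function Omega (pderiv a phi).
  by elim: a {H H'} => //= j a; exact: test_pd.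
rewrite (_ : Rintegral _ _ _ = \int[leb]_(x in Omega) (u x * pderiv a phi x + u' x * pderiv a phi x)); last first.
  by apply: eq_Rintegral => x _; rewrite mulrDl.
rewrite RintegralD//; [|exact: L1M_test..].
rewrite H// H'// -mulrDr -RintegralD//; [|exact: L1M_test..].
by congr (_ * _); apply: eq_Rintegral => x _; rewrite mulrDl.
Qed.

Lemma real_wderivZ a (c : R) u w : L1 u -> L1 w -> real_wderiv a u w ->
  real_wderiv a (fun x => c * u x) (fun x => c * w x).
Proof.
move=> iu iw H phi tphi.
have tp : test_function Omega (pderiv a phi).
  by elim: a {H} => //= j a; exact: test_pd.
rewrite (_ : Rintegral _ _ _ = \int[leb]_(x in Omega) (c * (u x * pderiv a phi x))); last first.
  by apply: eq_Rintegral => x _; rewrite mulrA.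
rewrite RintegralZl//; last exact: L1M_test.
rewrite H// mulrCA -RintegralZl//; last exact: L1M_test.
by congr (_ * _); apply: eq_Rintegral => x _; rewrite mulrA.
Qed.

Lemma real_wderivN a u w : L1 u -> L1 w -> real_wderiv a u w -> real_wderiv a (fun x => - u x) (fun x => - w x).
Proof.
move=> iu iw H; have -> : (fun x => - u x) = (fun x => -1 * u x) by apply/funext => x; rewrite mulN1r.
have -> : (fun x => - w x) = (fun x => -1 * w x) by apply/funext => x; rewrite mulN1r.
exact: real_wderivZ.
Qed.

Lemma real_wderivB a u u' w w' : L1 u -> L1 u' -> L1 w -> L1 w' -> real_wderiv a u w -> real_wderiv a u' w' ->
  real_wderiv a (fun x => u x - u' x) (fun x => w x - w' x).
Proof.
by move=> iu iu' iw iw' H H'; apply: real_wderivD => //; [exact: L1N|exact: L1N|exact: real_wderivN].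
Qed.

(** [e * phi] is again a test function; testing [u] against it produces the product rule. *)
Lemma real_wderiv_mul i e u w : smooth e -> L1 u -> L1 w -> real_wderiv [:: i] u w ->
  real_wderiv [:: i] (fun x => e x * u x) (fun x => e x * w x + pd i e x * u x).
Proof.
move=> se iu iw H phi tphi /=.
have ce : continuous e by exact: (se [::]).1.
have cei : continuous (pd i e) by exact: (se [:: i]).1.
have te := testM se tphi; have tp := test_pd i tphi.
have := H _ te; rewrite /= !expr1 !mulN1r => H1.
have E1 : \int[leb]_(x in Omega) (e x * u x * pd i phi x) =
    \int[leb]_(x in Omega) (u x * pd i (fun x => e x * phi x) x - (pd i e x * u x) * phi x).
  apply: eq_Rintegral => x _; rewrite pdM; [ring|exact: (se [::]).2|].
  by have [sp _] := tphi; exact: (sp [::]).2.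
rewrite E1 RintegralB//.
- rewrite H1 -opprD -RintegralD//.
  + by congr (- _); apply: eq_Rintegral => x _; ring.
  + exact: L1M_test.
  + by apply: L1M_test => //; exact: L1M_continuous.
- exact: (L1M_test (test_pd i te) iu).
- by apply: L1M_test => //; exact: L1M_continuous.
Qed.

Lemma real_wderiv_smooth i u : smooth u -> real_wderiv [:: i] u (pd i u).
Proof.
move=> su phi tphi; rewrite /= expr1 mulN1r.
have cu : continuous u by exact: (su [::]).1.
have cui : continuous (pd i u) by exact: (su [:: i]).1.
have tp := test_pd i tphi; have [sp [K [cK KO p0]]] := tphi.
have i1 : L1 (fun x => u x * pd i phi x) by apply: L1M_test => //; exact: L2_L1 (leb_Omega_lty hO) (continuous_L2 cu).
have i2 : L1 (fun x => pd i u x * phi x) by apply: L1M_test => //; exact: L2_L1 (leb_Omega_lty hO) (continuous_L2 cui).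
apply/eqP; rewrite -subr_eq0 opprK -RintegralD//; apply/eqP.
have Cup : C1 (fun x => u x * phi x) by apply: C1M; exact: smooth_C1.
have u0 x : ~ K x -> u x * phi x = 0 by move=> Kx; rewrite p0 ?mulr0.
have := integral_pd_eq0 (i := i) cK u0 (fun x => (Cup.2 i).1 x) (Cup.2 i).2.
rewrite /Rintegral => H.
rewrite (_ : (\int[_]_(_ in _) _)%E = 0%E)// -{}H.
rewrite [LHS](integral_mkcond Omega); congr (integral _ _ _); apply/funext => x.
have E : pd i (fun x => u x * phi x) x = u x * pd i phi x + pd i u x * phi x.
  by rewrite pdM; [ring|exact: (su [::]).2|exact: (sp [::]).2].
rewrite E /patch; case: ifPn => // xO.
have nK : ~ K x by move=> /KO Ox; move: xO; rewrite mem_set.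
rewrite (p0 _ nK) (pd_eq0 (K := K))// ?mulr0 ?addr0//.
by apply: compact_closed => //; exact: norm_hausdorff.
Qed.

Lemma real_wderiv_nil u : real_wderiv [::] u u.
Proof. by move=> phi _; rewrite expr0 mul1r. Qed.

(** [pderiv [:: i; j] phi] is d_i (d_j phi), so [u] is tested first, against d_j phi; the two minus
    signs combine into the sign of order two. *)
Lemma real_wderiv_comp i j u w w' : real_wderiv [:: i] u w -> real_wderiv [:: j] w w' -> real_wderiv [:: i; j] u w'.
Proof.
move=> H1 H2 phi tphi; have := H1 _ (test_pd j tphi); rewrite /= => ->.
have := H2 _ tphi => /= ->; rewrite !expr1 !mulN1r opprK expr2.
by rewrite mulN1r opprK mul1r.
Qed.

Lemma real_wderiv_split i j u w w' : real_wderiv [:: i] u w -> real_wderiv [:: i; j] u w' -> real_wderiv [:: j] w w'.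
Proof.
move=> H1 H2 phi tphi; have := H1 _ (test_pd j tphi); have := H2 _ tphi => /= ->.
rewrite !expr1 !mulN1r => /esym H; apply: oppr_inj; rewrite H expr2 mulN1r opprK mul1r.
by rewrite opprK.
Qed.

End weak_derivatives.

Section complex_weak_derivatives.
Context {R : realType} {m : nat}.
Variable Omega : set 'rV[R]_m.+1.
Hypothesis hO : @bounded_smooth_domain R m.+1 Omega.
Local Notation leb := (lebesgue_rV m.+1 : {measure set 'rV[R]_m.+1 -> \bar R}).
Implicit Types (u w : 'rV[R]_m.+1 -> R[i]) (a : seq 'I_m.+1) (i j : 'I_m.+1).
Local Notation Re := complex.Re.
Local Notation Im := complex.Im.
Local Notation ReF f := (fun x => Re (f x)).
Local Notation ImF f := (fun x => Im (f x)).
Local Notation L2Omega := (L2 leb Omega).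
Local Notation normL2 := (normL leb Omega 2%:E).
Local Open Scope complex_scope.

Let mO : measurable Omega := measurable_Omega hO.

Lemma Re_signM k (z : R[i]) : Re ((-1) ^+ k * z) = (-1) ^+ k * Re z.
Proof. by elim: k => [|k IH]; rewrite ?expr0 ?mul1r// !exprS -!mulrA mulN1r ReN IH mulN1r. Qed.

Lemma Im_signM k (z : R[i]) : Im ((-1) ^+ k * z) = (-1) ^+ k * Im z.
Proof. by elim: k => [|k IH]; rewrite ?expr0 ?mul1r// !exprS -!mulrA mulN1r ImN IH mulN1r. Qed.

Lemma ReFB u w : ReF (fun x => u x - w x) = (fun x => Re (u x) - Re (w x)).
Proof. by apply/funext => x; rewrite ReD ReN. Qed.

Lemma ImFB u w : ImF (fun x => u x - w x) = (fun x => Im (u x) - Im (w x)).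
Proof. by apply/funext => x; rewrite ImD ImN. Qed.

Lemma is_wderivP a u w : is_wderiv Omega a u w <->
  [/\ L2Omega (ReF w), L2Omega (ImF w), real_wderiv Omega a (ReF u) (ReF w) & real_wderiv Omega a (ImF u) (ImF w)].
Proof.
have reE (f : 'rV[R]_m.+1 -> R[i]) (p : 'rV[R]_m.+1 -> R) :
    Re (cintegral leb Omega (fun x => f x * (p x)%:C)) = \int[leb]_(x in Omega) (Re (f x) * p x).
  by apply: eq_Rintegral => x _; rewrite ReM/= mulr0 subr0.
have imE (f : 'rV[R]_m.+1 -> R[i]) (p : 'rV[R]_m.+1 -> R) :
    Im (cintegral leb Omega (fun x => f x * (p x)%:C)) = \int[leb]_(x in Omega) (Im (f x) * p x).
  by apply: eq_Rintegral => x _; rewrite ImM/= mulr0 add0r.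
split=> [[/(memL2P _ mO)[L1' L2'] H]|[L1' L2' H1 H2]].
  split=> // phi /H E; [have := congr1 (@complex.Re R) E|have := congr1 (@complex.Im R) E].
    by rewrite Re_signM !reE.
  by rewrite Im_signM !imE.
split; first exact/(memL2P _ mO).
move=> phi tphi; apply: complexP; rewrite ?Re_signM ?Im_signM ?reE ?imE; [exact: H1|exact: H2].
Qed.

Lemma wderivP a u : (exists w, is_wderiv Omega a u w) -> is_wderiv Omega a u (wderiv Omega a u).
Proof. by move=> ex; have := @xgetPex _ (fun=> 0 : R[i]) _ ex. Qed.

Lemma wderiv_unique a u w w' : is_wderiv Omega a u w -> is_wderiv Omega a u w' ->
  {ae leb, forall x, Omega x -> w x = w' x}.
Proof.
move=> /is_wderivP[Lr Li rr ri] /is_wderivP[Lr' Li' rr' ri'].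
have fin := leb_Omega_lty hO.
have H1 := real_wderiv_unique hO (L2_L1 mO fin Lr) (L2_L1 mO fin Lr') rr rr'.
have H2 := real_wderiv_unique hO (L2_L1 mO fin Li) (L2_L1 mO fin Li') ri ri'.
by apply: filterS2 H1 H2 => x h1 h2 Ox; apply: complexP; [exact: h1|exact: h2].
Qed.

(** [wderiv] is a choice among all weak derivatives, so a computed one may replace it only almost
    everywhere. *)
Lemma wderiv_ae a u w : is_wderiv Omega a u w ->
  {ae leb, forall x, Omega x -> wderiv Omega a u x = w x}.
Proof. by move=> H; apply: wderiv_unique (H); apply: wderivP; exists w. Qed.

Lemma normL2_ae u w : memL leb Omega 2%:E u -> memL leb Omega 2%:E w ->
  {ae leb, forall x, Omega x -> u x = w x} -> normL2 u = normL2 w.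
Proof.
move=> Lu Lw H; apply/eqP; rewrite eq_le.
by rewrite !(normL2_le mO)//; apply: filterS H => x H Ox; rewrite H.
Qed.

Definition has_wderivs k u : Prop := forall a, (size a <= k)%N -> exists w, is_wderiv Omega a u w.

Let sumH k u : R := \sum_(j < k.+1) \sum_(a : j.-tuple 'I_m.+1) normL2 (wderiv Omega a u) ^+ 2.

Let sumH_ge0 k u : 0 <= sumH k u.
Proof. by apply: sumr_ge0 => j _; apply: sumr_ge0 => a _; exact: sqr_ge0. Qed.

(** At an integer order the fractional part [theta] is 0 and the Slobodeckij double integral
    disappears. *)
Let enormH_natE k u : has_wderivs k u -> enormH Omega k%:R u = ((sumH k u)%:E `^ 2^-1)%E.
Proof.
move=> Hu; rewrite /enormH natrK subrr eqxx adde0; congr poweR.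
rewrite /sumH -sumEFin; apply: eq_bigr => j _; rewrite -sumEFin; apply: eq_bigr => a _.
have [_ fin] : memL leb Omega 2%:E (wderiv Omega a u).
  by have [] := wderivP (Hu a _); rewrite // size_tuple -ltnS.
rewrite /normL -(powR_mulrn 2)// -?poweR_EFin ?fineK//.
  by rewrite ge0_fin_numE ?Lnorm_ge0.
by rewrite fine_ge0 ?Lnorm_ge0.
Qed.

Let normH_natE k u : has_wderivs k u -> normH Omega k%:R u = Num.sqrt (sumH k u).
Proof. by move=> Hu; rewrite /normH enormH_natE// fine_poweR/= powR12_sqrt. Qed.

Lemma memH_nat k u : memH Omega k%:R u <-> memL leb Omega 2%:E u /\ has_wderivs k u.
Proof.
split=> [[Lu Hu _]|[Lu Hu]].
  by split=> // a sa; apply: (Hu _ (in_tuple a)); rewrite natrK.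
split=> //; first by move=> j a; rewrite natrK => jk; apply: Hu; rewrite size_tuple.
by rewrite enormH_natE// poweR_lty// ltry.
Qed.

Lemma normH_ge0 s u : 0 <= normH Omega s u.
Proof. by rewrite fine_ge0// poweR_ge0. Qed.

Lemma normL2_wderiv_le k u a : has_wderivs k u -> (size a <= k)%N ->
  normL2 (wderiv Omega a u) <= normH Omega k%:R u.
Proof.
move=> Hu sa; rewrite normH_natE// -(ger0_norm (normL_ge0 _ _ _ _)) -sqrtr_sqr ler_sqrt ?sumH_ge0//.
have sa' : (size a < k.+1)%N by [].
rewrite /sumH (bigD1 (Ordinal sa'))//= (bigD1 (in_tuple a))//= -addrA lerDl addr_ge0//.
  by apply: sumr_ge0 => b _; exact: sqr_ge0.
by apply: sumr_ge0 => j _; apply: sumr_ge0 => b _; exact: sqr_ge0.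
Qed.

(** A crude constant: being at least 1, it bounds its own square root in [normH_nat_le]. *)
Definition num_derivs k : R := \sum_(j < k.+1) \sum_(a : j.-tuple 'I_m.+1) 1.

Lemma num_derivs_ge1 k : 1 <= num_derivs k.
Proof.
rewrite /num_derivs big_ord_recl/= (bigD1 (nil_tuple _))//= -addrA lerDl addr_ge0//.
  by apply: sumr_ge0.
by apply: sumr_ge0 => j _; apply: sumr_ge0.
Qed.

Lemma normH_nat_le k u (M : R) : 0 <= M -> has_wderivs k u ->
  (forall a, (size a <= k)%N -> normL2 (wderiv Omega a u) <= M) ->
  normH Omega k%:R u <= num_derivs k * M.
Proof.
move=> M0 Hu uM; rewrite normH_natE//.
have N1 := num_derivs_ge1 k; have N0 : 0 <= num_derivs k by apply: le_trans N1.
rewrite -[leRHS]ger0_norm ?mulr_ge0// -sqrtr_sqr ler_sqrt ?sqr_ge0//.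
apply: (@le_trans _ _ (num_derivs k * M ^+ 2)).
  rewrite /num_derivs mulr_suml; apply: ler_sum => j _.
  rewrite mulr_suml; apply: ler_sum => a _; rewrite mul1r.
  by rewrite lerXn2r ?nnegrE ?normL_ge0// uM// size_tuple -ltnS.
by rewrite exprMn ler_wpM2r ?sqr_ge0// expr2 ler_peMl.
Qed.

Lemma memH2_memH1 u : memH Omega 2 u -> memH Omega 1 u.
Proof.
by move=> /(memH_nat 2)[Lu Hu]; apply/(memH_nat 1); split=> // a sa; apply: Hu; apply: leq_trans sa _.
Qed.

Lemma is_wderiv1 u i : memH Omega 1 u -> is_wderiv Omega [:: i] u (wderiv Omega [:: i] u).
Proof. by move=> /(memH_nat 1)[_ Hu]; apply: wderivP; exact: Hu. Qed.

Lemma is_wderiv2 u i j : memH Omega 2 u ->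
  is_wderiv Omega [:: j] (wderiv Omega [:: i] u) (wderiv Omega [:: i; j] u).
Proof.
move=> /[dup] /memH2_memH1 /(is_wderiv1 i) /is_wderivP[_ _ r1 r1'] /(memH_nat 2)[_ Hu].
have /wderivP/is_wderivP[L1' L2' r2 r2'] : exists w, is_wderiv Omega [:: i; j] u w by exact: Hu.
by apply/is_wderivP; split=> //; [exact: real_wderiv_split r1 r2|exact: real_wderiv_split r1' r2'].
Qed.

Lemma is_wderiv_nil u : memL leb Omega 2%:E u -> is_wderiv Omega [::] u u.
Proof. by move=> /(memL2P _ mO)[? ?]; apply/is_wderivP; split=> //; exact: real_wderiv_nil. Qed.

Lemma memH1P u (w : 'I_m.+1 -> 'rV[R]_m.+1 -> R[i]) : memL leb Omega 2%:E u ->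
  (forall i, is_wderiv Omega [:: i] u (w i)) -> memH Omega 1 u.
Proof.
move=> Lu Hu; apply/(memH_nat 1); split=> // -[_|i [|//] _].
  by exists u; exact: is_wderiv_nil.
by exists (w i).
Qed.

Lemma memH1_wderiv u i : memH Omega 2 u -> memH Omega 1 (wderiv Omega [:: i] u).
Proof.
move=> Hu; apply: (memH1P (w := fun j => wderiv Omega [:: i; j] u)).
  by have [] := is_wderiv1 i (memH2_memH1 Hu).
by move=> j; exact: is_wderiv2.
Qed.

Section trace.
Variables (sigma : {measure set 'rV[R]_m.+1 -> \bar R}).
Hypothesis hs : @surface_measure R m.+1 Omega sigma.

(* [w] plays the role of the gradient of [f], and [g] that of its trace. *)
Definition real_trace (f : 'rV[R]_m.+1 -> R) (w : 'I_m.+1 -> 'rV[R]_m.+1 -> R) (g : 'rV[R]_m.+1 -> R) :=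
  exists fk : nat -> 'rV[R]_m.+1 -> R,
  [/\ forall k, smooth (fk k), L2cvg leb Omega fk f,
      forall i, L2cvg leb Omega (fun k => pd i (fk k)) (w i) &
      L2cvg sigma (bd Omega) fk g].

Lemma continuous_L2_bd (f : 'rV[R]_m.+1 -> R) : continuous f -> L2 sigma (bd Omega) f.
Proof.
move=> cf; have [M M0 fM] := continuous_bounded_closure hO cf.
have mb := measurable_bd Omega.
refine (@L2_bounded _ _ _ sigma (bd Omega) mb f M _ _ _); last by move=> x [cx _]; exact: fM.
- apply: le_lt_trans (sigma_lty hO hs); apply: le_measure; rewrite ?inE//.
- exact: continuous_measurable_rV.
Qed.

(** The hypothesis controls the chosen weak derivatives of u_k - u. By uniqueness they agree almost
    everywhere with the classical gradient of u_k minus [w], so the gradients converge in L^2 along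
    with the functions. *)
Lemma is_trace_real u g (w : 'I_m.+1 -> 'rV[R]_m.+1 -> R[i]) : memL leb Omega 2%:E u ->
  (forall i, is_wderiv Omega [:: i] u (w i)) -> is_trace Omega sigma u g ->
  real_trace (ReF u) (fun i => ReF (w i)) (ReF g) /\ real_trace (ImF u) (fun i => ImF (w i)) (ImF g).
Proof.
move=> Lu Hw [Lg [uk [suk cuk cgk]]].
have fin := leb_Omega_lty hO.
have [Lur Lui] := (memL2P _ mO u).1 Lu.
pose v k x : R[i] := uk k x - u x.
pose vw i k x : R[i] := (pd i (ReF (uk k)) x +i* pd i (ImF (uk k)) x) - w i x.
have csm (f : 'rV[R]_m.+1 -> R) : smooth f -> L2Omega f by move=> sf; apply: continuous_L2 => //; exact: (sf [::]).1.
have csmd i (f : 'rV[R]_m.+1 -> R) : smooth f -> L2Omega (pd i f) by move=> /(smooth_pd i); exact: csm.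
have Luk k : memL leb Omega 2%:E (uk k) by apply/(memL2P _ mO); split; apply: csm; have [] := suk k.
have Ldk i k : memL leb Omega 2%:E (fun x => pd i (ReF (uk k)) x +i* pd i (ImF (uk k)) x).
  by apply/(memL2P _ mO); split=> /=; apply: csmd; have [] := suk k.
have Lv k : memL leb Omega 2%:E (v k).
  apply/(memL2P _ mO); have [? ?] := (memL2P _ mO _).1 (Luk k); rewrite /v.
  split; [under [X in L2 _ _ X]funext do rewrite ReD ReN|under [X in L2 _ _ X]funext do rewrite ImD ImN]; exact: L2B.
have Hvw i k : is_wderiv Omega [:: i] (v k) (vw i k).
  have /is_wderivP[Lr Li rr ri] := Hw i; have [sr si] := suk k.
  apply/is_wderivP; rewrite /v /vw; split.
  - by under [X in L2 _ _ X]funext do rewrite ReD ReN/=; apply: L2B => //; exact: csmd.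
  - by under [X in L2 _ _ X]funext do rewrite ImD ImN/=; apply: L2B => //; exact: csmd.
  - rewrite !ReFB; apply: (real_wderivB hO) (real_wderiv_smooth hO i sr) rr; apply: (L2_L1 mO fin) => //; [exact: (csm _ sr)|exact: (csmd i _ sr)].
  - rewrite !ImFB; apply: (real_wderivB hO) (real_wderiv_smooth hO i si) ri; apply: (L2_L1 mO fin) => //; [exact: (csm _ si)|exact: (csmd i _ si)].
have Hv k : has_wderivs 1 (v k).
  move=> [_|i [|//] _]; first by exists (v k); exact: is_wderiv_nil.
  by exists (vw i k).
have N0 k : normL2 (v k) <= normH Omega 1 (v k).
  rewrite (normL2_ae (w := wderiv Omega [::] (v k))); first exact: (@normL2_wderiv_le 1).
  - exact: Lv.
  - by have [] := wderivP (Hv k [::] _).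
  - by apply: filterS (wderiv_ae (is_wderiv_nil (Lv k))) => x H Ox; rewrite H.
have N1 i k : normL2 (vw i k) <= normH Omega 1 (v k).
  rewrite (normL2_ae (w := wderiv Omega [:: i] (v k))); first exact: (@normL2_wderiv_le 1).
  - by have [] := Hvw i k.
  - by have [] := wderivP (Hv k [:: i] _).
  - by apply: filterS (wderiv_ae (Hvw i k)) => x H Ox; rewrite H.
have c0 : normL2 (fun x => uk k x - u x) @[k --> \oo] --> (0 : R).
  apply: (squeeze_cvgr _ (cvg_cst 0) cuk); near=> k; rewrite normL_ge0; exact: N0.
have c1 i : normL2 (fun x => (pd i (ReF (uk k)) x +i* pd i (ImF (uk k)) x) - w i x) @[k --> \oo] --> (0 : R).
  apply: (squeeze_cvgr _ (cvg_cst 0) cuk); near=> k; rewrite normL_ge0; exact: N1.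
have [C0r C0i] := normL2_cvg mO Luk Lu c0.
have C1' i := normL2_cvg mO (Ldk i) (Hw i).1 (c1 i).
have Lukb k : memL sigma (bd Omega) 2%:E (uk k).
  apply/(memL2P _ (measurable_bd Omega)); have [sr si] := suk k.
  by split; apply: continuous_L2_bd; [exact: (sr [::]).1|exact: (si [::]).1].
have [Cgr Cgi] := normL2_cvg (measurable_bd Omega) Lukb Lg cgk.
split.
  exists (fun k => ReF (uk k)); split=> // [k|i]; first by have [] := suk k.
  by have [] := C1' i.
exists (fun k => ImF (uk k)); split=> // [k|i]; first by have [] := suk k.
by have [] := C1' i.
Unshelve. all: by end_near. Qed.

End trace.

End complex_weak_derivatives.

Lemma L2cvgN {d} {T : measurableType d} {R : realType} (mu : {measure set T -> \bar R}) (A : set T)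
    (F : nat -> T -> R) (f : T -> R) : measurable A ->
  L2cvg mu A F f -> L2cvg mu A (fun k x => - F k x) (fun x => - f x).
Proof.
move=> mA H.
have -> : (fun k x => - F k x) = (fun k x => cst (-1) x * F k x).
  by apply/funext => k; apply/funext => x; rewrite mulN1r.
have -> : (fun x => - f x) = (fun x => cst (-1) x * f x) by apply/funext => x; rewrite mulN1r.
by apply: (L2cvgMb mA (K := 1)) => // x _; rewrite normrN normr1.
Qed.

Lemma cvg_add_unique {R : realType} (F A B : nat -> R) (a b c : R) :
  (forall k, F k = A k + B k) ->
  F k @[k --> \oo] --> a -> A k @[k --> \oo] --> b -> B k @[k --> \oo] --> c -> a = b + c.
Proof.
move=> E Fa Ab Bc; have H : F k @[k --> \oo] --> b + c.
  by rewrite (_ : F = fun k => A k + B k); [exact: cvgD|exact/funext].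
exact: (cvg_unique (@norm_hausdorff _ R) Fa H).
Qed.

Section traces.
Context {R : realType} {m : nat}.
Variables (Omega : set 'rV[R]_m.+1) (sigma : {measure set 'rV[R]_m.+1 -> \bar R})
  (nu : 'rV[R]_m.+1 -> 'rV[R]_m.+1).
Hypotheses (hO : @bounded_smooth_domain R m.+1 Omega)
  (hs : @surface_measure R m.+1 Omega sigma)
  (hnu : @outward_unit_normal R m.+1 Omega nu).
Local Notation leb := (lebesgue_rV m.+1 : {measure set 'rV[R]_m.+1 -> \bar R}).
Implicit Types (f g : 'rV[R]_m.+1 -> R) (i j : 'I_m.+1).

Let mO : measurable Omega := measurable_Omega hO.
Let mB : measurable (bd Omega) := measurable_bd Omega.

Lemma green_Rintegral j psi : C1 psi ->
  \int[leb]_(x in Omega) pd j psi x = \int[sigma]_(x in bd Omega) (psi x * nu x ord0 j).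
Proof. by move=> Cpsi; rewrite /Rintegral (green_C1 hO hs hnu j Cpsi). Qed.

Lemma real_trace_L2 f w g : real_trace Omega sigma f w g ->
  [/\ L2 leb Omega f, forall i, L2 leb Omega (w i) & L2 sigma (bd Omega) g].
Proof. by move=> [fk [_ [_ ? _] H [_ ? _]]]; split=> // i; have [] := H i. Qed.

(** The C1 formula for the product of the approximants splits into inner products of sequences
    converging in L^2, and each converges; [nu] is bounded and measurable, so it may multiply one
    factor. *)
Lemma real_trace_green f w g f' w' g' i :
  real_trace Omega sigma f w g -> real_trace Omega sigma f' w' g' ->
  \int[sigma]_(x in bd Omega) (nu x ord0 i * g x * g' x) =
  ip leb Omega (w i) f' + ip leb Omega f (w' i).
Proof.
move=> [fk [sf cf cw cg]] [fk' [sf' cf' cw' cg']].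
have mnu := measurable_nu hO hnu i; have bnu := nu_bound hO hnu i.
have Hl := ip_cvg mB (L2cvgMb mB mnu bnu cg) cg'.
have H1 := ip_cvg mO (cw i) cf'.
have H2 := ip_cvg mO cf (cw' i).
apply: (cvg_add_unique _ Hl H1 H2) => k.
have [/smooth_C1 C /smooth_C1 C'] := (sf k, sf' k).
have := green_Rintegral i (C1M C C'); rewrite /ip => H.
transitivity (\int[leb]_(x in Omega) pd i (fun x => fk k x * fk' k x) x).
  by rewrite H; apply: eq_Rintegral => x _; ring.
rewrite -RintegralD//.
- apply: eq_Rintegral => x _; rewrite pdM; [ring|exact: (C.2 i).1|exact: (C'.2 i).1].
- apply: (L2M mO); [have [H' _ _] := cw i; exact: H'|have [H' _ _] := cf'; exact: H'].
- apply: (L2M mO); [have [H' _ _] := cf; exact: H'|have [H' _ _] := cw' i; exact: H'].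
Qed.

Lemma ae_seq {d} {T : measurableType d} (mu : {measure set T -> \bar R}) (I : eqType) (L : seq I)
  (P : I -> T -> Prop) : (forall p, p \in L -> {ae mu, forall x, P p x}) ->
  {ae mu, forall x p, p \in L -> P p x}.
Proof.
elim: L => [|a L IH] H; first exact: aeW.
have Ha := H a (mem_head _ _); have {}IH := IH (fun p pL => H p (mem_behead (s := a :: L) pL)).
by apply: filterS2 Ha IH => x h1 h2 p; rewrite inE => /predU1P[->|/h2].
Qed.

Lemma max0_lipschitz (a b : R) : `|Num.max a 0 - Num.max b 0| <= `|a - b|.
Proof. by rewrite ler_norml; case: (leP a 0) => ?; case: (leP b 0) => ?; case: (ler0P (a - b)) => ?; apply/andP; split; lra. Qed.

Section trace_upper_bound.
Variables (f : 'rV[R]_m.+1 -> R) (w : 'I_m.+1 -> 'rV[R]_m.+1 -> R) (g : 'rV[R]_m.+1 -> R) (M : R).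
Hypotheses (tr : real_trace Omega sigma f w g)
  (fM : {ae leb, forall x, Omega x -> f x <= M}).

Local Notation excess f := (fun x => Num.max (f x - M) 0).

Let L2_excess {d} {T : measurableType d} (mu : {measure set T -> \bar R}) (A : set T) (h : T -> R) :
  measurable A -> (mu A < +oo)%E -> L2 mu A h -> L2 mu A (excess h).
Proof.
move=> mA muA Lh; have LM : L2 mu A (cst M) by apply: (L2_bounded mA (K := `|M|)).
have [mh ih] := L2B mA Lh LM.
split; first by apply: measurable_maxr.
apply: (le_L1 mA) ih; first by apply: measurable_funX; exact: measurable_maxr.
move=> x _; rewrite ger0_norm ?sqr_ge0//.
by case: (leP (h x - M) 0) => ?; rewrite ?expr0n ?sqr_ge0.
Qed.

(* Green's formula in the chart direction for [(f_k - M)_+^2 chi^2]: the bulk terms vanish in the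
   limit since [f <= M], and [nu_i] has constant sign in the chart. *)
Let local_bound p (e : R) : is_chart_ball Omega p e -> exists2 e', 0 < e' &
  {ae sigma, forall x, bd Omega x -> ball p e' x -> g x <= M}.
Proof.
move=> [i [b [gam ch]]]; have e0 : 0 < e by case: ch.
have [e' e'0 [chi [K [Cchi cK Ke chi0 chi1]]]] := cutoff_ball p e0.
exists e' => //.
have [fk [sf cf cw cg]] := tr; have [_ Lf _] := cf; have [_ Lg _] := cg.
have finO := leb_Omega_lty hO.
have finB : (sigma (bd Omega) < +oo)%E.
  by apply: le_lt_trans (sigma_lty hO hs); apply: le_measure; rewrite ?inE.
have cchi : continuous chi by case: Cchi.
have cchii : continuous (pd i chi) by exact: (Cchi.2 i).2.
have [X X0 chiX] := continuous_bounded_closure hO cchi.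
have [X' X'0 chiX'] := continuous_bounded_closure hO cchii.
have bcl x : bd Omega x -> closure Omega x by case.
have Ocl x : Omega x -> closure Omega x by exact: subset_closure.
pose pk k := excess (fk k).
(* Since f <= M, the excess of f_k over M is at most |f_k - f|. *)
have cpO : L2cvg leb Omega pk (cst 0).
  apply: (L2cvg_le mO (F := fk) (f := f)) => //.
  - by move=> k; apply: L2_excess => //; have [H _ _] := cf; exact: H.
  - by apply: (L2_bounded mO (K := 0)) => // x _; rewrite normr0.
  - move=> k; apply: filterS fM => x H Ox; rewrite /pk subr0.
    have := H Ox => fx; rewrite ger0_norm; last by rewrite le_max lexx orbT.
    have := ler_norm (fk k x - f x); have := normr_ge0 (fk k x - f x).
    by case: (leP (fk k x - M) 0) => ?; lra.
have cpB : L2cvg sigma (bd Omega) pk (excess g).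
  apply: (L2cvg_le mB (F := fk) (f := g)) => //.
  - by move=> k; apply: L2_excess => //; have [H _ _] := cg; exact: H.
  - exact: L2_excess.
  - move=> k; apply: aeW => x _; apply: le_trans (max0_lipschitz _ _) _.
    by rewrite opprB addrA subrK.
have mnu := measurable_nu hO hnu i; have bnu := nu_bound hO hnu i.
pose c x := nu x ord0 i * chi x ^+ 2.
have mc : measurable_fun (bd Omega) c.
  apply: measurable_funM => //; apply: measurable_funX; exact: continuous_measurable_rV.
have bc x : bd Omega x -> `|c x| <= 1 * X ^+ 2.
  move=> bx; rewrite normrM normrX ler_pM ?exprn_ge0 ?bnu//.
  by rewrite lerXn2r ?nnegrE ?chiX//; exact: bcl.
have Hl := ip_cvg mB (L2cvgMb mB mc bc cpB) cpB.
pose c1 x := 2 * chi x ^+ 2.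
have mc1 : measurable_fun Omega c1.
  apply: measurable_funM; first exact: measurable_cst.
  by apply: measurable_funX; exact: continuous_measurable_rV.
have bc1 x : Omega x -> `|c1 x| <= 2 * X ^+ 2.
  move=> Ox; rewrite normrM normrX (ger0_norm (ler0n _ 2)) ler_wpM2l//.
  by rewrite lerXn2r ?nnegrE ?chiX//; exact: Ocl.
pose c2 x := 2 * chi x * pd i chi x.
have mc2 : measurable_fun Omega c2.
  apply: measurable_funM; last exact: continuous_measurable_rV.
  by apply: measurable_funM; [exact: measurable_cst|exact: continuous_measurable_rV].
have bc2 x : Omega x -> `|c2 x| <= 2 * X * X'.
  move=> /Ocl Ox; rewrite !normrM (ger0_norm (ler0n _ 2)).
  by rewrite ler_pM ?mulr_ge0 ?chiX'// ler_wpM2l ?chiX.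
have H1 := ip_cvg mO (L2cvgMb mO mc1 bc1 cpO) (cw i).
have H2 := ip_cvg mO (L2cvgMb mO mc2 bc2 cpO) cpO.
(* In both bulk terms the factor [pk k] tends to 0 in L^2, so convergence of the gradients of f_k in
   L^2 is all that is asked of them. *)
have E k : ip sigma (bd Omega) (fun x => c x * pk k x) (pk k) =
    ip leb Omega (fun x => c1 x * pk k x) (pd i (fk k)) + ip leb Omega (fun x => c2 x * pk k x) (pk k).
  have Cf := smooth_C1 (sf k).
  have CfM : C1 (fun x => fk k x - M) by exact: (C1B Cf (C1_cst M)).
  have Dp (s : R) : derivable (pos_sqr : R -> R) s (1 : R) by have [] := is_derive_pos_sqr s.
  have dpE : (fun s => 'D_1 pos_sqr s) = (fun s : R => 2 * Num.max s 0).
    by apply/funext => s; have [_ ->] := is_derive_pos_sqr s.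
  have cDp : continuous (fun s => 'D_1 pos_sqr s : R).
    rewrite dpE; apply: (continuous_mul (f := cst (2 : R))); first exact: cst_continuous.
    by apply: (continuous_maxr (f := id) (g := cst 0)); [move=> x; exact: cvg_id|exact: cst_continuous].
  have Cp : C1 (fun x => pos_sqr (fk k x - M)) by exact: C1_comp.
  have Cc2 := C1M Cchi Cchi.
  have := green_Rintegral i (C1M Cp Cc2); rewrite /ip => H.
  transitivity (\int[leb]_(x in Omega) pd i (fun x => pos_sqr (fk k x - M) * (chi x * chi x)) x).
    by rewrite H; apply: eq_Rintegral => x _; rewrite /c /pk /pos_sqr; ring.
  rewrite -RintegralD//.
  - apply: eq_Rintegral => x _; rewrite pdM; [|exact: (Cp.2 i).1|exact: (Cc2.2 i).1].
    rewrite (pdM (f := chi) (g := chi)); [|exact: (Cchi.2 i).1|exact: (Cchi.2 i).1].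
    have [_ pdE] := @is_derive_comp R m.+1 pos_sqr (fun x => fk k x - M) x (basis_vec i) ((CfM.2 i).1 x) (Dp (fk k x - M)).
    rewrite [pd i (fun x => pos_sqr _) x]pdE (_ : 'D_1 pos_sqr _ = 2 * Num.max (fk k x - M) 0); last first.
      by have [_ ->] := is_derive_pos_sqr (fk k x - M).
    rewrite (_ : 'D_(basis_vec i) (fun x => fk k x - M) x = pd i (fk k) x); last first.
      have := deriveB ((Cf.2 i).1 x) (derivable_cst M x (basis_vec i)).
      by rewrite derive_cst subr0.
    by rewrite /c1 /c2 /pk /pos_sqr; ring.
  - have [LP _ _] := cpO; have [LW _ _] := cw i.
    by apply: (L2M mO) => //; apply: (L2Mb mO mc1 bc1).
  - have [LP _ _] := cpO.
    by apply: (L2M mO) => //; apply: (L2Mb mO mc2 bc2).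
have I0 : ip sigma (bd Omega) (fun x => c x * excess g x) (excess g) = 0.
  have Z h : ip leb Omega (fun x => h x * cst 0 x) =1 fun=> 0.
    move=> h'; rewrite /ip (@eq_Rintegral _ _ _ _ _ (fun=> 0)) ?Rintegral_cst ?mul0r// => x _.
    by rewrite mulr0 mul0r.
  by rewrite (cvg_add_unique E Hl H1 H2) !Z addr0.
have LE : L2 sigma (bd Omega) (excess g) by exact: L2_excess.
have LcE := L2Mb mB mc bc LE.
(* The orientation sign makes the limit integrand nonnegative; as its integral is 0, it vanishes
   almost everywhere. *)
pose F x := (-1) ^+ b * (c x * excess g x * excess g x).
have iF : L1 sigma (bd Omega) F by apply: L1Z => //; exact: L2M.
have chiout x : ~ ball p e x -> chi x = 0 by move=> px; apply: chi0 => /Ke.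
have area0 y := chart_area_gt0 gam y.
have nuE x : bd Omega x -> ball p e x -> (-1) ^+ b * nu x ord0 i = (chart_area gam (col' i x))^-1.
  move=> bx px; rewrite (nu_chart hnu ch i bx px) /chart_nu /graph_normal insert_coordE mulr1.
  by rewrite mulrA -expr2 sqrr_sign mul1r.
have F0 x : bd Omega x -> 0 <= F x.
  move=> bx; rewrite /F /c; have [px|/chiout ->] := pselect (ball p e x); last first.
    by rewrite expr0n/= !(mulr0, mul0r).
  have -> : (-1) ^+ b * (nu x ord0 i * chi x ^+ 2 * excess g x * excess g x) =
    ((-1) ^+ b * nu x ord0 i) * (chi x * excess g x) ^+ 2 by ring.
  by rewrite nuE// mulr_ge0 ?sqr_ge0// invr_ge0 ltW.
have IF : (\int[sigma]_(x in bd Omega) `|(F x)%:E| = 0)%E.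
  rewrite (eq_integral (EFin \o F)); last first.
    by move=> x; rewrite inE => bx; rewrite /= ger0_norm// F0.
  rewrite -[LHS]fineK; last by apply: integrable_fin_num.
  by congr EFin; rewrite -/(Rintegral _ _ _) RintegralZl//; [rewrite -/(ip _ _ _ _) I0 mulr0|exact: L2M].
have mF : measurable_fun (bd Omega) (EFin \o F) by exact: measurable_int iF.
have := (ae_eq_integral_abs sigma mB mF).1 IF.
apply: filterS => x H bx px; have /eqP := H bx; rewrite /= eqe.
have pe : ball p e x.
  by apply: contrapT => /chiout; rewrite chi1// => /eqP; rewrite oner_eq0.
have -> : F x = ((-1) ^+ b * nu x ord0 i) * (chi x * excess g x) ^+ 2 by rewrite /F /c; ring.
rewrite nuE// mulf_eq0 invr_eq0 (gt_eqF (area0 _))/= sqrf_eq0 chi1// mul1r.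
by rewrite eq_le ge_max lexx andbT subr_le0 => /andP[].
Qed.

Lemma real_trace_le : {ae sigma, forall x, bd Omega x -> g x <= M}.
Proof.
pose P x e := {ae sigma, forall z, bd Omega z -> ball x e z -> g z <= M}.
have [||L [L1 L2]] := @compact_ball_cover R m.+1 (bd Omega) P.
- exact: compact_bd.
- move=> x bx; have [_ _ _ /(_ x bx)[i [b [gam [e ch]]]]] := hO.
  by apply: (local_bound (e := e)); exists i, b, gam.
have := @ae_seq _ _ sigma _ L (fun p z => bd Omega z -> ball p.1 p.2 z -> g z <= M).
move=> /(_ (fun p pL => let: And3 _ _ H := L1 p pL in H)).
apply: filterS => z H bz; have [p pL pz] := L2 z bz; exact: H pL bz pz.
Qed.

End trace_upper_bound.

Lemma real_trace_norm_le f w g (M : R) : real_trace Omega sigma f w g ->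
  {ae leb, forall x, Omega x -> `|f x| <= M} -> {ae sigma, forall x, bd Omega x -> `|g x| <= M}.
Proof.
move=> tr fM.
have H1 : {ae sigma, forall x, bd Omega x -> g x <= M}.
  by apply: real_trace_le tr _; apply: filterS fM => x H Ox; rewrite (le_trans (ler_norm _))// H.
have trN : real_trace Omega sigma (fun x => - f x) (fun i x => - w i x) (fun x => - g x).
  have [fk [sf cf cw cg]] := tr.
  exists (fun k x => - fk k x); split.
  - move=> k; have := smoothM (smooth_cst (-1)) (sf k); congr smooth.
    by apply/funext => x; rewrite mulN1r.
  - exact: L2cvgN.
  - move=> i; have := L2cvgN mO (cw i); congr L2cvg; apply/funext => k; apply/funext => x.
    by rewrite /pd; symmetry; apply: deriveN; exact: (sf k [::]).2.
  - exact: L2cvgN.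
have H2 : {ae sigma, forall x, bd Omega x -> - g x <= M}.
  apply: real_trace_le trN _; apply: filterS fM => x H Ox.
  by rewrite (le_trans (ler_norm _))// normrN H.
by apply: filterS2 H1 H2 => x h1 h2 bx; rewrite ler_norml h1// andbT lerNl h2.
Qed.

End traces.

(** * The indicator functional as a bulk integral *)

Section complex_integral.
Context {d} {T : measurableType d} {R : realType}.
Variables (mu : {measure set T -> \bar R}) (A : set T).
Hypothesis mA : measurable A.
Implicit Types (f g : T -> R[i]).
Local Notation Re := complex.Re.
Local Notation Im := complex.Im.
Local Notation ReF f := (fun x => Re (f x)).
Local Notation ImF f := (fun x => Im (f x)).
Local Open Scope complex_scope.

Definition cL1 f := L1 mu A (ReF f) /\ L1 mu A (ImF f).

Lemma cL1D f g : cL1 f -> cL1 g -> cL1 (fun x => f x + g x).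
Proof.
move=> [f1 f2] [g1 g2]; split.
  by under [X in L1 _ _ X]funext do rewrite ReD; exact: L1D.
by under [X in L1 _ _ X]funext do rewrite ImD; exact: L1D.
Qed.

Lemma cL1N f : cL1 f -> cL1 (fun x => - f x).
Proof.
move=> [f1 f2]; split.
  by under [X in L1 _ _ X]funext do rewrite ReN; exact: L1N.
by under [X in L1 _ _ X]funext do rewrite ImN; exact: L1N.
Qed.

Lemma cL1B f g : cL1 f -> cL1 g -> cL1 (fun x => f x - g x).
Proof. by move=> Lf Lg; apply: cL1D => //; exact: cL1N. Qed.

Lemma cintegralD f g : cL1 f -> cL1 g ->
  cintegral mu A (fun x => f x + g x) = cintegral mu A f + cintegral mu A g.
Proof.
move=> [f1 f2] [g1 g2]; apply: complexP; rewrite ?ReD ?ImD /= -RintegralD//.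
  by apply: eq_Rintegral => x _; rewrite ReD.
by apply: eq_Rintegral => x _; rewrite ImD.
Qed.

Lemma cintegralN f : cL1 f -> cintegral mu A (fun x => - f x) = - cintegral mu A f.
Proof.
move=> [f1 f2]; apply: complexP; rewrite ?ReN ?ImN /= -mulN1r -RintegralZl//.
  by apply: eq_Rintegral => x _; rewrite ReN mulN1r.
by apply: eq_Rintegral => x _; rewrite ImN mulN1r.
Qed.

Lemma cintegralB f g : cL1 f -> cL1 g ->
  cintegral mu A (fun x => f x - g x) = cintegral mu A f - cintegral mu A g.
Proof. by move=> Lf Lg; rewrite cintegralD ?cintegralN//; exact: cL1N. Qed.

Lemma eq_cintegral f g : (forall x, A x -> f x = g x) -> cintegral mu A f = cintegral mu A g.
Proof.
move=> fg; apply: complexP; apply: eq_Rintegral => x; rewrite inE => Ax; by rewrite fg.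
Qed.

Lemma cintegral_sum I (s : seq I) (F : I -> T -> R[i]) : (forall i, cL1 (F i)) ->
  cintegral mu A (fun x => \sum_(i <- s) F i x) = \sum_(i <- s) cintegral mu A (F i).
Proof.
move=> LF; apply: complexP; rewrite ?Re_sum ?Im_sum /= -Rint_sum//.
- by apply: eq_Rintegral => x _; rewrite Re_sum.
- by move=> i; have [] := LF i.
- by apply: eq_Rintegral => x _; rewrite Im_sum.
- by move=> i; have [] := LF i.
Qed.

Lemma ae_eq_Rintegral (f g : T -> R) : measurable_fun A f -> measurable_fun A g ->
  {ae mu, forall x, A x -> f x = g x} -> \int[mu]_(x in A) f x = \int[mu]_(x in A) g x.
Proof.
move=> mf mg fg; congr fine; apply: ae_eq_integral => //; try exact/measurable_EFinP.
by apply: filterS fg => x H Ax; rewrite H.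
Qed.

Lemma ae_eq_cintegral f g : cmeasurable A f -> cmeasurable A g ->
  {ae mu, forall x, A x -> f x = g x} -> cintegral mu A f = cintegral mu A g.
Proof.
move=> [f1 f2] [g1 g2] fg; apply: complexP; apply: ae_eq_Rintegral => //.
  by apply: filterS fg => x H Ax; rewrite H.
by apply: filterS fg => x H Ax; rewrite H.
Qed.

Lemma cL1_mul_conj f g : memL mu A 2%:E f -> memL mu A 2%:E g -> cL1 (fun x => f x * (g x)^*).
Proof.
move=> /(memL2P _ mA)[f1 f2] /(memL2P _ mA)[g1 g2]; split.
  under [X in L1 _ _ X]funext do rewrite ReM Re_conj Im_conj mulrN opprK.
  by apply: L1D => //; exact: L2M.
under [X in L1 _ _ X]funext do rewrite ImM Re_conj Im_conj mulrN.
by apply: L1D => //; [apply: L1N => //|]; exact: L2M.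
Qed.

Lemma cL1_measurable f : cL1 f -> cmeasurable A f.
Proof. by move=> [f1 f2]; split; [exact: L1_measurable f1|exact: L1_measurable f2]. Qed.

Lemma memL2_realM (c : T -> R) (K : R) f : measurable_fun A c -> (forall x, A x -> `|c x| <= K) ->
  memL mu A 2%:E f -> memL mu A 2%:E (fun x => (c x)%:C * f x).
Proof.
move=> mc cK /(memL2P _ mA)[f1 f2]; apply/(memL2P _ mA); split.
  by under [X in L2 _ _ X]funext do rewrite ReM/= mul0r subr0; exact: (L2Mb mA mc cK).
by under [X in L2 _ _ X]funext do rewrite ImM/= mul0r addr0; exact: (L2Mb mA mc cK).
Qed.

End complex_integral.

Section indicator_identity.
Context {R : realType} {m : nat}.
Variables (Omega : set 'rV[R]_m.+1) (sigma : {measure set 'rV[R]_m.+1 -> \bar R})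
  (nu : 'rV[R]_m.+1 -> 'rV[R]_m.+1) (tr : ('rV[R]_m.+1 -> R[i]) -> 'rV[R]_m.+1 -> R[i]).
Hypotheses (hO : @bounded_smooth_domain R m.+1 Omega)
  (hs : @surface_measure R m.+1 Omega sigma)
  (hnu : @outward_unit_normal R m.+1 Omega nu)
  (htr : @trace_operator R m.+1 Omega sigma tr).
Local Notation leb := (lebesgue_rV m.+1 : {measure set 'rV[R]_m.+1 -> \bar R}).
Local Notation Re := complex.Re.
Local Notation Im := complex.Im.
Local Notation ReF f := (fun x => Re (f x)).
Local Notation ImF f := (fun x => Im (f x)).
Local Open Scope complex_scope.
Implicit Types (u v w a b : 'rV[R]_m.+1 -> R[i]) (i : 'I_m.+1).

Let mO : measurable Omega := measurable_Omega hO.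
Let mB : measurable (bd Omega) := measurable_bd Omega.
Local Notation cint := (cintegral leb Omega).

Lemma memH_L2 (s : R) u : memH Omega s u -> memL leb Omega 2%:E u.
Proof. by case. Qed.

Lemma trace_L2 u : memH Omega 1 u -> memL sigma (bd Omega) 2%:E (tr u).
Proof. by move=> /htr[]. Qed.

Lemma trace_real u (w : 'I_m.+1 -> 'rV[R]_m.+1 -> R[i]) : memH Omega 1 u -> (forall i, is_wderiv Omega [:: i] u (w i)) ->
  real_trace Omega sigma (ReF u) (fun i => ReF (w i)) (ReF (tr u)) /\
  real_trace Omega sigma (ImF u) (fun i => ImF (w i)) (ImF (tr u)).
Proof. by move=> Hu Hw; apply: (is_trace_real hO hs _ Hw (htr Hu)); exact: memH_L2 Hu. Qed.

(** Real and imaginary parts are bounded separately, hence the factor 2. *)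
Lemma trace_normy_le u (M : R) : memH Omega 1 u -> {ae leb, forall x, Omega x -> cabs (u x) <= M} ->
  {ae sigma, forall x, bd Omega x -> cabs (tr u x) <= 2 * M}.
Proof.
move=> Hu uM; have [tR tI] := trace_real Hu (fun i => is_wderiv1 i Hu).
have H1 : {ae sigma, forall x, bd Omega x -> `|Re (tr u x)| <= M}.
  apply: (real_trace_norm_le hO hs hnu tR); apply: filterS uM => x H Ox.
  exact: le_trans (le_Re_cabs _) (H Ox).
have H2 : {ae sigma, forall x, bd Omega x -> `|Im (tr u x)| <= M}.
  apply: (real_trace_norm_le hO hs hnu tI); apply: filterS uM => x H Ox.
  exact: le_trans (le_Im_cabs _) (H Ox).
apply: filterS2 H1 H2 => x h1 h2 bx; apply: le_trans (cabs_le _) _.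
by rewrite mulr2n mulrDl mul1r lerD ?h1 ?h2.
Qed.

Lemma complex_green a b (wa wb : 'I_m.+1 -> 'rV[R]_m.+1 -> R[i]) i : memH Omega 1 a -> memH Omega 1 b ->
  (forall i, is_wderiv Omega [:: i] a (wa i)) -> (forall i, is_wderiv Omega [:: i] b (wb i)) ->
  cintegral sigma (bd Omega) (fun x => (nu x ord0 i)%:C * tr a x * (tr b x)^*) =
  cint (fun x => wa i x * (b x)^* + a x * (wb i x)^*).
Proof.
move=> Ha Hb Hwa Hwb.
have [ar ai] := trace_real Ha Hwa; have [br bi] := trace_real Hb Hwb.
have [Lar Lwar Lgar] := real_trace_L2 ar; have [Lai Lwai Lgai] := real_trace_L2 ai.
have [Lbr Lwbr Lgbr] := real_trace_L2 br; have [Lbi Lwbi Lgbi] := real_trace_L2 bi.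
have G := @real_trace_green _ _ _ _ _ hO hs hnu _ _ _ _ _ _ i.
have mnu := measurable_nu hO hnu i; have bnu := nu_bound hO hnu i.
have Lb f g : L2 sigma (bd Omega) f -> L2 sigma (bd Omega) g ->
    L1 sigma (bd Omega) (fun x => nu x ord0 i * f x * g x).
  by move=> Lf Lg; apply: (L2M mB) => //; exact: (L2Mb mB mnu bnu).
have LO := L2M mO.
apply: complexP => /=.
  transitivity (\int[sigma]_(x in bd Omega) (nu x ord0 i * Re (tr a x) * Re (tr b x) + nu x ord0 i * Im (tr a x) * Im (tr b x))).
    by apply: eq_Rintegral => x _; rewrite !ReImE/=; ring.
  rewrite RintegralD//; [|exact: Lb..].
  rewrite (G _ _ _ _ _ _ ar br) (G _ _ _ _ _ _ ai bi) /ip.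
  rewrite -!RintegralD//; try exact: LO; try by apply: (L1D mO); exact: LO.
  by apply: eq_Rintegral => x _; rewrite !ReImE; ring.
transitivity (\int[sigma]_(x in bd Omega) (nu x ord0 i * Im (tr a x) * Re (tr b x) - nu x ord0 i * Re (tr a x) * Im (tr b x))).
  by apply: eq_Rintegral => x _; rewrite !ReImE/=; ring.
rewrite RintegralB//; [|exact: Lb..].
rewrite (G _ _ _ _ _ _ ai br) (G _ _ _ _ _ _ ar bi) /ip.
rewrite -!RintegralD//; try exact: LO.
rewrite -RintegralB//; try by apply: (L1D mO); exact: LO.
by apply: eq_Rintegral => x _; rewrite !ReImE; ring.
Qed.

(** Green's formula is applied along each axis to the pairs (d_i a, v) and (a, d_i v), with a = u
    and a = w. The products of d_i a with the conjugate of d_i v occur in both and cancel, and the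
    boundary terms of the second pairs agree because [u] and [w] have the same trace. *)
Lemma indicator_identity u w v : memH Omega 2 u -> memH Omega 2 w -> memH Omega 2 v ->
  boundary_value Omega sigma tr u (tr v) -> boundary_value Omega sigma tr w (tr v) ->
  indicator_functional Omega sigma tr nu u w (tr v) =
  cint (fun x => (laplacian Omega u x - laplacian Omega w x) * (v x)^* -
                 (u x - w x) * (laplacian Omega v x)^*).
Proof.
move=> Hu Hw Hv bu bw.
have Hu1 := memH2_memH1 Hu; have Hw1 := memH2_memH1 Hw; have Hv1 := memH2_memH1 Hv.
pose D i a := wderiv Omega [:: i] a; pose DD i a := wderiv Omega [:: i; i] a.
have HD i a : memH Omega 2 a -> memH Omega 1 (D i a) by exact: memH1_wderiv.
have WD i a : memH Omega 2 a -> forall j, is_wderiv Omega [:: j] (D i a) (wderiv Omega [:: i; j] a).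
  by move=> Ha j; exact: is_wderiv2.
have W a : memH Omega 2 a -> forall j, is_wderiv Omega [:: j] a (D j a).
  by move=> Ha j; apply: is_wderiv1; exact: memH2_memH1.
have LD i a : memH Omega 2 a -> memL leb Omega 2%:E (D i a) by move=> /(HD i)/memH_L2.
have LDD i a : memH Omega 2 a -> memL leb Omega 2%:E (DD i a) by move=> /(WD i)/(_ i)[].
have L a : memH Omega 2 a -> memL leb Omega 2%:E a by exact: memH_L2.
have P a b : memL leb Omega 2%:E a -> memL leb Omega 2%:E b -> cL1 leb Omega (fun x => a x * (b x)^*).
  exact: cL1_mul_conj.
pose G i a b x := (nu x ord0 i)%:C * tr a x * (tr b x)^*.
have LG i a b : memH Omega 1 a -> memH Omega 1 b -> cL1 sigma (bd Omega) (G i a b).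
  move=> Ha Hb; apply: cL1_mul_conj => //; last exact: trace_L2.
  apply: (memL2_realM mB (K := 1)); [exact: measurable_nu hO hnu i|exact: nu_bound hO hnu i|exact: trace_L2].
rewrite /indicator_functional (@eq_cintegral _ _ _ sigma (bd Omega) _ (fun x => \sum_(i < m.+1) (G i (D i u) v x - G i (D i w) v x))); last first.
  move=> x _; rewrite /normal_derivative -sumrB mulr_suml; apply: eq_bigr => i _.
  by rewrite mulrBl.
have E0 i : cintegral sigma (bd Omega) (G i u (D i v)) = cintegral sigma (bd Omega) (G i w (D i v)).
  apply: (ae_eq_cintegral mB).
  - exact: cL1_measurable (LG i _ _ Hu1 (HD i v Hv)).
  - exact: cL1_measurable (LG i _ _ Hw1 (HD i v Hv)).
  by apply: filterS2 bu bw => x h1 h2 bx; rewrite /G h1// h2.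
pose X i a x := DD i a x * (v x)^* + D i a x * (D i v x)^*.
pose Y i a x := D i a x * (D i v x)^* + a x * (DD i v x)^*.
have LX i a : memH Omega 2 a -> cL1 leb Omega (X i a).
  by move=> Ha; apply: cL1D => //; apply: P; [exact: LDD|exact: L|exact: LD|exact: LD].
have LY i a : memH Omega 2 a -> cL1 leb Omega (Y i a).
  by move=> Ha; apply: cL1D => //; apply: P; [exact: LD|exact: LD|exact: L|exact: LDD].
have GX i a : memH Omega 2 a -> cintegral sigma (bd Omega) (G i (D i a) v) = cint (X i a).
  by move=> Ha; exact: (@complex_green (D i a) v (fun j => wderiv Omega [:: i; j] a) (fun j => D j v) i (HD _ _ Ha) Hv1 (WD _ _ Ha) (W _ Hv)).
have GY i a : memH Omega 2 a -> cintegral sigma (bd Omega) (G i a (D i v)) = cint (Y i a).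
  by move=> Ha; exact: (@complex_green a (D i v) (fun j => D j a) (fun j => wderiv Omega [:: i; j] v) i (memH2_memH1 Ha) (HD _ _ Hv) (W _ Ha) (WD _ _ Hv)).
have LGu i := LG i _ _ (HD i u Hu) Hv1; have LGw i := LG i _ _ (HD i w Hw) Hv1.
rewrite (cintegral_sum mB _ (fun i => cL1B mB (LGu i) (LGw i))).
pose XX i x := X i u x - X i w x; pose YY i x := Y i u x - Y i w x.
have LXX i : cL1 leb Omega (XX i) := cL1B mO (LX i u Hu) (LX i w Hw).
have LYY i : cL1 leb Omega (YY i) := cL1B mO (LY i u Hu) (LY i w Hw).
have LZ i : cL1 leb Omega (fun x => XX i x - YY i x) := cL1B mO (LXX i) (LYY i).
transitivity (\sum_(i < m.+1) cint (fun x => XX i x - YY i x)).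
  apply: eq_bigr => i _; rewrite (cintegralB mB (LGu i) (LGw i)) (GX i u Hu) (GX i w Hw).
  rewrite (cintegralB mO (LXX i) (LYY i)) (cintegralB mO (LX i u Hu) (LX i w Hw)).
  rewrite (cintegralB mO (LY i u Hu) (LY i w Hw)).
  have EY : cint (Y i u) = cint (Y i w) := etrans (esym (GY i u Hu)) (etrans (E0 i) (GY i w Hw)).
  have S0 (p q r s : R[i]) : r = s -> p - q = p - q - (r - s) by move=> ->; rewrite subrr subr0.
  exact: S0 EY.
rewrite -(cintegral_sum mO _ LZ).
apply: eq_cintegral => x _; rewrite /laplacian -sumrB mulr_suml.
rewrite (rmorph_sum (@conjc _)) mulr_sumr -sumrB; apply: eq_bigr => i _.
by rewrite /XX /YY /X /Y /D /DD; ring.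
Qed.

End indicator_identity.

(** * Bounds on the CGO solutions *)

Section exponential_factor.
Context {R : realType} {m : nat}.
Variable Omega : set 'rV[R]_m.+1.
Hypothesis hO : @bounded_smooth_domain R m.+1 Omega.
Local Notation leb := (lebesgue_rV m.+1 : {measure set 'rV[R]_m.+1 -> \bar R}).
Local Notation Re := complex.Re.
Local Notation Im := complex.Im.
Local Notation ReF f := (fun x => Re (f x)).
Local Notation ImF f := (fun x => Im (f x)).
Local Notation memL2 := (memL leb Omega 2%:E).
Local Notation normL2 := (normL leb Omega 2%:E).
Local Open Scope complex_scope.
Implicit Types (u w : 'rV[R]_m.+1 -> R[i]) (i j : 'I_m.+1) (p q x : 'rV[R]_m.+1).

Let mO : measurable Omega := measurable_Omega hO.

Let fin := leb_Omega_lty hO.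

Lemma is_wderivD a u w u' w' : memL2 u -> memL2 w -> is_wderiv Omega a u u' ->
  is_wderiv Omega a w w' -> is_wderiv Omega a (fun x => u x + w x) (fun x => u' x + w' x).
Proof.
move=> /(memL2P _ mO)[u1 u2] /(memL2P _ mO)[w1 w2].
move=> /(is_wderivP hO)[u1' u2' ru1 ru2] /(is_wderivP hO)[w1' w2' rw1 rw2].
have L f : L2 leb Omega f -> L1 leb Omega f by exact: L2_L1.
apply/(is_wderivP hO); split.
- by under [X in L2 _ _ X]funext do rewrite ReD; exact: L2D.
- by under [X in L2 _ _ X]funext do rewrite ImD; exact: L2D.
- have -> : ReF (fun x => u x + w x) = fun x => Re (u x) + Re (w x) by apply/funext => x; rewrite ReD.
  have -> : ReF (fun x => u' x + w' x) = fun x => Re (u' x) + Re (w' x) by apply/funext => x; rewrite ReD.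
  by apply: (real_wderivD hO) ru1 rw1; exact: L.
- have -> : ImF (fun x => u x + w x) = fun x => Im (u x) + Im (w x) by apply/funext => x; rewrite ImD.
  have -> : ImF (fun x => u' x + w' x) = fun x => Im (u' x) + Im (w' x) by apply/funext => x; rewrite ImD.
  by apply: (real_wderivD hO) ru2 rw2; exact: L.
Qed.

Lemma is_wderiv_cM a (c : R[i]) u u' : memL2 u -> is_wderiv Omega a u u' ->
  is_wderiv Omega a (fun x => c * u x) (fun x => c * u' x).
Proof.
move=> Lu /[dup] -[Lu' _] /(is_wderivP hO)[_ _ r1 r2].
have L f : L2 leb Omega f -> L1 leb Omega f by exact: L2_L1.
have [u1 u2] := (memL2P _ mO _).1 Lu; have [u1' u2'] := (memL2P _ mO _).1 Lu'.
have [v1 v2] := (memL2P _ mO _).1 (memL2_cM mO c Lu').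
apply/(is_wderivP hO); split=> //.
- have -> : ReF (fun x => c * u x) = fun x => Re c * Re (u x) - Im c * Im (u x) by apply/funext => x; rewrite ReM.
  have -> : ReF (fun x => c * u' x) = fun x => Re c * Re (u' x) - Im c * Im (u' x) by apply/funext => x; rewrite ReM.
  by apply: (real_wderivB hO); try (by apply: (L1Z mO); exact: L); apply: (real_wderivZ hO) => //; exact: L.
- have -> : ImF (fun x => c * u x) = fun x => Re c * Im (u x) + Im c * Re (u x) by apply/funext => x; rewrite ImM.
  have -> : ImF (fun x => c * u' x) = fun x => Re c * Im (u' x) + Im c * Re (u' x) by apply/funext => x; rewrite ImM.
  by apply: (real_wderivD hO); try (by apply: (L1Z mO); exact: L); apply: (real_wderivZ hO) => //; exact: L.
Qed.

Section multiplication.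
Variables (E : 'rV[R]_m.+1 -> R[i]) (lam : 'I_m.+1 -> R[i]).
Hypotheses (sR : smooth (ReF E)) (sI : smooth (ImF E))
  (dR : forall i x, pd i (ReF E) x = Re (lam i * E x))
  (dI : forall i x, pd i (ImF E) x = Im (lam i * E x)).

Let cmE : cmeasurable Omega E.
Proof. by split; apply: continuous_measurable_rV => //; [exact: (sR [::]).1|exact: (sI [::]).1]. Qed.

Let bE : exists K : R, forall x, Omega x -> cabs (E x) <= K.
Proof.
have [K1 _ H1] := continuous_bounded_closure hO (sR [::]).1.
have [K2 _ H2] := continuous_bounded_closure hO (sI [::]).1.
exists (K1 + K2) => x Ox; apply: le_trans (cabs_le _) _.
by apply: lerD; [apply: H1|apply: H2]; exact: subset_closure.
Qed.

(** Comes from the real product rule for the parts of [E] and [u]; the relation d_i E = lam_i E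
    regroups the terms into a multiple of [E], so that the formula can be iterated. *)
Lemma is_wderiv_expM i u w : memL2 u -> is_wderiv Omega [:: i] u w ->
  is_wderiv Omega [:: i] (fun x => E x * u x) (fun x => E x * (w x + lam i * u x)).
Proof.
move=> Lu /[dup] -[Lw _] /(is_wderivP hO)[_ _ r1 r2].
have [K EK] := bE.
have LE : memL2 (fun x => E x * (w x + lam i * u x)).
  by apply: (memL2_cbM mO cmE EK); apply: (memL2D mO) => //; exact: (memL2_cM mO).
have L f : L2 leb Omega f -> L1 leb Omega f by exact: L2_L1.
have [u1 u2] := (memL2P _ mO _).1 Lu; have [w1 w2] := (memL2P _ mO _).1 Lw.
have [e1 e2] := (memL2P _ mO _).1 LE.
have c1 := (sR [::]).1; have c2 := (sI [::]).1.
have d1 : continuous (pd i (ReF E)) := (sR [:: i]).1; have d2 : continuous (pd i (ImF E)) := (sI [:: i]).1.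
have Q (e f : 'rV[R]_m.+1 -> R) : continuous e -> L2 leb Omega f -> L1 leb Omega (fun x => e x * f x).
  by move=> ce Lf; apply: (L1M_continuous hO ce); exact: L.
have M (e f g : 'rV[R]_m.+1 -> R) : smooth e -> L2 leb Omega f -> L2 leb Omega g -> real_wderiv Omega [:: i] f g ->
    real_wderiv Omega [:: i] (fun x => e x * f x) (fun x => e x * g x + pd i e x * f x).
  by move=> se Lf Lg; apply: (real_wderiv_mul hO se); exact: L.
have QQ (e f g : 'rV[R]_m.+1 -> R) : smooth e -> L2 leb Omega f -> L2 leb Omega g ->
    L1 leb Omega (fun x => e x * g x + pd i e x * f x).
  by move=> se Lf Lg; apply: (L1D mO); apply: Q => //; [exact: (se [::]).1|exact: (se [:: i]).1].
apply/(is_wderivP hO); split=> //.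
- have -> : ReF (fun x => E x * u x) = fun x => Re (E x) * Re (u x) - Im (E x) * Im (u x).
    by apply/funext => x; rewrite ReM.
  have -> : ReF (fun x => E x * (w x + lam i * u x)) =
      fun x => (Re (E x) * Re (w x) + pd i (ReF E) x * Re (u x)) -
               (Im (E x) * Im (w x) + pd i (ImF E) x * Im (u x)).
    by apply/funext => x; rewrite dR dI !ReImE; ring.
  apply: (real_wderivB hO); [exact: Q|exact: Q|exact: (QQ _ _ _ sR)|exact: (QQ _ _ _ sI)|exact: (M _ _ _ sR)|exact: (M _ _ _ sI)].
- have -> : ImF (fun x => E x * u x) = fun x => Re (E x) * Im (u x) + Im (E x) * Re (u x).
    by apply/funext => x; rewrite ImM.
  have -> : ImF (fun x => E x * (w x + lam i * u x)) =
      fun x => (Re (E x) * Im (w x) + pd i (ReF E) x * Im (u x)) +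
               (Im (E x) * Re (w x) + pd i (ImF E) x * Re (u x)).
    by apply/funext => x; rewrite dR dI !ReImE; ring.
  apply: (real_wderivD hO); [exact: Q|exact: Q|exact: (QQ _ _ _ sR)|exact: (QQ _ _ _ sI)|exact: (M _ _ _ sR)|exact: (M _ _ _ sI)].
Qed.

(** Each differentiation of [E] costs a factor [L]. With the factor 2 of [normL2D], first
    derivatives give at most 4 L A and second ones 2 (4 L A + 4 L^2 A) <= 16 L^2 A; 20 is a round
    bound. *)
Lemma expM_H2 u0 (u1 : 'I_m.+1 -> 'rV[R]_m.+1 -> R[i]) (u2 : 'I_m.+1 -> 'I_m.+1 -> 'rV[R]_m.+1 -> R[i])
    (K L A : R) :
  (forall x, Omega x -> cabs (E x) <= K) -> 1 <= L -> (forall i, cabs (lam i) <= L) ->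
  memL2 u0 -> (forall i, is_wderiv Omega [:: i] u0 (u1 i)) ->
  (forall i j, is_wderiv Omega [:: j] (u1 i) (u2 i j)) ->
  0 <= K -> normL2 u0 <= A -> (forall i, normL2 (u1 i) <= A) -> (forall i j, normL2 (u2 i j) <= A) ->
  memH Omega 2 (fun x => E x * u0 x) /\
  normH Omega 2 (fun x => E x * u0 x) <= @num_derivs R m 2 * (K * (20 * L ^+ 2 * A)).
Proof.
move=> EK L1' lamL Lu0 H1 H2 K0 A0 A1 A2.
have L0 : 0 <= L by apply: le_trans L1'.
have A_ge0 : 0 <= A by apply: le_trans A0; exact: normL_ge0.
have Lu1 i : memL2 (u1 i) by have [] := H1 i.
have Lu2 i j : memL2 (u2 i j) by have [] := H2 i j.
pose v1 i x := u1 i x + lam i * u0 x.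
pose v1' i j x := u2 i j x + lam i * u1 j x.
pose v2 i j x := v1' i j x + lam j * v1 i x.
have Llu0 i : memL2 (fun x => lam i * u0 x) by exact: (memL2_cM mO).
have Llu1 i j : memL2 (fun x => lam i * u1 j x) by exact: (memL2_cM mO).
have Lv1 i : memL2 (v1 i) by exact: (memL2D mO).
have Lv1' i j : memL2 (v1' i j) by exact: (memL2D mO).
have Llv1 i j : memL2 (fun x => lam j * v1 i x) by exact: (memL2_cM mO).
have Lv2 i j : memL2 (v2 i j) by exact: (memL2D mO).
have W1 i : is_wderiv Omega [:: i] (fun x => E x * u0 x) (fun x => E x * v1 i x).
  exact: is_wderiv_expM.
have Wv1 i j : is_wderiv Omega [:: j] (v1 i) (v1' i j).
  by apply: is_wderivD => //; exact: is_wderiv_cM.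
have W2 i j : is_wderiv Omega [:: j] (fun x => E x * v1 i x) (fun x => E x * v2 i j x).
  exact: is_wderiv_expM.
have W12 i j : is_wderiv Omega [:: i; j] (fun x => E x * u0 x) (fun x => E x * v2 i j x).
  have /(is_wderivP hO)[_ _ a1 a2] := W1 i; have /(is_wderivP hO)[b1 b2 a3 a4] := W2 i j.
  by apply/(is_wderivP hO); split=> //; [exact: real_wderiv_comp a1 a3|exact: real_wderiv_comp a2 a4].
have LEu0 : memL2 (fun x => E x * u0 x) by exact: (memL2_cbM mO cmE EK).
have W0 := is_wderiv_nil hO LEu0.
have Z i f B : memL2 f -> normL2 f <= B -> normL2 (fun x => lam i * f x) <= L * B.
  move=> Lf fB; apply: le_trans (normL2_cM mO _ Lf) _.
  by apply: ler_pM => //; [exact: cabs_ge0|exact: normL_ge0].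
have N1 i : normL2 (v1 i) <= 4 * L * A.
  apply: le_trans (normL2D mO (Lu1 i) (Llu0 i)) _.
  have := Z i _ _ Lu0 A0; have := A1 i; nra.
have N1' i j : normL2 (v1' i j) <= 4 * L * A.
  apply: le_trans (normL2D mO (Lu2 i j) (Llu1 i j)) _.
  have := Z i _ _ (Lu1 j) (A1 j); have := A2 i j; nra.
have LA : L * A <= L ^+ 2 * A by rewrite ler_wpM2r// expr2 ler_peMl.
have N2 i j : normL2 (v2 i j) <= 20 * L ^+ 2 * A.
  apply: le_trans (normL2D mO (Lv1' i j) (Llv1 i j)) _.
  have H3 := Z j _ _ (Lv1 i) (N1 i); have H4 := N1' i j.
  have -> : 20 * L ^+ 2 * A = 20 * (L ^+ 2 * A) by ring.
  have E1 : L * (4 * L * A) = 4 * (L ^+ 2 * A) by ring.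
  rewrite E1 in H3; have E2 : 4 * L * A = 4 * (L * A) by ring.
  rewrite E2 in H4; have : 0 <= L ^+ 2 * A by rewrite mulr_ge0// sqr_ge0.
  lra.
have H2' : has_wderivs Omega 2 (fun x => E x * u0 x).
  move=> [_|i [_|j [|//] _]]; first by exists (fun x => E x * u0 x).
    by exists (fun x => E x * v1 i x).
  by exists (fun x => E x * v2 i j x).
split; first by apply/(memH_nat Omega 2).
apply: (@normH_nat_le _ _ Omega 2) => //.
  by rewrite mulr_ge0// mulr_ge0// mulr_ge0// sqr_ge0.
have NE a f : is_wderiv Omega a (fun x => E x * u0 x) (fun x => E x * f x) -> memL2 f ->
    normL2 f <= 20 * L ^+ 2 * A ->
    normL2 (wderiv Omega a (fun x => E x * u0 x)) <= K * (20 * L ^+ 2 * A).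
  move=> Wf Lf fB.
  rewrite (normL2_ae hO (w := fun x => E x * f x)).
  - apply: le_trans (normL2_cbM mO K0 cmE EK Lf) _; exact: ler_wpM2l.
  - by have [] := wderivP (ex_intro _ _ Wf).
  - by have [] := Wf.
  - exact: (wderiv_ae hO Wf).
have LLA : A <= L ^+ 2 * A by rewrite ler_peMl// expr_ge1.
move=> [_|i [_|j [|//] _]].
- apply: NE W0 Lu0 _; apply: le_trans A0 _.
  have -> : 20 * L ^+ 2 * A = 20 * (L ^+ 2 * A) by ring.
  have : 0 <= L ^+ 2 * A by rewrite mulr_ge0// sqr_ge0.
  lra.
- apply: NE (W1 i) (Lv1 i) _; apply: le_trans (N1 i) _.
  have -> : 20 * L ^+ 2 * A = 20 * (L ^+ 2 * A) by ring.
  have -> : 4 * L * A = 4 * (L * A) by ring.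
  have : 0 <= L ^+ 2 * A by rewrite mulr_ge0// sqr_ge0.
  lra.
- exact: NE (W12 i j) (Lv2 i j) (N2 i j).
Qed.

End multiplication.

(** Carries the equation from the CGO solution over to its rescaling. *)
Lemma laplacian_realM (c : R) u : memH Omega 2 u ->
  {ae leb, forall x, Omega x ->
     laplacian Omega (fun y => c%:C * u y) x = c%:C * laplacian Omega u x}.
Proof.
move=> Hu; have Lu : memL2 u by exact: memH_L2 Hu.
have H (i : 'I_m.+1) : {ae leb, forall x, Omega x ->
    wderiv Omega [:: i; i] (fun y => c%:C * u y) x = c%:C * wderiv Omega [:: i; i] u x}.
  apply: (wderiv_ae hO); apply: is_wderiv_cM => //; apply: wderivP.
  by have [_] := (memH_nat Omega 2 u).1 Hu; apply.
have := @ae_seq _ _ _ leb _ (index_enum 'I_m.+1) (fun i x => Omega x ->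
    wderiv Omega [:: i; i] (fun y => c%:C * u y) x = c%:C * wderiv Omega [:: i; i] u x) (fun i _ => H i).
apply: filterS => x Hx Ox; rewrite /laplacian mulr_sumr; apply: eq_bigr => i _.
by apply: Hx => //; exact: mem_index_enum.
Qed.

End exponential_factor.

Section exponential_wave.
Context {R : realType} {n : nat}.
Local Notation Re := complex.Re.
Local Notation Im := complex.Im.
Local Notation ReF f := (fun x => Re (f x)).
Local Notation ImF f := (fun x => Im (f x)).
Local Open Scope complex_scope.
Implicit Types (p q x y : 'rV[R]_n) (i : 'I_n).

Lemma dotZl (c : R) p x : dot (c *: p) x = c * dot p x.
Proof. by rewrite /dot mulr_sumr; apply: eq_bigr => i _; rewrite mxE mulrA. Qed.

Lemma smooth_dot p : smooth (dot p).
Proof.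
apply: (@smooth_sum _ _ _ _ (fun i (x : 'rV[R]_n) => p ord0 i * x ord0 i)) => i.
by apply: smoothM; [exact: smooth_cst|exact: smooth_coord].
Qed.

Lemma pd_dot i p x : pd i (dot p) x = p ord0 i.
Proof.
have H (s : seq 'I_n) : is_derive x (basis_vec i) (fun x : 'rV[R]_n => \sum_(k <- s) p ord0 k * x ord0 k)
    (\sum_(k <- s) p ord0 k * (k == i)%:R).
  elim: s => [|k s IH].
    rewrite big_nil; under eq_fun do rewrite big_nil; exact: is_derive_cst.
  rewrite big_cons; under eq_fun do rewrite big_cons.
  exact: is_deriveD (is_deriveZ (p ord0 k) (is_derive_coord k i x)) IH.
have [_ H'] := H (index_enum 'I_n); apply: etrans H' _.
by rewrite (bigD1 i)//= eqxx mulr1 big1 ?addr0// => j /negbTE ->; rewrite mulr0.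
Qed.

(** This is k exp((p + i q).x), written through its real and imaginary parts so that the real
    smoothness results apply to them; each d_i acts on it as multiplication by p_i + i q_i. *)
Definition exp_wave (k : R) p q x : R[i] :=
  (k * expR (dot p x) * cos (dot q x)) +i* (k * expR (dot p x) * sin (dot q x)).

Let smooth_amp (k : R) p : smooth (fun x => k * expR (dot p x)).
Proof. by apply: smoothM; [exact: smooth_cst|apply: smooth_expR; exact: smooth_dot]. Qed.

Let smooth_cos q : smooth (fun x => cos (dot q x)).
Proof.
rewrite (_ : (fun x => _) = fun x => 0 * sin (dot q x) + 1 * cos (dot q x)).
  by apply: smooth_trig; exact: smooth_dot.
by apply/funext => x; rewrite mul0r add0r mul1r.
Qed.

Let smooth_sin q : smooth (fun x => sin (dot q x)).
Proof.
rewrite (_ : (fun x => _) = fun x => 1 * sin (dot q x) + 0 * cos (dot q x)).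
  by apply: smooth_trig; exact: smooth_dot.
by apply/funext => x; rewrite mul0r addr0 mul1r.
Qed.

Lemma smooth_exp_wave_Re k p q : smooth (ReF (exp_wave k p q)).
Proof. exact: smoothM (smooth_amp k p) (smooth_cos q). Qed.

Lemma smooth_exp_wave_Im k p q : smooth (ImF (exp_wave k p q)).
Proof. exact: smoothM (smooth_amp k p) (smooth_sin q). Qed.

Let pd_comp (phi : R -> R) (d : R) i q x : is_derive (dot q x) (1 : R) phi d ->
  pd i (fun x => phi (dot q x)) x = d * q ord0 i.
Proof.
move=> [dphi phiE].
have [_ H] := @is_derive_comp R n phi (dot q) x (basis_vec i) ((smooth_dot q [::]).2 i x) dphi.
apply: etrans H _.
by rewrite phiE -[X in _ * X = _]/(pd i (dot q) x) pd_dot.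
Qed.

Let pd_amp k i p x : pd i (fun x => k * expR (dot p x)) x = p ord0 i * (k * expR (dot p x)).
Proof.
rewrite (pdM (f := cst k)).
- have -> : pd i (cst k) x = 0 by exact: derive_cst.
  by rewrite (pd_comp i (is_derive_expR _)) /=; ring.
- exact: derivable_cst.
- exact: (smooth_expR (smooth_dot p) [::]).2.
Qed.

Lemma pd_exp_wave_Re k p q i x :
  pd i (ReF (exp_wave k p q)) x = Re ((p ord0 i +i* q ord0 i) * exp_wave k p q x).
Proof.
rewrite (pdM (f := fun x => k * expR (dot p x)) (g := fun x => cos (dot q x))); last 2 first.
- exact: (smooth_amp k p [::]).2.
- exact: (smooth_cos q [::]).2.
by rewrite pd_amp (pd_comp i (is_derive_cos _)) /=; ring.
Qed.

Lemma pd_exp_wave_Im k p q i x :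
  pd i (ImF (exp_wave k p q)) x = Im ((p ord0 i +i* q ord0 i) * exp_wave k p q x).
Proof.
rewrite (pdM (f := fun x => k * expR (dot p x)) (g := fun x => sin (dot q x))); last 2 first.
- exact: (smooth_amp k p [::]).2.
- exact: (smooth_sin q [::]).2.
by rewrite pd_amp (pd_comp i (is_derive_sin _)) /=; ring.
Qed.

Lemma rescaled_cgoE (omega omegap : 'rV[R]_n) (J t h : R) (r : 'rV[R]_n -> R[i]) x :
  rescaled_cgo omega omegap J t h r x =
  exp_wave (expR (- ((J - t) / h))) (- h^-1 *: omega) (- h^-1 *: omegap) x * (1 + r x).
Proof.
rewrite /rescaled_cgo /cgo_solution mulrA; congr (_ * _).
have -> : - ((dot omega x +i* dot omegap x) / h%:C) =
    dot (- h^-1 *: omega) x +i* dot (- h^-1 *: omegap) x.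
  rewrite -(fmorphV (real_complex R)) !dotZl; apply: complexP; rewrite ?ReImE /=; ring.
by apply: complexP; rewrite /cexp !ReImE /=; ring.
Qed.

Lemma cabs_rescaled_cgo (omega omegap : 'rV[R]_n) (J t h : R) (r : 'rV[R]_n -> R[i]) x :
  cabs (rescaled_cgo omega omegap J t h r x) =
  expR (- ((J - t + dot omega x) / h)) * cabs (1 + r x).
Proof.
rewrite /rescaled_cgo /cgo_solution cabsM cabsM cabs_real (ger0_norm (expR_ge0 _)) cabs_cexp mulrA -expRD.
congr (expR _ * _); rewrite -(fmorphV (real_complex R)) ReN ReM /=; ring.
Qed.

Lemma coord_le1 (omega : 'rV[R]_n) i : enorm omega = 1 -> `|omega ord0 i| <= 1.
Proof.
move=> o1; have d1 : dot omega omega = 1.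
  rewrite -[LHS]sqr_sqrtr -/(enorm _) ?o1 ?expr1n//.
  by apply: sumr_ge0 => j _; rewrite -expr2 sqr_ge0.
rewrite -(ler_pXn2r (_ : 0 < 2)%N) ?nnegrE// expr1n real_normK ?num_real// -d1.
rewrite /dot (bigD1 i)//= -expr2 lerDl; apply: sumr_ge0 => j _; by rewrite -expr2 sqr_ge0.
Qed.

End exponential_wave.

Section rescaled_cgo_bounds.
Context {R : realType} {m : nat}.
Variable Omega : set 'rV[R]_m.+1.
Hypothesis hO : @bounded_smooth_domain R m.+1 Omega.
Local Notation leb := (lebesgue_rV m.+1 : {measure set 'rV[R]_m.+1 -> \bar R}).
Local Notation Re := complex.Re.
Local Notation Im := complex.Im.
Local Notation ReF f := (fun x => Re (f x)).
Local Notation ImF f := (fun x => Im (f x)).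
Local Notation memL2 := (memL leb Omega 2%:E).
Local Notation normL2 := (normL leb Omega 2%:E).
Local Notation normLy := (normL leb Omega +oo%E).
Local Open Scope complex_scope.
Variables (omega omegap : 'rV[R]_m.+1) (J t h b c : R) (r : 'rV[R]_m.+1 -> R[i]).
Hypotheses (o1 : enorm omega = 1) (op1 : enorm omegap = 1) (h0 : 0 < h) (h1 : h <= 1)
  (Hb : forall x, Omega x -> b <= dot omega x) (Hr : memA2 Omega r) (rc : normA2 Omega r <= c).

Let mO : measurable Omega := measurable_Omega hO.
Let v := rescaled_cgo omega omegap J t h r.
Let E := exp_wave (expR (- ((J - t) / h))) (- h^-1 *: omega) (- h^-1 *: omegap).

Lemma correction_ae : {ae leb, forall x, Omega x -> cabs (r x) <= c}.
Proof.
have [_ [_ ry]] := Hr; apply: filterS (normLy_ae ry) => x H Ox; apply: le_trans (H Ox) _.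
by apply: le_trans rc; rewrite /normA2 lerDr normH_ge0.
Qed.

Lemma rescaled_cgo_ae : {ae leb, forall x, Omega x ->
  cabs (v x) <= (1 + c) * expR (- ((J - t + b) / h))}.
Proof.
apply: filterS correction_ae => x H Ox; rewrite /v cabs_rescaled_cgo mulrC.
apply: ler_pM; [exact: cabs_ge0|exact: expR_ge0| |].
  apply: le_trans (cabsD _ _) _; rewrite (_ : cabs 1 = 1) ?lerD2l ?H//.
  by rewrite (cabs_real 1) normr1.
by rewrite ler_expR lerN2 ler_wpM2r ?invr_ge0 ?(ltW h0)// lerD2l Hb.
Qed.

(** The multiplication estimate with lam_i = -(omega_i + i omegap_i) / h, whose modulus is at most L
    = 2 / h, and L >= 1 because h <= 1. The last factor bounds 1 + r and the derivatives of r in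
    L^2. *)
Lemma rescaled_cgo_H2 : memH Omega 2 v /\
  normH Omega 2 v <= @num_derivs R m 2 *
    (expR (- ((J - t + b) / h)) * (20 * (2 / h) ^+ 2 * (2 * (normL2 (cst 1) + c)))).
Proof.
have -> : v = (fun x => E x * (1 + r x)) by apply/funext => x; rewrite /v rescaled_cgoE.
have [Hr2 _] := Hr; have Lr : memL2 r by exact: memH_L2 Hr2.
have c0 : 0 <= c by apply: le_trans rc; rewrite addr_ge0 ?normH_ge0 ?normL_ge0.
have L1' : memL2 (cst 1).
  apply/(memL2P _ mO); split; apply: (continuous_L2 hO); exact: cst_continuous.
have Hwd := ((memH_nat Omega 2 r).1 Hr2).2.
have nr a : (size a <= 2)%N -> normL2 (wderiv Omega a r) <= c.
  move=> sa; apply: le_trans (normL2_wderiv_le Hwd sa) _; apply: le_trans rc.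
  by rewrite /normA2 lerDl normL_ge0.
have N1 : 0 <= normL2 (cst 1) by exact: normL_ge0.
apply: (@expM_H2 _ _ _ hO E (fun i => (- h^-1 *: omega) ord0 i +i* (- h^-1 *: omegap) ord0 i)
  _ _ _ _ (fun x => 1 + r x) (fun i => wderiv Omega [:: i] r) (fun i j => wderiv Omega [:: i; j] r)).
- exact: smooth_exp_wave_Re.
- exact: smooth_exp_wave_Im.
- exact: pd_exp_wave_Re.
- exact: pd_exp_wave_Im.
- move=> x Ox; have := cabs_rescaled_cgo omega omegap J t h (fun=> 0) x.
  rewrite rescaled_cgoE addr0 mulr1 (_ : cabs 1 = 1) ?mulr1; last by rewrite (cabs_real 1) normr1.
  move=> ->; by rewrite ler_expR lerN2 ler_wpM2r ?invr_ge0 ?(ltW h0)// lerD2l Hb.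
- by rewrite ler_pdivlMr// mul1r (le_trans h1)// ler1n.
- move=> i; apply: le_trans (cabs_le _) _; rewrite /= !mxE !normrM normrN normfV (gtr0_norm h0).
  rewrite (_ : 2 / h = h^-1 * 1 + h^-1 * 1); last by ring.
  by apply: lerD; rewrite ler_wpM2l ?invr_ge0 ?(ltW h0)// coord_le1.
- exact: memL2D.
- move=> i; rewrite (_ : wderiv _ _ _ = fun x => 0 + wderiv Omega [:: i] r x); last first.
    by apply/funext => x; rewrite add0r.
  apply: (is_wderivD hO) => //; last by apply: is_wderiv1; exact: memH2_memH1.
  apply/(is_wderivP hO); split=> //=; try (by apply: (continuous_L2 hO); exact: cst_continuous).
  + have := real_wderiv_smooth hO i (smooth_cst (1 : R)); congr real_wderiv.
    by apply/funext => x; rewrite /pd derive_cst.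
  + have := real_wderiv_smooth hO i (smooth_cst (0 : R)); congr real_wderiv.
    by apply/funext => x; rewrite /pd derive_cst.
- by move=> i j; exact: is_wderiv2.
- exact: expR_ge0.
- apply: le_trans (normL2D mO L1' Lr) _; rewrite ler_wpM2l// lerD2l.
  rewrite (normL2_ae hO Lr (w := wderiv Omega [::] r)); first exact: nr.
    by have [] := wderivP (Hwd [::] _).
  apply: filterS (wderiv_ae hO (is_wderiv_nil hO Lr)) => x H Ox; by rewrite H.
- by move=> i; apply: le_trans (nr _ _) _ => //; lra.
- by move=> i j; apply: le_trans (nr _ _) _ => //; lra.
Qed.

Lemma rescaled_cgo_A2 : memA2 Omega v.
Proof.
have [Hv _] := rescaled_cgo_H2; split=> //; split; first by case: Hv => -[].
apply: le_lt_trans (ltry ((1 + c) * expR (- ((J - t + b) / h)))).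
apply: enormLy_le rescaled_cgo_ae; rewrite mulr_ge0 ?expR_ge0// addr_ge0//.
by apply: le_trans rc; rewrite addr_ge0 ?normH_ge0 ?normL_ge0.
Qed.

Lemma rescaled_cgo_solves q0 : solves_schrodinger Omega q0 (cgo_solution omega omegap h r) ->
  solves_schrodinger Omega q0 v.
Proof.
move=> [Hc eqc]; split; first by case: rescaled_cgo_H2.
have H := laplacian_realM hO (expR (- ((J - t) / h))) Hc.
apply: filterS2 H eqc => x h2 h3 Ox; rewrite /v /rescaled_cgo h2//.
by rewrite mulrCA -mulrDr h3// mulr0.
Qed.

End rescaled_cgo_bounds.

(** * Asymptotics *)

Section exponential_scales.
Context {R : realType}.
Implicit Types (h b A : R).

Lemma expRN_div_cvg0 b : 0 < b -> expR (- (b / h)) @[h --> 0^'+] --> (0 : R).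
Proof.
move=> b0; apply/cvgr0Pnorm_le => e e0; near=> h.
have h0 : 0 < h by near: h; exact: nbhs_right_gt.
have he : h <= e * b by near: h; apply: nbhs_right_le; rewrite mulr_gt0.
rewrite ger0_norm ?expR_ge0// expRN -[leRHS]invrK lef_pV2 ?posrE ?expR_gt0 ?invr_gt0//.
apply: (@le_trans _ _ (b / h)); last by apply: le_trans (expR_ge1Dx _); rewrite lerDr.
by rewrite ler_pdivlMr// mulrC ler_pdivrMr// mulrC.
Unshelve. all: by end_near. Qed.

Lemma scaled_expRN_div_cvg0 A b : 0 < b -> A * expR (- (b / h)) @[h --> 0^'+] --> (0 : R).
Proof.
by move=> /expRN_div_cvg0 H; have := cvgM (cvg_cst A) H; rewrite mulr0; apply.
Qed.

Lemma expR_div_cvgy b : 0 < b -> expR (b / h) @[h --> 0^'+] --> +oo.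
Proof.
move=> b0; apply/cvgryPge => A; near=> h.
have h0 : 0 < h by near: h; exact: nbhs_right_gt.
have A1 : 0 < `|A| + 1 by rewrite ltr_wpDl.
have hA : h <= b / (`|A| + 1) by near: h; apply: nbhs_right_le; rewrite divr_gt0.
apply: (@le_trans _ _ (b / h)); last by apply: le_trans (expR_ge1Dx _); rewrite lerDr.
apply: (@le_trans _ _ (`|A| + 1)); first by rewrite (le_trans (ler_norm A))// lerDl.
by rewrite ler_pdivlMr// mulrC -ler_pdivlMr.
Unshelve. all: by end_near. Qed.

(** From exp(y) >= y^2 / 2 at y = b / h. It removes the factor h^-2 left by two derivatives of the
    CGO exponential. *)
Lemma expRN_div_sqr b h : 0 < b -> 0 < h -> (h ^+ 2)^-1 * expR (- (b / h)) <= 2 / b ^+ 2.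
Proof.
move=> b0 h0; have bh : 0 <= b / h by rewrite divr_ge0// ltW.
have := expR_ge1Dxn 1 bh; rewrite expRN => H.
rewrite ler_pdivrMr ?expR_gt0//.
have : (b / h) ^+ 2 / 2 <= expR (b / h) by apply: le_trans H; rewrite lerDr.
have b2 : 0 < 2 / b ^+ 2 by rewrite divr_gt0// exprn_gt0.
rewrite -(ler_pM2l b2); apply: le_trans.
have -> // : 2 / b ^+ 2 * ((b / h) ^+ 2 / 2) = (h ^+ 2)^-1 by field; rewrite !gt_eqF.
Qed.

End exponential_scales.

Lemma cabs_dist {R : realType} (z w : R[i]) : `|cabs (z + w) - cabs z| <= cabs w.
Proof.
rewrite ler_norml; apply/andP; split; last by rewrite lerBlDl cabsD.
have := cabsB (z + w) w; rewrite addrK; lra.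
Qed.

Section power_difference.
Context {R : realType}.
Local Open Scope complex_scope.

(** With s = a / b the claim reduces to 1 - s^alpha <= 1 - s^N <= N (1 - s), the last step being
    Bernoulli's inequality for an integer [N] above [alpha]. The extra factor [a] compensates for
    the power not being Lipschitz at 0 when alpha < 1. *)
Lemma powR_diff_le (alpha P a b : R) (N : nat) : 0 <= alpha -> alpha <= N%:R -> 0 <= a -> a <= b -> b <= P ->
  (b `^ alpha - a `^ alpha) * a <= N%:R * P `^ alpha * (b - a).
Proof.
move=> alpha0 aN a0 ab bP.
have b0 : 0 <= b by apply: le_trans ab.
have ba0 : 0 <= b - a by rewrite subr_ge0.
have [->|an0] := eqVneq a 0.
  by rewrite mulr0 subr0 !mulr_ge0 ?powR_ge0.
have a_gt0 : 0 < a by rewrite lt_def an0.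
have b_gt0 : 0 < b by apply: lt_le_trans ab.
pose s := a / b.
have s0 : 0 < s by rewrite divr_gt0.
have s1 : s <= 1 by rewrite ler_pdivrMr// mul1r.
have aE : a = b * s by rewrite mulrCA divff ?mulr1// gt_eqF.
have sN : s ^+ N <= s `^ alpha.
  by rewrite -powR_mulrn ?(ltW s0)//; apply: ger_powR => //; rewrite s0.
have bern : 1 - s ^+ N <= N%:R * (1 - s).
  elim: N {aN sN} => [|N IH]; first by rewrite expr0 subrr mul0r.
  have sN1 : s ^+ N <= 1 by apply: exprn_ile1 => //; exact: ltW.
  rewrite exprS -natr1.
  have -> : 1 - s * s ^+ N = (1 - s ^+ N) + (1 - s) * s ^+ N by ring.
  rewrite [leRHS]mulrDl mul1r lerD// ler_piMr// subr_ge0//.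
have Pa : b `^ alpha <= P `^ alpha.
  by apply: ge0_ler_powR => //; rewrite nnegrE// (le_trans b0).
have -> : a `^ alpha = b `^ alpha * s `^ alpha by rewrite {1}aE powRM// ltW.
have -> : (b `^ alpha - b `^ alpha * s `^ alpha) * a = b `^ alpha * ((1 - s `^ alpha) * a) by ring.
have -> : N%:R * P `^ alpha * (b - a) = P `^ alpha * (N%:R * (b - a)) by ring.
have H1 : (1 - s `^ alpha) * a <= N%:R * (b - a).
  apply: (@le_trans _ _ (N%:R * (1 - s) * a)).
    by apply: ler_wpM2r => //; apply: le_trans bern; rewrite lerD2l lerN2.
  have -> : b - a = (1 - s) * b by rewrite mulrBl mul1r [s * b]mulrC -aE.
  by rewrite -mulrA ler_wpM2l// ler_wpM2l// subr_ge0.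
apply: (@le_trans _ _ (b `^ alpha * (N%:R * (b - a)))); first by rewrite ler_wpM2l ?powR_ge0.
by rewrite ler_wpM2r ?mulr_ge0.
Qed.

Lemma cpower_diff_le (alpha P : R) (N : nat) (z1 z2 : R[i]) : 0 <= alpha -> alpha <= N%:R ->
  cabs z1 <= P -> cabs z2 <= P ->
  cabs ((cabs z1 `^ alpha)%:C * z1 - (cabs z2 `^ alpha)%:C * z2) <=
  (N%:R + 1) * P `^ alpha * cabs (z1 - z2).
Proof.
move=> alpha0 aN.
wlog le12 : z1 z2 / cabs z1 <= cabs z2 => [H|] z1P z2P.
  have [|/ltW] := leP (cabs z1) (cabs z2) => le12; first exact: H.
  by rewrite -cabsN opprB -(cabsN (z1 - z2)) opprB; exact: H.
(* In this splitting the difference of the powers multiplies the number of smaller modulus, as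
   [powR_diff_le] requires. *)
have -> : (cabs z1 `^ alpha)%:C * z1 - (cabs z2 `^ alpha)%:C * z2 =
  (cabs z2 `^ alpha)%:C * (z1 - z2) - (cabs z2 `^ alpha - cabs z1 `^ alpha)%:C * z1.
  by rewrite rmorphB /=; ring.
apply: le_trans (cabsB _ _) _; rewrite !cabsM !cabs_real.
have mono : cabs z1 `^ alpha <= cabs z2 `^ alpha.
  by apply: ge0_ler_powR => //; rewrite nnegrE cabs_ge0.
rewrite ger0_norm ?powR_ge0// ger0_norm ?subr_ge0// addrC.
have -> : (N%:R + 1) * P `^ alpha * cabs (z1 - z2) =
  N%:R * P `^ alpha * cabs (z1 - z2) + P `^ alpha * cabs (z1 - z2) by ring.
apply: lerD.
  apply: le_trans (powR_diff_le alpha0 aN (cabs_ge0 z1) le12 z2P) _.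
  rewrite ler_wpM2l ?mulr_ge0 ?powR_ge0// lerBlDr.
  have -> : z2 = (z2 - z1) + z1 by rewrite subrK.
  by apply: le_trans (cabsD _ _) _; rewrite subrK -(cabsN (z1 - z2)) opprB.
rewrite ler_wpM2r ?cabs_ge0//; apply: ge0_ler_powR => //; rewrite nnegrE ?cabs_ge0//.
exact: le_trans (cabs_ge0 _) z2P.
Qed.

End power_difference.

Lemma ae_and {d} {T : measurableType d} {R : realType} (mu : {measure set T -> \bar R})
    (P Q : T -> Prop) :
  {ae mu, forall x, P x} -> {ae mu, forall x, Q x} -> {ae mu, forall x, P x /\ Q x}.
Proof. by move=> aP aQ; apply: filterS2 aP aQ => x Px Qx. Qed.

Section ae_integrals.
Context {d} {T : measurableType d} {R : realType}.
Variables (mu : {measure set T -> \bar R}) (A : set T).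
Hypothesis mA : measurable A.
Implicit Types (f g : T -> R).

Lemma L1_ae_bounded f (K : R) : (mu A < +oo)%E -> measurable_fun A f ->
  {ae mu, forall x, A x -> `|f x| <= K} -> L1 mu A f.
Proof.
move=> muA mf fK; have L1K : L1 mu A (cst `|K|) by apply: (L1_bounded mA (K := `|K|)) => // x _; rewrite normr_id.
apply/integrableP; split; first exact/measurable_EFinP.
have /integrableP[_] := L1K; apply: le_lt_trans.
apply: ae_ge0_le_integral => //.
- by apply: measurableT_comp => //; exact/measurable_EFinP.
- by apply: measurableT_comp => //; apply/measurable_EFinP; exact: measurable_cst.
apply: filterS fK => x H Ax; rewrite /= lee_fin normr_id.
by apply: le_trans (H Ax) _; exact: ler_norm.
Qed.

(** Replacing [g] by the maximum of [f] and [g] turns the almost everywhere inequality into one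
    valid everywhere. *)
Lemma ae_le_Rintegral f g : L1 mu A f -> L1 mu A g ->
  {ae mu, forall x, A x -> f x <= g x} -> \int[mu]_(x in A) f x <= \int[mu]_(x in A) g x.
Proof.
move=> f1 g1 fg; have mf := L1_measurable f1; have mg := L1_measurable g1.
have mM : measurable_fun A (fun x => Num.max (f x) (g x)) by exact: measurable_maxr.
have M1 : L1 mu A (fun x => Num.max (f x) (g x)).
  apply: (le_L1 mA mM) (L1D mA (integrable_abse f1) (integrable_abse g1)) => x _ /=.
  by case: (leP (f x) (g x)) => _; rewrite ?lerDr ?lerDl.
rewrite (@ae_eq_Rintegral _ _ _ mu A mA g (fun x => Num.max (f x) (g x)))//.
  by apply: le_Rintegral => // x _; rewrite le_max lexx.
by apply: filterS fg => x H Ax; rewrite max_r// H.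
Qed.

Lemma norm_Rintegral_le f (G : R) : (mu A < +oo)%E -> L1 mu A f ->
  {ae mu, forall x, A x -> `|f x| <= G} -> `|\int[mu]_(x in A) f x| <= G * fine (mu A).
Proof.
move=> muA f1 fG; apply: le_trans (le_normr_Rintegral mA f1) _.
have LG : L1 mu A (cst G) by apply: (L1_bounded mA (K := `|G|)).
by rewrite -(Rintegral_cst _ mA); apply: ae_le_Rintegral => //; exact: integrable_abse f1.
Qed.

Lemma cintegral_le (F : T -> R[i]) (G : R) : (mu A < +oo)%E -> cL1 mu A F ->
  {ae mu, forall x, A x -> cabs (F x) <= G} ->
  cabs (cintegral mu A F) <= 2 * (G * fine (mu A)).
Proof.
move=> muA [FR FI] FG.
apply: le_trans (cabs_le _) _; rewrite mulr2n mulrDl mul1r.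
apply: lerD; apply: norm_Rintegral_le => //.
  by apply: filterS FG => x h Ax; apply: le_trans (le_Re_cabs _) (h Ax).
by apply: filterS FG => x h Ax; apply: le_trans (le_Im_cabs _) (h Ax).
Qed.

End ae_integrals.

Section halfspaces.
Context {R : realType} {n : nat}.
Variables (D : set 'rV[R]_n) (omega : 'rV[R]_n) (t : R).
Hypotheses (oD : open D) (o1 : enorm omega = 1).
Local Notation halfspace := [set x | dot omega x <= t].
Local Notation tstar := (ereal_inf [set (dot omega x)%:E | x in D]).

Let cdot : continuous (dot omega).
Proof. exact: (smooth_dot omega [::]).1. Qed.

Lemma dot_unit : dot omega omega = 1.
Proof.
rewrite -[LHS]sqr_sqrtr -/(enorm _) ?o1 ?expr1n//.
by apply: sumr_ge0 => j _; rewrite -expr2 sqr_ge0.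
Qed.

(** A real bound is extracted because the infimum may be [+oo]; it passes to the closure of [D]
    because the half-space on and above level [t'] is closed. *)
Lemma lt_tstarP : (t%:E < tstar)%E -> exists2 t', t < t' & forall x, closure D x -> t' <= dot omega x.
Proof.
move=> tt; suff [t' tt' H] : exists2 t', t < t' & (t'%:E <= tstar)%E.
  exists t' => // x; have cl : closed [set x | t' <= dot omega x].
    by apply: (@preimage_closed _ _ (dot omega) [set y | t' <= y]); [move=> y _; exact: cdot|exact: closed_ge].
  have sub : D `<=` [set x | t' <= dot omega x].
    by move=> y Dy; rewrite /= -lee_fin; apply: le_trans H _; apply: ereal_inf_lbound; exists y.
  by move=> Dx; have := closureS sub Dx; rewrite -((closure_id _).1 cl).
case: tstar tt => [r rt||//]; first by exists r; rewrite // -lte_fin.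
by move=> _; exists (t + 1); rewrite ?ltrDl// leey.
Qed.

(** [dot omega] attains its minimum on the compact closure, so disjointness forces a strict gap; for
    empty [D] the infimum is [+oo]. *)
Lemma halfspace_closureP (K : set 'rV[R]_n) : compact K -> closure D `<=` K ->
  halfspace `&` closure D = set0 <-> (t%:E < tstar)%E.
Proof.
move=> cK DK; split=> [H|/lt_tstarP[t' tt' H]]; last first.
  apply/seteqP; split=> // x [/= xt /H] /(lt_le_trans tt'); by rewrite ltNge xt.
have cD : compact (closure D) by apply: subclosed_compact cK DK; exact: closed_closure.
have [D0|/set0P D0] := eqVneq (closure D) set0.
  rewrite (_ : [set _ | x in D] = set0) ?ereal_inf0 ?ltry//.
  rewrite -subset0 => y [x Dx _]; have := subset_closure Dx; by rewrite D0.
have [x0 cx0 x0min] := @compact_EVT_min _ R (dot omega) _ D0 cD (continuous_subspaceT cdot).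
apply: (@lt_le_trans _ _ (dot omega x0)%:E).
  rewrite lte_fin ltNge; apply/negP => x0t; rewrite inE in cx0.
  by have : (halfspace `&` closure D) x0 by []; rewrite H.
apply: le_ereal_inf_tmp => _ [x Dx <-]; rewrite lee_fin; apply: x0min; rewrite inE.
exact: subset_closure.
Qed.

(** [D] is open, so from a point of the half-space a small move against [omega] stays in [D] and
    makes the inequality strict. *)
Lemma halfspace_openP : halfspace `&` D !=set0 <-> (tstar < t%:E)%E.
Proof.
split=> [[x [/= xt Dx]]|/ereal_inf_lt[_ [x Dx <-] xt]]; last first.
  by exists x; split=> //=; rewrite ltW// -lte_fin.
have [e e0 eD] := open_obox_sub oD Dx.
pose y := x - (e / 2) *: omega.
have Dy : D y.
  apply: eD; rewrite -ball_normE /= /y opprB addrC subrK normrZ.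
  rewrite gtr0_norm ?divr_gt0//.
  have on1 : `|omega| <= 1 by apply: norm_le_coord => // i; exact: coord_le1.
  apply: (@le_lt_trans _ _ (e / 2)); last by rewrite gtr_pMr// invf_lt1// ltr1n.
  by rewrite ler_piMr// divr_ge0// ltW.
have dy : dot omega y = dot omega x - e / 2.
  have -> : dot omega y = dot omega x - e / 2 * dot omega omega.
    by rewrite /dot mulr_sumr -sumrB; apply: eq_bigr => i _; rewrite !mxE; ring.
  by rewrite dot_unit mulr1.
apply: (@le_lt_trans _ _ (dot omega y)%:E); first by apply: ereal_inf_lbound; exists y.
have e2 : 0 < e / 2 by rewrite divr_gt0.
by rewrite lte_fin dy; lra.
Qed.

End halfspaces.

Section main_term.
Context {R : realType} {m : nat}.
Variables (Omega : set 'rV[R]_m.+1) (sigma : {measure set 'rV[R]_m.+1 -> \bar R})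
  (nu : 'rV[R]_m.+1 -> 'rV[R]_m.+1) (tr : ('rV[R]_m.+1 -> R[i]) -> 'rV[R]_m.+1 -> R[i]).
Hypotheses (hO : @bounded_smooth_domain R m.+1 Omega)
  (hs : @surface_measure R m.+1 Omega sigma)
  (hnu : @outward_unit_normal R m.+1 Omega nu)
  (htr : @trace_operator R m.+1 Omega sigma tr).
Local Notation leb := (lebesgue_rV m.+1 : {measure set 'rV[R]_m.+1 -> \bar R}).
Local Notation Re := complex.Re.
Local Notation Im := complex.Im.
Local Notation ReF f := (fun x => Re (f x)).
Local Notation ImF f := (fun x => Im (f x)).
Local Notation memL2 := (memL leb Omega 2%:E).
Local Open Scope complex_scope.

Let mO : measurable Omega := measurable_Omega hO.

Lemma mul_conj (v : R[i]) : v * v^* = (cabs v ^+ 2)%:C.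
Proof. by apply: complexP; rewrite !ReImE /= ?cabs_sqr; ring. Qed.

Lemma powR_mul_sqr (alpha a : R) : 0 < alpha -> 0 <= a -> a `^ alpha * a ^+ 2 = a `^ (alpha + 2).
Proof.
move=> alpha0 a0; rewrite -powR_mulrn// powRD//.
by apply/implyP => /eqP H; move: alpha0; lra.
Qed.

(** Algebra of the integrand at one point: [U] and [V] stand for the moduli of [u] and [v] to the
    power alpha1, and [d] for the part of q_1 living on [D]. As [q0] is real, the conjugate of [v]
    solves the same equation and [w] drops out. Adding the leading term leaves the remainder of the
    nonlinearity and the effect of replacing [u] by [v]. *)
Lemma main_term_identity (lu lw lv qu u w v q1 q1b d : R[i]) (q0 U V : R) :
  lu + qu * u = 0 -> lw + q0%:C * w = - q1b * V%:C * v -> lv + q0%:C * v = 0 -> q1 = q1b + d ->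
  (lu - lw) * v^* - (u - w) * lv^* + d * (V%:C * (v * v^*)) =
  - ((qu * u - q0%:C * u - q1 * (U%:C * u)) + q1 * (U%:C * u - V%:C * v)) * v^*.
Proof.
move=> /eqP; rewrite addr_eq0 => /eqP -> /eqP; rewrite eq_sym -subr_eq => /eqP <- /eqP.
rewrite addr_eq0 => /eqP -> ->.
by apply: complexP; rewrite !ReImE /=; ring.
Qed.

Variables (D : set 'rV[R]_m.+1) (q1D v : 'rV[R]_m.+1 -> R[i]) (alpha : R).
Hypotheses (oD : open D) (alpha0 : 0 < alpha) (mq : cmeasurable Omega q1D)
  (mv : cmeasurable Omega v).

(* Minus the leading term of the integrand of the indicator functional; [Re] costs
   nothing because [q1D] is real on [D]. *)
Definition main_density x : R := \1_D x * Re (q1D x) * cabs (v x) `^ (alpha + 2).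

Lemma measurable_main_density : measurable_fun Omega main_density.
Proof.
apply: measurable_funM; first apply: measurable_funM.
- by apply: measurable_indic; exact: open_measurable_rV.
- by case: mq.
- by apply: (measurableT_comp (measurable_powR _)); exact: cmeasurable_cabs.
Qed.

Lemma main_density_L1 (P Q : R) : 0 <= P ->
  {ae leb, forall x, Omega x -> cabs (q1D x) <= Q} ->
  {ae leb, forall x, Omega x -> cabs (v x) <= P} -> L1 leb Omega main_density.
Proof.
move=> P0 HQ HP; apply: (L1_ae_bounded mO (K := Q * P `^ (alpha + 2))).
- exact: leb_Omega_lty.
- exact: measurable_main_density.
apply: filterS2 HQ HP => x hq hp Ox; rewrite /main_density normrM.
apply: ler_pM => //.
  rewrite normrM; apply: le_trans (hq Ox); apply: le_trans (le_Re_cabs _).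
  by rewrite -[leRHS]mul1r ler_wpM2r// indicE; case: (x \in D); rewrite ?normr1 ?normr0.
rewrite ger0_norm ?powR_ge0//; apply: ge0_ler_powR; rewrite ?nnegrE ?cabs_ge0 ?hp//.
by rewrite addr_ge0// ltW.
Qed.

Variables (q : 'rV[R]_m.+1 -> R -> R[i]) (q0 : 'rV[R]_m.+1 -> R) (q1 q1b : 'rV[R]_m.+1 -> R[i])
  (u w v' : 'rV[R]_m.+1 -> R[i]) (alpha2 Cs Q QD P Nd : R) (N : nat).
Hypotheses (Hu : memH Omega 2 u) (Hw : memH Omega 2 w) (Hv : memH Omega 2 v)
  (bu : boundary_value Omega sigma tr u (tr v)) (bw : boundary_value Omega sigma tr w (tr v))
  (eq_u : {ae leb, forall x, Omega x -> laplacian Omega u x + q x (cabs (u x)) * u x = 0})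
  (eq_w : {ae leb, forall x, Omega x -> laplacian Omega w x + (q0 x)%:C * w x =
     - q1b x * (cabs (v' x) `^ alpha)%:C * v' x})
  (vv' : {ae leb, forall x, Omega x -> v x = v' x})
  (eq_v : {ae leb, forall x, Omega x -> laplacian Omega v x + (q0 x)%:C * v x = 0})
  (q1E : {ae leb, forall x, Omega x -> q1 x = q1b x + (\1_D x)%:C * q1D x})
  (q1D_real : {ae leb, forall x, D x -> Im (q1D x) = 0})
  (q1Q : {ae leb, forall x, Omega x -> cabs (q1 x) <= Q})
  (q1DQ : {ae leb, forall x, Omega x -> cabs (q1D x) <= QD})
  (nonlin : {ae leb, forall x, Omega x -> forall z1 z2 : R[i],
     cabs z1 <= 1 -> cabs z2 <= 1 ->
     cabs (q x (cabs z1) * z1 - q x (cabs z2) * z2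
           - (q0 x)%:C * (z1 - z2)
           - q1 x * ((cabs z1 `^ alpha)%:C * z1 - (cabs z2 `^ alpha)%:C * z2))
     <= Cs * (cabs z1 `^ alpha2 + cabs z2 `^ alpha2) * cabs (z1 - z2)})
  (alpha20 : 0 < alpha2) (alphaN : alpha <= N%:R) (Cs0 : 0 <= Cs) (Q0 : 0 <= Q) (P0 : 0 <= P)
  (Nd0 : 0 <= Nd)
  (u1 : {ae leb, forall x, Omega x -> cabs (u x) <= 1})
  (uP : {ae leb, forall x, Omega x -> cabs (u x) <= P})
  (vP : {ae leb, forall x, Omega x -> cabs (v x) <= P})
  (uv : {ae leb, forall x, Omega x -> cabs (u x - v x) <= Nd}).

(** The first summand stands for the remainder of order alpha2 + 1, the second for the replacement
    of [u] by [v]; the last [P] bounds the conjugate of [v] that multiplies both. *)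
Let G := (Cs * P `^ alpha2 * P + Q * ((N%:R + 1) * P `^ alpha * Nd)) * P.

Let F x := (laplacian Omega u x - laplacian Omega w x) * (v x)^* -
  (u x - w x) * (laplacian Omega v x)^*.

Let F_bound : {ae leb, forall x, Omega x -> cabs (F x + (main_density x)%:C) <= G}.
Proof.
have K1 := ae_and (ae_and eq_u eq_w) (ae_and vv' eq_v).
have K2 := ae_and (ae_and q1E q1D_real) (ae_and q1Q nonlin).
have K3 := ae_and (ae_and u1 uP) (ae_and vP uv).
apply: filterS (ae_and K1 (ae_and K2 K3)).
move=> x [[[h1 h2] [h3 h4]] [[[h5 h6] [h7 h8]] [[h9 h10] [h11 h12]]]] Ox.
have {}h1 := h1 Ox; have {}h2 := h2 Ox; have {}h3 := h3 Ox; have {}h4 := h4 Ox.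
have {}h5 := h5 Ox; have {}h7 := h7 Ox; have {}h8 := h8 Ox; have {}h9 := h9 Ox.
have {}h10 := h10 Ox; have {}h11 := h11 Ox; have {}h12 := h12 Ox.
rewrite -h3 in h2.
have dE : (main_density x)%:C = (\1_D x)%:C * q1D x * ((cabs (v x) `^ alpha)%:C * (v x * (v x)^*)).
  have qE : (\1_D x)%:C * q1D x = (\1_D x * Re (q1D x))%:C.
    rewrite rmorphM /= indicE; case: (boolP (x \in D)) => [xD|_]; last by rewrite !mul0r.
    by congr (_ * _); apply: complexP => //=; apply: h6; rewrite inE in xD.
  by rewrite qE mul_conj -rmorphM /= powR_mul_sqr ?cabs_ge0// -rmorphM.
rewrite /F dE (main_term_identity (cabs (u x) `^ alpha) h1 h2 h4 h5) cabsM cabsN cabs_conj /G.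
apply: ler_pM; [exact: cabs_ge0|exact: cabs_ge0| |exact: h11].
apply: le_trans (cabsD _ _) _; apply: lerD.
  (* The structural inequality with z2 = 0: positive powers of 0 vanish, so the remainder is at most
     Cs |u|^(alpha2 + 1). *)
  have := h8 (u x) 0 h9; rewrite cabs0 => /(_ ler01).
  rewrite powR0 ?gt_eqF// powR0 ?gt_eqF// !mulr0 !subr0 addr0 => H; apply: le_trans H _.
  rewrite -!mulrA ler_wpM2l//; apply: ler_pM; [exact: powR_ge0|exact: cabs_ge0| |exact: h10].
  by apply: ge0_ler_powR; rewrite ?nnegrE ?cabs_ge0// ltW.
rewrite cabsM; apply: ler_pM; [exact: cabs_ge0|exact: cabs_ge0|exact: h7|].
apply: le_trans (cpower_diff_le (ltW alpha0) alphaN h10 h11) _.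
by rewrite ler_wpM2l// mulr_ge0 ?powR_ge0// addr_ge0.
Qed.

Lemma indicator_main_term :
  cabs (indicator_functional Omega sigma tr nu u w (tr v) + (\int[leb]_(x in Omega) main_density x)%:C)
  <= 2 * (G * fine (leb Omega)).
Proof.
rewrite (indicator_identity hO hs hnu htr Hu Hw Hv bu bw) -/F.
have LL a : memH Omega 2 a -> memL2 (laplacian Omega a).
  move=> Ha; have W i : memL2 (wderiv Omega [:: i; i] a).
    by have [] := wderivP (((memH_nat Omega 2 a).1 Ha).2 [:: i; i] isT).
  rewrite /laplacian; elim: (index_enum _) => [|i s IH].
    under [X in memL _ _ _ X]funext do rewrite big_nil.
    by apply/(memL2P _ mO); split; apply: (continuous_L2 hO); exact: cst_continuous.
  by under [X in memL _ _ _ X]funext do rewrite big_cons; exact: memL2D.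
have L2N' a : memL2 a -> memL2 (fun x => - a x).
  move=> /(memL2_cM mO (-1)); congr memL; apply/funext => x; exact: mulN1r.
have FL : cL1 leb Omega F.
  apply: (cL1B mO); apply: (cL1_mul_conj mO).
  - by apply: (memL2D mO); [exact: LL|apply: L2N'; exact: LL].
  - exact: memH_L2 Hv.
  - by apply: (memL2D mO); [exact: memH_L2 Hu|apply: L2N'; exact: memH_L2 Hw].
  - exact: LL.
have ML : cL1 leb Omega (fun x => (main_density x)%:C).
  split; first exact: main_density_L1 P0 q1DQ vP.
  by apply: (L1_bounded mO (K := 0)) => //; [exact: leb_Omega_lty|move=> x _; rewrite normr0].
have -> : (\int[leb]_(x in Omega) main_density x)%:C = cintegral leb Omega (fun x => (main_density x)%:C).
  apply: complexP => //=.
  by rewrite Rintegral_cst// mul0r.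
rewrite -(cintegralD mO FL ML).
apply: (cintegral_le mO) F_bound => //; [exact: leb_Omega_lty|exact: (cL1D mO)].
Qed.

End main_term.

Local Open Scope complex_scope.

Theorem theorem3p6 (R : realType) (n : nat)
  (* the domain, with its surface measure, outward unit normal and trace operator *)
  (Omega : set 'rV[R]_n) (sigma : {measure set 'rV[R]_n -> \bar R})
  (nu : 'rV[R]_n -> 'rV[R]_n)
  (tr : ('rV[R]_n -> R[i]) -> 'rV[R]_n -> R[i])
  (* the inclusion and the coefficients *)
  (D : set 'rV[R]_n) (q : 'rV[R]_n -> R -> R[i])
  (s : R) (q0 : 'rV[R]_n -> R) (q1 q1b q1D : 'rV[R]_n -> R[i])
  (mu Cstar alpha1 alpha2 : R)
  (* the solution maps f |-> v_f, u_f and the background approximation *)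
  (C delta0 : R) (v u ub : ('rV[R]_n -> R[i]) -> 'rV[R]_n -> R[i])
  (* the CGO solutions *)
  (omega omegap : 'rV[R]_n) (J t : R)
  (h0 Ccgo : R) (r : R -> 'rV[R]_n -> R[i]) :
  let leb : {measure set 'rV[R]_n -> \bar R} := lebesgue_rV n in
  let q0C : 'rV[R]_n -> R[i] := fun x => (q0 x)%:C in
  let CKerr := Cstar + 2 `^ (Num.max 1 alpha1) * normL leb Omega +oo%E q1 in
  let b := inf [set dot omega x | x in Omega] in
  let B := sup [set dot omega x | x in Omega] in
  let tstar : \bar R := ereal_inf [set (dot omega x)%:E | x in D] in
  let halfspace : set 'rV[R]_n := [set x | dot omega x <= t] in
  let vh (h : R) := rescaled_cgo omega omegap J t h (r h) in
  let fh (h : R) := tr (vh h) in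
  let I (f : 'rV[R]_n -> R[i]) :=
    indicator_functional Omega sigma tr nu (u f) (ub f) f in
  (2 <= n)%N ->
  bounded_smooth_domain Omega ->
  surface_measure Omega sigma ->
  outward_unit_normal Omega nu ->
  trace_operator Omega sigma tr ->
  open D -> closure D `<=` Omega ->
  (* q_0 *)
  n%:R / 2 < s -> 2 < s -> memH Omega s q0C ->
  {ae leb, forall x, Omega x -> q0 x <= 0} ->
  (* q_1 *)
  memL leb Omega +oo%E q1 -> memL leb Omega +oo%E q1b ->
  memL leb Omega +oo%E q1D ->
  {ae leb, forall x, Omega x -> q1 x = q1b x + (\1_D x)%:C * q1D x} ->
  {ae leb, forall x, D x -> complex.Im (q1D x) = 0} ->
  0 < mu ->
  {ae leb, forall x, D x -> mu <= complex.Re (q1D x)} \/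
  {ae leb, forall x, D x -> complex.Re (q1D x) <= - mu} ->
  (* q; Lebesgue measurable means almost everywhere equal to a Borel function *)
  (forall z : R, 0 <= z -> exists2 g : 'rV[R]_n -> R[i], cmeasurable Omega g &
     {ae leb, forall x, Omega x -> q x z = g x}) ->
  0 < Cstar -> 0 < alpha1 -> alpha1 < alpha2 ->
  {ae leb, forall x, Omega x -> forall z1 z2 : R[i],
     cabs z1 <= 1 -> cabs z2 <= 1 ->
     cabs (q x (cabs z1) * z1 - q x (cabs z2) * z2
           - (q0 x)%:C * (z1 - z2)
           - q1 x * ((cabs z1 `^ alpha1)%:C * z1 - (cabs z2 `^ alpha1)%:C * z2))
     <= Cstar * (cabs z1 `^ alpha2 + cabs z2 `^ alpha2) * cabs (z1 - z2)} ->
  (* well-posedness: v_f, u_f and the background approximate solution *)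
  1 < C -> 0 < delta0 -> delta0 < 1 ->
  (forall f, memA32 Omega sigma tr f ->
     unique_with Omega (linear_solution Omega sigma tr q0 f) (v f)) ->
  (forall f, small_data Omega sigma tr delta0 f ->
     unique_with Omega
       (fun w => kerr_solution Omega sigma tr q f w /\
          kerr_estimates Omega sigma tr q0 CKerr C alpha1 f (v f) w) (u f)) ->
  (forall f, small_data Omega sigma tr delta0 f ->
     normL leb Omega +oo%E (u f) <= 1 /\ normL leb Omega +oo%E (v f) <= 1) ->
  (forall f, small_data Omega sigma tr delta0 f ->
     unique_with Omega
       (background_solution Omega sigma tr q0 q1b alpha1 f (v f)) (ub f)) ->
  (* the CGO solutions *)
  enorm omega = 1 -> enorm omegap = 1 -> dot omega omegap = 0 ->
  0 < h0 -> 0 < Ccgo ->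
  (forall h, 0 < h -> h < h0 ->
     [/\ memH Omega s (r h), memA2 Omega (r h),
         normH Omega s (r h) <= Ccgo * h * normH Omega s q0C,
         normA2 Omega (r h) <= Ccgo * h * normH Omega s q0C &
         solves_schrodinger Omega q0 (cgo_solution omega omegap h (r h))]) ->
  Num.max ((B - b) * (2 + 2 * alpha1) / alpha1)
          ((B - b) * (2 + alpha2) / (alpha2 - alpha1)) < J ->
  b < t -> t < B ->
  [/\ halfspace `&` closure D = set0 <-> (t%:E < tstar)%E,
      halfspace `&` D !=set0 <-> (tstar < t%:E)%E,
      halfspace `&` closure D = set0 ->
        expR ((alpha1 + 2) * J / h) * cabs (I (fh h)) @[h --> 0^'+] --> (0 : R) &
      halfspace `&` D !=set0 ->
        expR ((alpha1 + 2) * J / h) * cabs (I (fh h)) @[h --> 0^'+] --> +oo].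
Proof.
(* Charts drop one coordinate, so the theory is set in dimension m + 1; dimension 0 contradicts n >=
   2. *)
destruct n as [|m]; first by [].
move=> leb q0C CKerr b B tstar halfspace vh fh I _ hO hs hnu htr oD DO _ _ _ _.
move=> Hq1 _ Hq1D q1E q1Dre mu0 q1Dsign _ Cs0 a10 a12 nonlin.
move=> C1' d0 d1 Hv Hu Huv1 Hub o1 op1 _ h00 Ccgo0 Hcgo HJ bt tB.
have clD := halfspace_closureP omega t (compact_closure_Omega hO)
  (subset_trans DO (@subset_closure _ Omega)).
have opD := halfspace_openP t oD o1.
have mO : measurable Omega := measurable_Omega hO.
have finO := leb_Omega_lty hO.
have mB : measurable (bd Omega) := measurable_bd Omega.
have DsubO : D `<=` Omega by apply: subset_trans DO; exact: subset_closure.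
have a20 : 0 < alpha2 by exact: lt_trans a12.
(* The real [inf] is a true lower bound only for a set bounded below, which holds because
   [dot omega] is bounded on [Omega]. *)
have bO x : Omega x -> b <= dot omega x.
  have [M M0 HM] := continuous_bounded_closure hO (smooth_dot omega [::]).1.
  move=> Ox; apply: ge_inf; last by exists x.
  exists (- M) => _ [y Oy <-]; have := HM y (subset_closure Oy).
  by rewrite ler_norml => /andP[].
(* [- (J - t + b) = - gam - kap] is the exponent of [sup |v_h|]; [exp (- kap / h)] absorbs the
   factor [h^-2] of the H2 norm. *)
pose gam : R := J - (B - b); pose kap : R := B - t.
have kap0 : 0 < kap by rewrite subr_gt0.
have Bb0 : 0 < B - b by rewrite subr_gt0 (lt_trans bt).
move: HJ; rewrite gt_max => /andP[].
rewrite ltr_pdivrMr// ltr_pdivrMr ?subr_gt0// => HJ1 HJ2.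
(* [b1, b2] are the decay rates of the two errors relative to [exp (- (alpha1 + 2) J / h)];
   they are positive exactly by the two lower bounds on [J]. *)
pose b1 : R := (alpha2 + 2) * gam - (alpha1 + 2) * J.
pose b2 : R := (2 * alpha1 + 2) * gam - (alpha1 + 2) * J.
have b10 : 0 < b1.
  have -> : b1 = J * (alpha2 - alpha1) - (B - b) * (2 + alpha2) by rewrite /b1 /gam; ring.
  by rewrite subr_gt0.
have b20 : 0 < b2.
  have -> : b2 = J * alpha1 - (B - b) * (2 + 2 * alpha1) by rewrite /b2 /gam; ring.
  by rewrite subr_gt0.
have gam0 : 0 < gam.
  have : 0 < alpha1 * gam.
    have -> : alpha1 * gam = b2 + (B - b) * (2 + alpha1) by rewrite /b2 /gam; ring.
    by rewrite addr_gt0// mulr_gt0// addr_gt0.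
  by rewrite pmulr_rgt0.

(* Constants and exponential scales of the estimates *)
pose Hq := normH Omega s q0C; have Hq0 : 0 <= Hq by exact: normH_ge0.
pose c := Ccgo * Hq; have c0 : 0 <= c by rewrite mulr_ge0// ltW.
pose n1 := normL leb Omega 2%:E (cst 1); have n10 : 0 <= n1 by exact: normL_ge0.
pose nd := @num_derivs R m 2; have nd1 : 1 <= nd by exact: num_derivs_ge1.
have nd0 : 0 <= nd by apply: le_trans nd1.
(* What is left of the H^2 bound on [v_h] after taking out h^-2 and the exponential; the 4 comes
   from (2 / h)^2. *)
pose C2 := nd * (20 * 4 * (2 * (n1 + c))).
have C20 : 0 <= C2 by rewrite !mulr_ge0// addr_ge0.
(* The first summand is for the H^{3/2} norm of [fh h], where h^-2 exp(-kap / h) <= 2 / kap^2; the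
   second is for its sup norm, with the 2 of the trace bound. *)
pose K1 := C2 * (2 / kap ^+ 2) + 2 * (1 + c).
have K10 : 0 < K1.
  rewrite ltr_wpDl//; first by rewrite mulr_ge0// divr_ge0// sqr_ge0.
  by rewrite mulr_gt0// ltr_pwDl.
pose N h := K1 * expR (- (gam / h)).
have N0 h : 0 <= N h by rewrite mulr_ge0 ?expR_ge0// ltW.
pose Q := normL leb Omega +oo%E q1; have Q0 : 0 <= Q by exact: normL_ge0.
pose QD := normL leb Omega +oo%E q1D; have QD0 : 0 <= QD by exact: normL_ge0.
pose Qh : R := 1 + normL leb Omega +oo%E q0C.
have Qh1 : 1 <= Qh by rewrite lerDl normL_ge0.
have CQ1 : 1 <= C * Qh by rewrite -[leLHS]mul1r ler_pM// ltW.
have CQ0 : 0 < C * Qh by apply: lt_le_trans CQ1.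
(* [P h] is C Qh times the bound [N h] on the data, hence a bound on the nonlinear solution. With
   its constant moved into the exponent, all its real powers are exponentials and the decay rates
   can be compared exactly. *)
pose k1 := ln (C * Qh * K1).
pose P h := expR (k1 - gam / h).
have PE h : P h = C * Qh * N h.
  by rewrite /P expRD lnK ?posrE; [rewrite /N; ring|rewrite mulr_gt0].
pose KD := CKerr * C `^ (1 + alpha1) * Qh `^ (2 + alpha1).
have CK0 : 0 <= CKerr by rewrite addr_ge0 ?(ltW Cs0)// mulr_ge0 ?powR_ge0.
have KD0 : 0 <= KD by rewrite mulr_ge0 ?powR_ge0// mulr_ge0 ?powR_ge0.
have NP h : N h <= P h by rewrite PE ler_peMl.
(* The integer above alpha1 that Bernoulli's inequality asks for in [powR_diff_le]. *)
pose Nn := (Num.truncn alpha1).+1.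
have alphaN : alpha1 <= Nn%:R by rewrite ltW// truncnS_gt.
pose L := fine (leb Omega); have L0 : 0 <= L by rewrite fine_ge0.
pose A1 := 2 * (Cstar * L); pose A2 := 2 * (Q * (Nn%:R + 1) * KD * L).
(* The remainder has size P^(alpha2 + 2), the replacement of u by v_h has size P^alpha1 P^(1 +
   alpha1) P; both are multiplied here by exp((alpha1 + 2) J / h). *)
pose err h := A1 * expR ((alpha2 + 2) * k1) * expR (- (b1 / h)) +
  A2 * expR ((2 * alpha1 + 2) * k1) * expR (- (b2 / h)).
have err0 : err h @[h --> 0^'+] --> (0 : R).
  have E1 := scaled_expRN_div_cvg0 (A1 * expR ((alpha2 + 2) * k1)) b10.
  have E2 := scaled_expRN_div_cvg0 (A2 * expR ((2 * alpha1 + 2) * k1)) b20.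
  by have := cvgD E1 E2; rewrite addr0; apply.
pose M h := \int[leb]_(x in Omega) main_density D q1D (vh h) alpha1 x.
have hr h : 0 < h -> h < h0 -> h <= 1 -> memA2 Omega (r h) /\ normA2 Omega (r h) <= c.
  move=> hp hh0 h1; have [_ Hr _ rc _] := Hcgo h hp hh0; split=> //; apply: le_trans rc _.
  by rewrite ler_wpM2r// ler_piMr// ltW.
have q1Q : {ae leb, forall x, Omega x -> cabs (q1 x) <= Q} by apply: normLy_ae; case: Hq1.
have q1DQ : {ae leb, forall x, Omega x -> cabs (q1D x) <= QD} by apply: normLy_ae; case: Hq1D.
have Jt : J - t + b = gam + kap by rewrite /gam /kap; ring.
have small : \forall h \near 0^'+, [/\ 0 < h, h < h0, h <= 1 & N h <= delta0].
  near=> h; split.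
  - by near: h; exact: nbhs_right_gt.
  - by near: h; exact: nbhs_right_lt.
  - by near: h; exact: nbhs_right_le.
  - near: h; have : N h @[h --> 0^'+] --> (0 : R).
      exact: scaled_expRN_div_cvg0.
    by move=> /cvgrPdist_le/(_ _ d0); apply: filterS => h; rewrite sub0r normrN ger0_norm.

(* Reduction of the indicator to its main term *)
have key : \forall h \near 0^'+,
    expR ((alpha1 + 2) * J / h) * cabs (I (fh h) + (M h)%:C) <= err h.
  apply: filterS small => h [hp hh0 h1 Nd].
  have [Hr rc] := hr h hp hh0 h1.
  have [_ _ _ _ Hsolve] := Hcgo h hp hh0.
  have vbound := rescaled_cgo_ae omegap J t hp bO Hr rc.
  have [Hv2 Nv2] := rescaled_cgo_H2 hO J t o1 op1 hp h1 bO Hr rc.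
  have HvA := rescaled_cgo_A2 hO J t o1 op1 hp h1 bO Hr rc.
  have Hvs := rescaled_cgo_solves hO J t o1 op1 hp h1 bO Hr rc Hsolve.
  rewrite -/(vh h) in vbound Hv2 Nv2 HvA Hvs.
  set Eg := expR (- (gam / h)); have Eg0 : 0 <= Eg by exact: expR_ge0.
  set Ek := expR (- (kap / h)).
  have Ek1 : Ek <= 1.
    by rewrite -expR0 ler_expR oppr_le0 divr_ge0// ltW.
  have Ev : expR (- ((J - t + b) / h)) = Eg * Ek.
    by rewrite Jt -expRD; congr expR; rewrite mulrDl opprD.
  rewrite Ev in vbound Nv2.
  have {}Nv2 : normH Omega 2 (vh h) <= C2 * (2 / kap ^+ 2) * Eg.
    apply: le_trans Nv2 _.
    have -> : @num_derivs R m 2 * (Eg * Ek * (20 * (2 / h) ^+ 2 *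
        (2 * (normL leb Omega 2%:E (cst 1) + c)))) = C2 * ((h ^+ 2)^-1 * Ek) * Eg.
      by rewrite /C2 /n1 /nd; field; rewrite gt_eqF.
    rewrite ler_wpM2r// ler_wpM2l//; exact: expRN_div_sqr.
  have {}vbound : {ae leb, forall x, Omega x -> cabs (vh h x) <= (1 + c) * Eg}.
    apply: filterS vbound => x H Ox; apply: le_trans (H Ox) _.
    by rewrite ler_wpM2l ?addr_ge0// ler_piMr.
  have Hv1 : memH Omega 1 (vh h) by exact: memH2_memH1.
  have trb := trace_normy_le hO hs hnu htr Hv1 vbound; rewrite -/(fh h) in trb.
  have cEg0 : 0 <= 2 * ((1 + c) * Eg) by rewrite mulr_ge0// mulr_ge0// addr_ge0.
  (* A trace is a priori only in L^2, which supplies measurability; boundedness is the trace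
     estimate. *)
  have memfy : memL sigma (bd Omega) +oo%E (fh h).
    split; first by have [] := trace_L2 htr Hv1.
    exact: le_lt_trans (enormLy_le cEg0 trb) (ltry _).
  have bvv : boundary_value Omega sigma tr (vh h) (fh h) by exact: aeW.
  have fA : memA32 Omega sigma tr (fh h) by split=> //; exists (vh h).
  set E32 := [set normH Omega 2 w | w in [set w | memH Omega 2 w /\ boundary_value Omega sigma tr w (fh h)]].
  have lb32 : lbound E32 0 by move=> _ [w _ <-]; exact: normH_ge0.
  have nf0 : 0 <= normA32 Omega sigma tr (fh h).
    rewrite addr_ge0 ?normL_ge0//; apply: lb_le_inf => //.
    by exists (normH Omega 2 (vh h)); exists (vh h).
  have nfN : normA32 Omega sigma tr (fh h) <= N h.
    rewrite /N -/Eg /K1 mulrDl; apply: lerD.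
      (* In the quotient norm [v_h] itself is an admissible extension of its trace. *)
      apply: le_trans Nv2; apply: ge_inf; first by exists 0.
      by exists (vh h).
    by rewrite -mulrA; exact: normLy_le.
  have sd : small_data Omega sigma tr delta0 (fh h) by split=> //; exact: le_trans nfN Nd.
  have [[[uA ueq ubv] [est1 est2]] _] := Hu _ sd.
  have [[vA _ _] vuniq] := Hv _ fA.
  (* [v_h] solves the linear problem with its own trace as data, so by uniqueness it is the function
     to which the a priori estimates compare u. *)
  have vv : {ae leb, forall x, Omega x -> vh h x = v (fh h) x} by apply: vuniq.
  have [[wH weq wbv] _] := Hub _ sd.
  have [un1 vn1] := Huv1 _ sd.
  have [uH [um uy]] := uA; have [vH [vm vy]] := vA.
  have u1 : {ae leb, forall x, Omega x -> cabs (u (fh h) x) <= 1}.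
    by apply: filterS (normLy_ae uy) => x H Ox; exact: le_trans (H Ox) un1.
  have v1 : {ae leb, forall x, Omega x -> cabs (v (fh h) x) <= 1}.
    by apply: filterS (normLy_ae vy) => x H Ox; exact: le_trans (H Ox) vn1.
  have uP : {ae leb, forall x, Omega x -> cabs (u (fh h) x) <= P h}.
    apply: filterS (normLy_ae uy) => x H Ox; apply: le_trans (H Ox) _.
    apply: (@le_trans _ _ (normA2 Omega (u (fh h)))); first by rewrite lerDr normH_ge0.
    by apply: le_trans est2 _; rewrite PE ler_wpM2l ?(ltW CQ0).
  have vP : {ae leb, forall x, Omega x -> cabs (vh h x) <= P h}.
    apply: filterS vbound => x H Ox; apply: le_trans (H Ox) _; apply: le_trans (NP h).
    rewrite /N -/Eg ler_wpM2r// /K1 -[leLHS]add0r lerD//; first by rewrite mulr_ge0// divr_ge0// sqr_ge0.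
    by rewrite ler_peMl ?addr_ge0// ler1n.
  pose ND := KD * P h `^ (1 + alpha1).
  have uv : {ae leb, forall x, Omega x -> cabs (u (fh h) x - vh h x) <= ND}.
    (* [normL] takes the value 0 when the extended norm is infinite, so finiteness has to be known
       before it bounds anything; here both functions are bounded by 1. *)
    have uvy : (enormL leb Omega +oo%E (fun x => (u (fh h) x - v (fh h) x)%R) < +oo)%E.
      apply: le_lt_trans (ltry 2); apply: enormLy_le => //.
      apply: filterS2 u1 v1 => x H H' Ox; apply: le_trans (cabsB _ _) _.
      by rewrite (_ : 2 = 1 + 1)// lerD ?H ?H'.
    apply: filterS2 (normLy_ae uvy) vv => x H H' Ox; rewrite H'//; apply: le_trans (H Ox) _.
    apply: (@le_trans _ _ (normA2 Omega (fun x => u (fh h) x - v (fh h) x))).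
      by rewrite lerDr normH_ge0.
    apply: le_trans est1 _; rewrite ler_wpM2l//.
    apply: ge0_ler_powR; rewrite ?nnegrE//.
    - by rewrite addr_ge0// ltW.
    - exact: expR_ge0.
    - exact: le_trans nfN (NP h).
  have := @indicator_main_term R m Omega sigma nu tr hO hs hnu htr D q1D (vh h) alpha1 oD a10
    Hq1D.1 HvA.2.1 q q0 q1 q1b (u (fh h)) (ub (fh h)) (v (fh h)) alpha2 Cstar Q QD (P h) ND Nn
    uH wH Hv2 ubv wbv ueq weq vv Hvs.2 q1E q1Dre q1Q q1DQ nonlin a20 alphaN (ltW Cs0)
    (expR_ge0 _) u1 uP vP uv.
  rewrite -/(M h) -/(fh h) -/(I (fh h)) => main.
  rewrite mulrC -ler_pdivlMr ?expR_gt0//; apply: le_trans main _.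
  rewrite ler_pdivlMr ?expR_gt0//.
  have Pa a : P h `^ a = expR (a * (k1 - gam / h)) by rewrite mulrC expRM.
  have t1 : P h `^ alpha2 * P h * P h * expR ((alpha1 + 2) * J / h) =
      expR ((alpha2 + 2) * k1) * expR (- (b1 / h)).
    by rewrite Pa /P -!expRD; congr expR; rewrite /b1; field; rewrite gt_eqF.
  have t2 : P h `^ alpha1 * P h `^ (1 + alpha1) * P h * expR ((alpha1 + 2) * J / h) =
      expR ((2 * alpha1 + 2) * k1) * expR (- (b2 / h)).
    by rewrite !Pa /P -!expRD; congr expR; rewrite /b2; field; rewrite gt_eqF.
  rewrite /err -(mulrA A1) -(mulrA A2) -t1 -t2 le_eqVlt; apply/orP; left; apply/eqP.
  by rewrite /A1 /A2 /ND /L; ring.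
have mdL1 h : 0 < h -> h < h0 -> h <= 1 -> L1 leb Omega (main_density D q1D (vh h) alpha1).
  move=> hp hh0 h1; have [Hr rc] := hr h hp hh0 h1.
  have HvA := rescaled_cgo_A2 hO J t o1 op1 hp h1 bO Hr rc.
  apply: (main_density_L1 hO oD a10 Hq1D.1 HvA.2.1 _ q1DQ (rescaled_cgo_ae omegap J t hp bO Hr rc)).
  by rewrite mulr_ge0 ?expR_ge0// addr_ge0.
have cabsIM h : `|cabs (I (fh h) + (M h)%:C) - cabs (I (fh h))| <= `|M h|.
  by have := cabs_dist (I (fh h)) (M h)%:C; rewrite cabs_real.
have p20 : 0 <= alpha1 + 2 by rewrite addr_ge0// ltW.
have dens_out h x : ~ D x -> main_density D q1D (vh h) alpha1 x = 0.
  by move=> nDx; rewrite /main_density indicE memNset// !mul0r.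
have dens_in h x : D x -> main_density D q1D (vh h) alpha1 x =
    complex.Re (q1D x) * cabs (vh h x) `^ (alpha1 + 2).
  by move=> Dx; rewrite /main_density indicE mem_set// mul1r.
split=> //.

(* The half-space misses the closure of the inclusion: decay *)
- move=> /clD tt; have [t' tt' Ht'] := lt_tstarP tt.
  pose KM := QD * (1 + c) `^ (alpha1 + 2) * L.
  have KMcvg := scaled_expRN_div_cvg0 KM
    (mulr_gt0 (addr_gt0 a10 (ltr0n _ 2)) (etrans (subr_gt0 t t') tt')).
  (* On [D] one has omega.x >= t' > t, so |v_h| <= (1 + c) exp(-(J - t + t') / h) there, and the
     scaling by exp((alpha1 + 2) J / h) leaves the rate (alpha1 + 2)(t' - t). *)
  have Mbound : \forall h \near 0^'+, expR ((alpha1 + 2) * J / h) * `|M h| <=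
      KM * expR (- ((alpha1 + 2) * (t' - t) / h)).
    apply: filterS small => h [hp hh0 h1 _].
    have [Hr rc] := hr h hp hh0 h1.
    pose Gm := QD * ((1 + c) `^ (alpha1 + 2) * expR (- ((alpha1 + 2) * (J - t + t') / h))).
    have Mle : `|M h| <= Gm * L.
      apply: norm_Rintegral_le => //; first exact: mdL1.
      apply: filterS2 (correction_ae Hr rc) q1DQ => x h2 h3 Ox.
      have [Dx|nDx] := pselect (D x); last first.
        by rewrite dens_out// normr0 mulr_ge0// mulr_ge0 ?powR_ge0 ?expR_ge0.
      rewrite dens_in// normrM; apply: ler_pM => //.
        exact: le_trans (le_Re_cabs _) (h3 Ox).
      rewrite ger0_norm ?powR_ge0// /vh cabs_rescaled_cgo mulrC.
      have -> : (1 + c) `^ (alpha1 + 2) * expR (- ((alpha1 + 2) * (J - t + t') / h)) =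
          ((1 + c) * expR (- ((J - t + t') / h))) `^ (alpha1 + 2).
        rewrite powRM ?expR_ge0 ?addr_ge0// -expRM; congr (_ * expR _); ring.
      apply: ge0_ler_powR => //; rewrite ?nnegrE ?mulr_ge0 ?cabs_ge0 ?expR_ge0 ?addr_ge0//.
      apply: ler_pM; rewrite ?cabs_ge0 ?expR_ge0//.
        apply: le_trans (cabsD _ _) _; rewrite (_ : cabs 1 = 1) ?lerD2l ?h2//.
        by rewrite (cabs_real 1) normr1.
      rewrite ler_expR lerN2 ler_wpM2r ?invr_ge0 ?(ltW hp)// lerD2l.
      by apply: Ht'; exact: subset_closure.
    rewrite mulrC -ler_pdivlMr ?expR_gt0//; apply: le_trans Mle _.
    rewrite ler_pdivlMr ?expR_gt0// /Gm /KM le_eqVlt; apply/orP; left; apply/eqP.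
    have -> : expR (- ((alpha1 + 2) * (t' - t) / h)) =
        expR (- ((alpha1 + 2) * (J - t + t') / h)) * expR ((alpha1 + 2) * J / h).
      by rewrite -expRD; congr expR; field; rewrite gt_eqF.
    ring.
  have lim0 : err h + KM * expR (- ((alpha1 + 2) * (t' - t) / h)) @[h --> 0^'+] --> (0 : R).
    by have := cvgD err0 KMcvg; rewrite addr0; apply.
  apply: (squeeze_cvgr _ (cvg_cst 0) lim0).
  apply: filterS2 key Mbound => h h1 h2; apply/andP; split.
    by apply: mulr_ge0; [exact: expR_ge0|exact: cabs_ge0].
  apply: le_trans (lerD h1 h2); rewrite -mulrDr ler_wpM2l ?expR_ge0//.
  by have := cabsIM h; rewrite ler_norml; lra.

(* The half-space meets the inclusion: growth *)
- move=> /opD/ereal_inf_lt[_ [x0 Dx0 <-]]; rewrite lte_fin => x0t.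
  (* Half the gap at [x0]. The part [D'] of [D] where omega.x < t - ep is open and contains [x0], so
     it has positive measure; there the scaled density grows at least like exp((alpha1 + 2) ep /
     h). *)
  pose ep := (t - dot omega x0) / 2.
  have ep0 : 0 < ep by rewrite divr_gt0// subr_gt0.
  pose D' := D `&` [set x | dot omega x < t - ep].
  have oD' : open D'.
    apply: openI => //.
    by apply: (@open_comp _ _ (dot omega) [set y | y < t - ep]); [move=> y _; exact: (smooth_dot omega [::]).1|exact: open_lt].
  have D'x0 : D' x0 by split=> //=; rewrite /ep; lra.
  have mD' : measurable D' by exact: open_measurable_rV.
  have D'O : D' `<=` Omega by move=> x [/DsubO].
  pose l := fine (leb D').
  have l0 : 0 < l.
    rewrite fine_gt0// lebesgue_rV_open_gt0//=; last by exists x0.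
    by apply: le_lt_trans finO; apply: le_measure; rewrite ?inE.
  (* Both sign alternatives for q_{1,D} become a single lower bound after multiplication by 1 or -1,
     which leaves |M h| unchanged. *)
  have [sg [sg1 sgE]] : exists sg : R, `|sg| = 1 /\
      {ae leb, forall x, D x -> mu <= sg * complex.Re (q1D x)}.
    case: q1Dsign => H; [exists 1|exists (-1)]; rewrite ?normrN normr1; split=> //.
      by apply: filterS H => x H Dx; rewrite mul1r H.
    by apply: filterS H => x H Dx; rewrite mulN1r lerNr H.
  pose cM := mu * 2^-1 `^ (alpha1 + 2) * l.
  have cM0 : 0 < cM by rewrite !mulr_gt0// powR_gt0// invr_gt0.
  have Mlow : \forall h \near 0^'+, cM * expR ((alpha1 + 2) * ep / h) <=
      expR ((alpha1 + 2) * J / h) * `|M h|.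
    (* The norm of r is at most c h, so this gives |r| <= 1/2 and |1 + r| >= 1/2 almost everywhere,
       the source of the 1/2 in [cM]. *)
    have ch : \forall h \near 0^'+, h <= (2 * (c + 1))^-1.
      by apply: nbhs_right_le; rewrite invr_gt0 mulr_gt0// ltr_wpDl.
    apply: filterS2 small ch => h [hp hh0 h1 _] hc.
    have [Hr rc] := hr h hp hh0 h1.
    have {}rc : normA2 Omega (r h) <= 2^-1.
      have [_ _ _ rch _] := Hcgo h hp hh0; apply: le_trans rch _.
      rewrite mulrAC -/Hq -/c; apply: (@le_trans _ _ (c * (2 * (c + 1))^-1)).
        exact: ler_wpM2l.
      have c10 : 0 < c + 1 by rewrite ltr_wpDl.
      rewrite ler_pdivrMr ?mulr_gt0// mulrA mulVf// mul1r.
      by rewrite lerDl.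
    pose kx := mu * (2^-1 `^ (alpha1 + 2) * expR (- ((alpha1 + 2) * (J - ep) / h))).
    have kx0 : 0 <= kx by rewrite mulr_ge0 ?(ltW mu0)// mulr_ge0 ?powR_ge0 ?expR_ge0.
    have i1 : L1 leb Omega (\1_D').
      apply: (L1_bounded mO (K := 1)) => //.
      by move=> x _; rewrite indicE; case: (x \in D'); rewrite ?normr1 ?normr0.
    have lE : l = \int[leb]_(x in Omega) \1_D' x.
      by rewrite /Rintegral integral_indic// setIidl.
    (* With the sign [sg] the density is nonnegative on [D] and it is zero off [D], so only the
       contribution of [D'] is kept. *)
    have kl : kx * l <= sg * M h.
      rewrite lE -RintegralZl// -RintegralZl//; last exact: mdL1.
      apply: ae_le_Rintegral => //; [exact: L1Z|by apply: L1Z => //; exact: mdL1|].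
      apply: filterS2 sgE (correction_ae Hr rc) => x h2 h3 Ox.
      have [Dx|nDx] := pselect (D x); last first.
        by rewrite dens_out// indicE memNset ?mulr0//; case.
      rewrite dens_in// mulrA.
      have [D'x|nD'x] := pselect (D' x); last first.
        by rewrite indicE memNset// mulr0 mulr_ge0 ?powR_ge0// (le_trans (ltW mu0))// h2.
      rewrite indicE mem_set// mulr1; apply: ler_pM; rewrite ?(ltW mu0) ?h2 ?mulr_ge0 ?powR_ge0 ?expR_ge0//.
      have -> : 2^-1 `^ (alpha1 + 2) * expR (- ((alpha1 + 2) * (J - ep) / h)) =
          (2^-1 * expR (- ((J - ep) / h))) `^ (alpha1 + 2).
        by rewrite powRM ?expR_ge0 ?invr_ge0// -expRM; congr (_ * expR _); ring.
      apply: ge0_ler_powR => //; rewrite ?nnegrE ?cabs_ge0 ?mulr_ge0 ?expR_ge0 ?invr_ge0//.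
      rewrite /vh cabs_rescaled_cgo mulrC; apply: ler_pM; rewrite ?expR_ge0 ?invr_ge0//.
        rewrite ler_expR lerN2 ler_wpM2r ?invr_ge0 ?(ltW hp)//.
        by have [_ /= D'x2] := D'x; lra.
      have := cabs_dist 1 (r h x); rewrite (_ : cabs 1 = 1); last by rewrite (cabs_real 1) normr1.
      by have := h3 Ox; rewrite ler_norml; lra.
    rewrite [leRHS]mulrC -ler_pdivrMr ?expR_gt0//.
    have -> : cM * expR ((alpha1 + 2) * ep / h) / expR ((alpha1 + 2) * J / h) = kx * l.
      rewrite -expRN /cM /kx.
      have -> : expR (- ((alpha1 + 2) * (J - ep) / h)) =
        expR ((alpha1 + 2) * ep / h) * expR (- ((alpha1 + 2) * J / h)).
        by rewrite -expRD; congr expR; field; rewrite gt_eqF.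
      ring.
    apply: le_trans kl _; apply: le_trans (ler_norm _) _; by rewrite normrM sg1 mul1r.
  have lim : cM * expR ((alpha1 + 2) * ep / h) @[h --> 0^'+] --> +oo.
    by apply: gt0_cvgMry => //; apply: expR_div_cvgy; rewrite mulr_gt0// addr_gt0.
  (* The target is raised to A + 1 to pay for the error, which is eventually at most 1. *)
  apply/cvgryPge => A; have /cvgryPge/(_ (A + 1)) HA := lim.
  have e1 : \forall h \near 0^'+, err h <= 1.
    move/cvgrPdist_le : err0 => /(_ 1 ltr01); apply: filterS => h.
    by rewrite sub0r normrN; apply: le_trans; exact: ler_norm.
  apply: filterS2 (filterI HA e1) (filterI key Mlow) => h [h1 h2] [h3 h4].
  have h5 := cabsIM h.
  have : expR ((alpha1 + 2) * J / h) * `|M h| <= expR ((alpha1 + 2) * J / h) *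
      (cabs (I (fh h) + (M h)%:C) + cabs (I (fh h))).
    rewrite ler_wpM2l ?expR_ge0//; rewrite -cabs_real.
    by have := cabsB (I (fh h) + (M h)%:C) (I (fh h)); rewrite addrAC subrr add0r.
  rewrite mulrDr; lra.
Unshelve. all: by end_near. Qed.
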